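(* Let $d>1$ and let $t\in\partial\mathbb{F}_d$ be a fixed point of the shift map. Let $D_{\mathrm{af},t}$ be the operator on $\ell^2(\mathbb{F}_d)$ given by $$D_{\mathrm{af},t}\delta_\mu=\big(2\chi_{\{0\}}(\ell(\mu,t))-1\big)\,\mathrm{e}^{\,\left||\mu|-2\ell(\mu,t)\right|+\ell(\mu,t)}\,\delta_\mu,\qquad\mu\in\mathbb{F}_d,$$ and $\sigma(a):=|D_{\mathrm{af},t}|a|D_{\mathrm{af},t}|^{-1}$. Let $\mathcal{A}$ be the $*$-algebra generated by $\bigcup_{k\in\mathbb{Z}}\sigma^k\big(C^\infty(\partial\mathbb{F}_d)\rtimes^{\mathrm{alg}}\mathbb{F}_d\big)$, so that $(\mathcal{A},\ell^2(\mathbb{F}_d),D_{\mathrm{af},t},\sigma)$ is the regular finitely summable twisted spectral triple with finite discrete dimension spectrum obtained from saturating the weakly twisted spectral triple $(C^\infty(\partial\mathbb{F}_d)\rtimes^{\mathrm{alg}}\mathbb{F}_d,\ell^2(\mathbb{F}_d),D_{\mathrm{af},t},\sigma)$. Then $(\mathcal{A},\ell^2(\mathbb{F}_d),D_{\mathrm{af},t},\sigma)$ pairs non-trivially with $K_1(\mathcal{A})$, but the cochain $(\phi_m)_{m\ge1,\ m\text{ odd}}$ provided by Moscovici's ansatz is the zero cochain. Hence the equality $$\langle[(\phi_m)_{m\ \mathrm{odd}}],\mathrm{Ch}(x)\rangle=\langle[(\mathcal{A},\ell^2(\mathbb{F}_d),D_{\mathrm{af},t},\sigma)],x\rangle\qquad\text{for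 all }x\in K_1(\mathcal{A})$$ does not hold.
   Context: $\mathbb{F}_d$ is the free group on $d$ generators with symmetric generating set $\{a_1,b_1,\dots,a_d,b_d\}$, $b_j=a_j^{-1}$, and word length $|\cdot|$. $\partial\mathbb{F}_d$ is its Gromov boundary, i.e. the compact space of infinite reduced words $t=t_1t_2t_3\cdots$; the shift map is $t_1t_2t_3\cdots\mapsto t_2t_3\cdots$, so $t$ being a fixed point means $t_j=\gamma_0$ for all $j$, for some generator $\gamma_0$. For $\mu\in\mathbb{F}_d$, $\ell(\mu,t)$ is the number of cancellations needed to put the product $\mu t$ in reduced form. $C^\infty(\partial\mathbb{F}_d)$ is the algebra of locally constant functions on $\partial\mathbb{F}_d$, and $C^\infty(\partial\mathbb{F}_d)\rtimes^{\mathrm{alg}}\mathbb{F}_d$ acts on $\ell^2(\mathbb{F}_d)$ (with basis $(\delta_\mu)_{\mu\in\mathbb{F}_d}$) by $a\lambda_\gamma\delta_\mu=a(\gamma\mu t)\delta_{\gamma\mu}$, $a\in C^\infty(\partial\mathbb{F}_d)$, $\gamma\in\mathbb{F}_d$. Write $D=D_{\mathrm{af},t}$ (invertible, self-adjoint), $H=\ell^2(\mathbb{F}_d)$, $F=D|D|^{-1}$. For $k\in\mathbb{Z}$, $\sigma^k(a)$ is the bounded extension of $|D|^ka|D|^{-k}$. A weakly twisted spectral triple $(\mathcal{A}_0,H,D,\sigma)$: a $*$-algebra $\mathcal{A}_0\subset\mathbb{B}(H)$, a self-adjoint operator $D$, and a partially defined multiplicative map $\sigma$ of $\mathbb{B}(H)$,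 defined on a $*$-subalgebra containing $\mathcal{A}_0$, with $\sigma(a)^*=\sigma^{-1}(a^* )$, such that for $a\in\mathcal{A}_0$: $a\operatorname{Dom}(D)\subset\operatorname{Dom}(D)$, $[D,a]_\sigma:=Da-\sigma(a)D$ is bounded and $a(1+D^2)^{-1/2}$ is compact. It is a twisted spectral triple if moreover $\sigma$ restricts to an automorphism of the algebra. The saturation replaces $\mathcal{A}_0$ by the $*$-algebra generated by $\bigcup_{k\in\mathbb{Z}}\sigma^k(\mathcal{A}_0)$. Finitely summable: $(i+D)^{-1}\in\mathcal{L}^p(H)$ for some $p>0$. Regular: there is a $*$-algebra $\mathcal{B}\subseteq\mathbb{B}(H)$ containing $\mathcal{A}$ and $[D,\mathcal{A}]_\sigma$ to which $\sigma$ extends as a linear isomorphism $\theta$ of $\mathcal{B}$, with $\mathcal{B}$ invariant under $b\mapsto|D|b-\theta(b)|D|$. Let $\Psi$ be the algebra of operators (on $\bigcap_k\operatorname{Dom}(|D|^k)$) generated by $F$, $\mathcal{A}$, $[D,\mathcal{A}]_\sigma$ and $|D|^k$, $k\in\mathbb{Z}$, with $\sigma(T)=|D|T|D|^{-1}$ for $T\in\Psi$. Discrete dimension spectrum: there is a discrete set $\mathrm{Sd}\subseteq\mathbb{C}$ such that for every $T\in\Psi$ the function $\zeta_T(z)=\operatorname{Tr}(T|D|^{-2z})$, $\mathrm{Re}(z)\gg0$, extends meromorphically to $\mathbb{C}$, holomorphic outside $\mathrm{Sd}$; finite if there is $N\in\mathbb{N}$ such that all poles of all $\zeta_T$, $T\in\Psi$,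 have order at most $N$. For $T\in\Psi$ set $T^{(0)}=T$, $T^{(k)}=D^2T^{(k-1)}-\sigma^2(T^{(k-1)})D^2$, and $\tau_j(T)=\mathrm{Res}_{z=0}\,z^j\operatorname{Tr}(T|D|^{-2z})$. Moscovici's ansatz (odd case): for $m\ge1$ odd, $j\in\mathbb{N}$, $\Bbbk=(k_1,\dots,k_m)\in\mathbb{N}^m$ (with $0\in\mathbb{N}$), $|\Bbbk|=\sum k_i$, $$\phi_{m,j,\Bbbk}(a_0,\dots,a_m)=\tau_j\Big(Fa_0[D,\sigma^{-2k_1-1}(a_1)]_\sigma^{(k_1)}\cdots[D,\sigma^{-2(k_1+\cdots+k_m)-1}(a_m)]_\sigma^{(k_m)}|D|^{-2|\Bbbk|-m}\Big),$$ $$\phi_m(a_0,\dots,a_m)=\sum_{\Bbbk\in\mathbb{N}^m}(-1)^{|\Bbbk|}\alpha(\Bbbk)\sum_{j=0}^{|\Bbbk|+(m-1)/2}\tilde\sigma_{|\Bbbk|+(m-1)/2,\,j}\ \phi_{m,j,\Bbbk}(a_0,\dots,a_m),$$ where $\alpha(\Bbbk)^{-1}=k_1!\cdots k_m!\,(k_1+1)(k_1+k_2+2)\cdots(|\Bbbk|+m)$ and $\prod_{l=0}^{n-1}(z+l+\tfrac12)=\sum_{j=0}^nz^j\tilde\sigma_{n,j}$. Pairings: for a unitary $u$ over $\mathcal{A}$, $\langle[(\mathcal{A},H,D,\sigma)],[u]\rangle=\mathrm{Index}(PuP:PH\to PH)$ with $P=(F+1)/2$; ''pairs non-trivially with $K_1(\mathcal{A})$''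 means this is non-zero for some class. $\langle[(\phi_m)],\mathrm{Ch}(u)\rangle=\sum_m\phi_m(\mathrm{Ch}_m(u))$, with $\mathrm{Ch}_{2l+1}(u)=(-1)^l\,l!\,u^*\otimes u\otimes\cdots\otimes u^*\otimes u$ ($2l+2$ factors), up to a universal normalisation, is the pairing with the Chern character. *)

(* Defs.v *)
From HB Require Import structures.
From mathcomp Require Import all_boot all_order all_algebra.
From mathcomp Require Import monoid finmap.
From mathcomp Require Import mathcomp_extra boolp classical_sets functions.
From mathcomp Require Import cardinality fsbigop reals ereal constructive_ereal.
From mathcomp Require Import interval_inference topology normedtype sequences.
From mathcomp Require Import numfun esum exp trigo derive.
From mathcomp Require Import complex ring lra.

Set Implicit Arguments.
Unset Strict Implicit.
Unset Printing Implicit Defensive.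

Import Order.TTheory GRing.Theory Num.Theory.
Import numFieldNormedType.Exports.

Local Open Scope classical_set_scope.
Local Open Scope complex_scope.
Local Open Scope ring_scope.

Section FreeGroup.
Variable d : nat.

(* (j, false) stands for a_j and (j, true) for b_j = a_j^-1. *)
Definition letter : Type := ('I_d * bool)%type.
HB.instance Definition _ := Finite.on letter.

Definition linv (x : letter) : letter := (x.1, ~~ x.2).

Definition no_cancel : rel letter := fun x y => y != linv x.

Definition reduced (w : seq letter) : bool := sorted no_cancel w.

Record fgroup : Type := Fgroup { fword :> seq letter; _ : reduced fword }.
HB.instance Definition _ := [isSub for fword].
HB.instance Definition _ := [Countable of fgroup by <:].

Definition lcons (x : letter) (w : seq letter) : seq letter :=
  if w is y :: w' then if y == linv x then w' else x :: w else [:: x].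

Lemma linvK : involutive linv.
Proof. by case=> j b; rewrite /linv negbK. Qed.

Lemma linv_eq x y : (y == linv x) = (x == linv y).
Proof. by rewrite -(inj_eq (inv_inj linvK)) linvK eq_sym. Qed.

Lemma lcons_reduced x w : reduced w -> reduced (lcons x w).
Proof.
case: w => //= y w yw; case: eqP => [_|/eqP xy]; first exact: path_sorted yw.
by rewrite /= /no_cancel xy.
Qed.

Lemma foldr_lcons_reduced u w : reduced w -> reduced (foldr lcons w u).
Proof. by move=> rw; elim: u => //= x u; exact: lcons_reduced. Qed.

Lemma lconsK x w : reduced w -> lcons (linv x) (lcons x w) = w.
Proof.
case: w => [_|y w /= yw] /=; first by rewrite linvK eqxx.
case: (eqVneq y (linv x)) yw => [->|xy _]; last by rewrite /= linvK eqxx.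
by case: w => [|z w] //= /andP[+ _]; rewrite /no_cancel => /negPf ->.
Qed.

Lemma lconsVK x w : reduced w -> lcons x (lcons (linv x) w) = w.
Proof. by move=> rw; rewrite -{1}(linvK x) lconsK. Qed.

Lemma foldr_lcons_lcons x u w : reduced w ->
  foldr lcons w (lcons x u) = lcons x (foldr lcons w u).
Proof.
case: u => [|y u] //= rw; case: eqP => [->|_] //=.
by rewrite lconsVK// foldr_lcons_reduced.
Qed.

Lemma foldr_lcons_comp u v w : reduced w ->
  foldr lcons w (foldr lcons v u) = foldr lcons (foldr lcons w v) u.
Proof. by move=> rw; elim: u => //= x u IH; rewrite foldr_lcons_lcons// IH. Qed.

Lemma foldr_lcons_nil u : reduced u -> foldr lcons [::] u = u.
Proof.
elim: u => // x u IH /= xu; rewrite IH; last exact: path_sorted xu.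
by case: u xu {IH} => //= y u /andP[+ _]; rewrite /no_cancel => /negPf ->.
Qed.

Lemma sinv_reduced u : reduced u -> reduced (rev (map linv u)).
Proof.
rewrite /reduced rev_sorted sorted_map => /=; apply: sub_sorted => x y.
by rewrite /no_cancel /= linvK eq_sym.
Qed.

Lemma sinvl u w : reduced w ->
  foldr lcons (foldr lcons w u) (rev (map linv u)) = w.
Proof.
elim: u w => // x u IH w rw.
rewrite /= rev_cons foldr_rcons lconsK ?IH//; exact: foldr_lcons_reduced.
Qed.

Definition fgmul (u v : fgroup) : fgroup :=
  Fgroup (foldr_lcons_reduced u (valP v)).

Definition fgone : fgroup := @Fgroup [::] isT.

Definition fginv (u : fgroup) : fgroup := Fgroup (sinv_reduced (valP u)).

Lemma fgmulA : associative fgmul.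
Proof.
by move=> u v w; apply/val_inj; rewrite /= foldr_lcons_comp//; exact: valP.
Qed.

Lemma fgmul1 : left_id fgone fgmul.
Proof. by move=> u; apply/val_inj. Qed.

Lemma fgmulr1 : right_id fgone fgmul.
Proof. by move=> u; apply/val_inj; rewrite /= foldr_lcons_nil//; exact: valP. Qed.

Lemma fgmulV : left_inverse fgone fginv fgmul.
Proof.
move=> u; apply/val_inj => /=.
by have := @sinvl (val u) [::] isT; rewrite foldr_lcons_nil ?(valP u).
Qed.

Lemma fginvK : involutive fginv.
Proof.
by move=> u; apply/val_inj; rewrite /= map_rev revK mapK//; exact: linvK.
Qed.

Lemma fgmulrV : right_inverse fgone fginv fgmul.
Proof. by move=> u; rewrite -{1}(fginvK u) fgmulV. Qed.

HB.instance Definition _ :=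
  isGroup.Build fgroup fgmulA fgmul1 fgmulr1 fgmulV fgmulrV.

End FreeGroup.

Section Boundary.
Variable d : nat.
Local Notation letter := (letter d).
Local Notation fgroup := (fgroup d).

Record boundary : Type := Boundary {
  bseq :> nat -> letter;
  bseq_reduced : forall n, no_cancel (bseq n) (bseq n.+1) }.

Definition shift_map (t : boundary) : boundary :=
  @Boundary (fun n => t n.+1) (fun n => bseq_reduced t n.+1).

Definition bcons_fun (x : letter) (t : boundary) : nat -> letter :=
  if t 0%N == linv x then fun n => t n.+1
  else fun n => if n is n'.+1 then t n' else x.

Lemma bcons_reduced x t n :
  no_cancel (bcons_fun x t n) (bcons_fun x t n.+1).
Proof.
rewrite /bcons_fun; case: ifPn => [_|xt]; first exact: bseq_reduced.
by case: n => [|n] //; exact: bseq_reduced.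
Qed.

Definition bcons (x : letter) (t : boundary) : boundary :=
  Boundary (bcons_reduced x t).

(* the action of F_d on its boundary, i.e. the reduced form of mu t *)
Definition bact (mu : fgroup) (t : boundary) : boundary := foldr bcons t mu.

Fixpoint cancellations (r : seq letter) (t : nat -> letter) : nat :=
  if r is x :: r' then
    if t 0%N == linv x then (cancellations r' (fun n => t n.+1)).+1 else 0
  else 0.

(* In the product mu t the last letter of mu meets the first letter of t. *)
Definition ell (mu : fgroup) (t : boundary) : nat := cancellations (rev mu) t.

(* The sets of points agreeing with t on the first n letters form a basis of
   neighbourhoods of t. *)
Definition locally_constant (X : Type) (a : boundary -> X) : Prop :=
  forall t : boundary, exists n, forall s : boundary,
    (forall i, (i < n)%N -> s i = t i) -> a s = a t.

End Boundary.

Section Sums.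
Variables (R : realType) (I : choiceType).
Local Notation C := (R[i])^o.

Definition modulus (z : C) : R := Normc.normc z.

(* Sums of absolutely summable families. *)
Definition rsum (f : I -> R) : R :=
  fine (\esum_(i in [set: I]) (EFin \o f)^\+ i -
        \esum_(i in [set: I]) (EFin \o f)^\- i)%E.

Definition csum (f : I -> C) : C :=
  rsum (fun i => complex.Re (f i)) +i* rsum (fun i => complex.Im (f i)).

Definition csummable (f : I -> C) : Prop :=
  summable [set: I] (fun i => (modulus (f i))%:E).

End Sums.

Section Ell2.
Variables (R : realType) (I : choiceType).
Local Notation C := (R[i])^o.

Definition sqsum (x : I -> C) : \bar R :=
  (\esum_(i in [set: I]) ((modulus (x i)) ^+ 2)%:E)%E.

Definition square_summable : {pred (I -> C)} := fun x => `[< sqsum x < +oo >]%E.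

Lemma modulus2_ge0 (x : I -> C) i : (0 <= ((modulus (x i)) ^+ 2)%:E)%E.
Proof. by rewrite lee_fin sqr_ge0. Qed.

Lemma modulus2D (a b : C) :
  modulus (a + b) ^+ 2 <= 2 * modulus a ^+ 2 + 2 * modulus b ^+ 2.
Proof.
case: a b => [a1 a2] [b1 b2]; rewrite /modulus /= !sqr_sqrtr ?addr_ge0 ?sqr_ge0//.
rewrite -subr_ge0.
rewrite [leRHS](_ : _ = (a1 - b1) ^+ 2 + (a2 - b2) ^+ 2); last by ring.
by rewrite addr_ge0 ?sqr_ge0.
Qed.

Lemma square_summable_submod : submod_closed square_summable.
Proof.
split; first apply/asboolP.
  rewrite /sqsum esum1 ?ltry// => i _.
  by rewrite /modulus /= !expr0n/= addr0 sqrtr0 expr0n.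
move=> a x y /asboolP sx /asboolP sy; apply/asboolP.
pose n := (Num.truncn (2 * modulus a ^+ 2 + 2)).+1.
have n_ge : 2 * modulus a ^+ 2 + 2 <= n%:R.
  by rewrite ltW// truncnS_gt.
have h : (sqsum (a *: x + y)%R <= \esum_(i in [set: I]) \sum_(j < n)
    ((modulus (x i) ^+ 2)%:E + (modulus (y i) ^+ 2)%:E))%E.
  apply: le_esum => i _.
  rewrite sumEFin lee_fin sumr_const card_ord -mulr_natl.
  apply: (le_trans (modulus2D _ _)).
  have -> : modulus (a * x i) = modulus a * modulus (x i) by exact: Normc.normcM.
  rewrite exprMn mulrA mulrDr lerD// ler_wpM2r ?sqr_ge0//.
    by apply: le_trans n_ge; rewrite lerDl.
  by apply: le_trans n_ge; rewrite lerDr mulr_ge0 ?sqr_ge0.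
apply: le_lt_trans h _; rewrite esum_sum; last first.
  by move=> i j _ _; rewrite adde_ge0// modulus2_ge0.
rewrite lte_sum_pinfty// => j _.
rewrite esumD; first exact: lte_add_pinfty.
all: by move=> i _; exact: modulus2_ge0.
Qed.

HB.instance Definition _ :=
  GRing.isSubmodClosed.Build _ _ square_summable square_summable_submod.

Record ell2 : Type := Ell2 { ell2_val :> I -> C; _ : ell2_val \in square_summable }.
HB.instance Definition _ := [isSub for ell2_val].
HB.instance Definition _ := [Choice of ell2 by <:].
HB.instance Definition _ := [SubChoice_isSubLmodule of ell2 by <:].

Definition hnorm (x : ell2) : R := Num.sqrt (fine (sqsum x)).

Definition inner (x y : ell2) : C := csum (fun i => ((x i)^* * y i)%C).

Lemma delta_square_summable (i : I) :
  ((fun j => (j == i)%:R) : I -> C) \in square_summable.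
Proof.
apply/asboolP; rewrite /sqsum (_ : esum _ _ =
  \esum_(j in [set i]) ((modulus ((j == i)%:R : C)) ^+ 2)%:E)%E.
  by rewrite esum_set1 ?ltry// lee_fin sqr_ge0.
rewrite [RHS]esum_mkcond; apply: eq_esum => j _.
case: ifPn => //; rewrite notin_setE => /= /eqP/negPf ->.
by rewrite /modulus /= !expr0n/= addr0 sqrtr0 expr0n.
Qed.

Definition delta (i : I) : ell2 := Ell2 (delta_square_summable i).

End Ell2.

Section Operators.
Variables (R : realType) (I : choiceType).
Local Notation C := (R[i])^o.
Local Notation H := (ell2 R I).
Local Notation op := (H -> H).

Definition dense_set (U : set H) : Prop :=
  forall (x : H) (e : R), 0 < e -> exists2 y, U y & hnorm (x - y) < e.

Definition bounded_on (U : set H) (T : op) : Prop :=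
  exists M : R, forall x, U x -> hnorm (T x) <= M * hnorm x.

Definition bounded_op (T : op) : Prop := linear T /\ bounded_on setT T.

(* the bounded operator extending the restriction of T to the dense set U, and
   0 if there is none *)
Definition bounded_extension (U : set H) (T : op) : op :=
  xget (0 : op) [set S | [/\ dense_set U, bounded_op S &
                             forall x, U x -> S x = T x]].

(* the adjoint of a bounded operator *)
Definition adj (T : op) : op :=
  xget (0 : op) [set S | bounded_op S /\
                         forall x y, inner (T x) y = inner x (S y)].

(* An unbounded operator is given by its domain and a function that is only
   used there. *)
Definition self_adjoint (U : set H) (T : op) : Prop :=
  [/\ dense_set U,
      forall (c : C) x y, U x -> U y ->
        U (c *: x + y) /\ T (c *: x + y) = c *: T x + T y
    & forall y z, (U y /\ T y = z) <->
        (forall x, U x -> inner (T x) y = inner x z)].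

Definition compact_op (T : op) : Prop :=
  bounded_op T /\
  forall x : nat -> H, (exists M, forall n, hnorm (x n) <= M) ->
    exists (k : nat -> nat) (y : H),
      (forall n, (k n < k n.+1)%N) /\
      (fun n => hnorm (T (x (k n)) - y)) @ \oo --> (0 : R).

Definition rank_le (n : nat) (T : op) : Prop :=
  exists v : 'I_n -> H, forall x, exists c : 'I_n -> C,
    T x = \sum_(i < n) c i *: v i.

(* singular values, as distances to the operators of rank at most n *)
Definition singular_value (T : op) (n : nat) : R :=
  inf [set M : R | 0 <= M /\ exists S, [/\ bounded_op S, rank_le n S &
                     forall x, hnorm (T x - S x) <= M * hnorm x]].

Definition schatten (p : R) (T : op) : Prop :=
  bounded_op T /\ (\sum_(0 <= n <oo) (singular_value T n `^ p)%:E < +oo)%E.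

Definition trace (T : op) : C := csum (fun i => inner (delta R i) (T (delta R i))).

Definition op_algebra (A : set op) : Prop :=
  [/\ A 0,
      forall S T, A S -> A T -> A (S + T),
      forall (c : C) T, A T -> A (c *: T)
    & forall S T, A S -> A T -> A (S \o T)].

Definition star_algebra (A : set op) : Prop :=
  [/\ A `<=` bounded_op, op_algebra A & forall T, A T -> A (adj T)].

(* multiplication by a function; the value is 0 outside of the domain *)
Definition diag_fun (w : I -> C) (x : H) : I -> C := fun i => w i * x i.
Definition diag_dom (w : I -> C) : set H :=
  [set x | diag_fun w x \in @square_summable R I].
Definition diag (w : I -> C) (x : H) : H := insubd 0 (diag_fun w x).

End Operators.

(* Twisted spectral triples whose operator D is diagonal in the standard basis,
   with non-zero real eigenvalues w; the functional calculus f(D) is then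
   multiplication by f o w. *)
Section SpectralTriples.
Variables (R : realType) (I : choiceType) (w : I -> R).
Local Notation C := (R[i])^o.
Local Notation H := (ell2 R I).
Local Notation op := (H -> H).

Definition fcalc (f : R -> C) : op := diag (fun i => f (w i)).
Definition fdom (f : R -> C) : set H := diag_dom (fun i => f (w i)).

Definition Dop : op := fcalc (fun x => x%:C).
Definition domD : set H := fdom (fun x => x%:C).

Definition absD (k : int) : op := fcalc (fun x => (`|x| ^ k)%:C).
Definition dom_absD (k : int) : set H := fdom (fun x => (`|x| ^ k)%:C).

Definition Fop : op := Dop \o absD (-1).

(* the bounded extension of |D|^k a |D|^-k *)
Definition twist (k : int) (a : op) : op :=
  bounded_extension
    [set x | dom_absD (- k) x /\ dom_absD k (a (absD (- k) x))]
    (absD k \o a \o absD (- k)).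

Section Twisted.
Variable sigma : op -> op.

Definition tcomm_fun (a : op) : op := fun x => Dop (a x) - sigma a (Dop x).

Definition tcomm (a : op) : op := bounded_extension domD (tcomm_fun a).

(* sigma is only used on the *-subalgebra S; the last clause says that
   sigma(a)^* = sigma^-1(a^* ). *)
Definition partial_twist (A : set op) : Prop :=
  exists S : set op,
    [/\ star_algebra S, A `<=` S,
        forall a, S a -> bounded_op (sigma a),
        forall a b, S a -> S b -> sigma (a \o b) = sigma a \o sigma b
      & forall a, S a -> S (adj (sigma a)) /\ sigma (adj (sigma a)) = adj a].

Definition weakly_twisted_spectral_triple (A : set op) : Prop :=
  [/\ star_algebra A, self_adjoint domD Dop, partial_twist A
    & forall a, A a ->
        [/\ forall x, domD x -> domD (a x),
            bounded_on domD (tcomm_fun a)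
          & compact_op (a \o fcalc (fun x => ((Num.sqrt (1 + x ^+ 2))^-1)%:C))]].

Definition algebra_automorphism (A : set op) : Prop :=
  [/\ set_bij A A sigma,
      forall (c : C) a b, A a -> A b ->
        sigma (c *: a + b) = c *: sigma a + sigma b
    & forall a b, A a -> A b -> sigma (a \o b) = sigma a \o sigma b].

Definition twisted_spectral_triple (A : set op) : Prop :=
  weakly_twisted_spectral_triple A /\ algebra_automorphism A.

Definition finitely_summable : Prop :=
  exists2 p : R, 0 < p & schatten p (fcalc (fun x => (x +i* 1)^-1)).

Definition regular_triple (A : set op) : Prop :=
  exists (B : set op) (theta : op -> op),
    [/\ star_algebra B, A `<=` B, tcomm @` A `<=` B,
        (forall a, A a -> theta a = sigma a)
      & [/\ set_bij B B theta,
            forall (c : C) a b, B a -> B b ->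
              theta (c *: a + b) = c *: theta a + theta b
          & forall b, B b -> exists2 b', B b' &
              forall x, dom_absD 1 x -> dom_absD 1 (b x) /\
                absD 1 (b x) - theta b (absD 1 x) = b' x]].

(* The elements of Psi are operators on H_infty: two members of the set below
   that agree there stand for the same operator. *)
Definition H_infty : set H := [set x | forall k, dom_absD k x].

Definition Psi (A : set op) : set op :=
  smallest (@op_algebra R I)
    ([set Fop] `|` A `|` tcomm @` A `|` range absD).

End Twisted.

(* r^z = exp (z ln r), for r > 0 *)
Definition cpow (r : R) (z : C) : C :=
  (expR (complex.Re z * ln r))%:C *
  (cos (complex.Im z * ln r) +i* sin (complex.Im z * ln r)).

Definition absD_cpow (z : C) : op := fcalc (fun x => cpow `|x| z).

Definition has_trace (T : op) (c : C) : Prop :=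
  exists S : op, [/\ schatten 1 S, (forall x, H_infty x -> S x = T x)
                   & trace S = c].

Definition holomorphic_at (f : C -> C) (z : C) : Prop :=
  \forall s \near z, derivable f s 1.

Definition pole_order_le (f : C -> C) (z : C) (N : nat) : Prop :=
  exists2 h : C -> C, holomorphic_at h z &
    \forall s \near z^', f s = h s / (s - z) ^+ N.

(* c is the coefficient of (s - z)^-1 in the Laurent expansion of f at z. *)
Definition residue (f : C -> C) (z c : C) : Prop :=
  exists (n : nat) (p : nat -> C) (h : C -> C),
    [/\ holomorphic_at h z,
        \forall s \near z^',
          f s = h s + \sum_(l < n.+1) p l / (s - z) ^+ l.+1
      & c = p 0%N].

Definition discrete_closed (S : set C) : Prop :=
  forall z : C, \forall s \near z^', ~ S s.

(* f is a meromorphic function on C extending zeta_T and holomorphic outside of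
   Sd; it is unique by the identity theorem. *)
Definition zeta_extension (T : op) (Sd : set C) (f : C -> C) : Prop :=
  [/\ exists x0 : R, forall z : C, x0 < complex.Re z ->
        has_trace (T \o absD_cpow (- (2 * z))) (f z),
      forall z, ~ Sd z -> holomorphic_at f z
    & forall z, exists N, pole_order_le f z N].

Definition finite_discrete_dimension_spectrum (sigma : op -> op) (A : set op) :
    Prop :=
  exists (Sd : set C) (N : nat), discrete_closed Sd /\
    forall T, Psi sigma A T ->
      exists2 f, zeta_extension T Sd f & forall z, pole_order_le f z N.

(* tau_j(T) = c *)
Definition tau_is (j : nat) (T : op) (c : C) : Prop :=
  exists (Sd : set C) (f : C -> C),
    [/\ discrete_closed Sd, zeta_extension T Sd f
      & residue (fun z => z ^+ j * f z) 0 c].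

(* T^(k) for T in Psi *)
Definition iter_tcomm2 (k : nat) (T : op) : op :=
  iter k (fun S => (fcalc (fun x => (x ^+ 2)%:C) \o S)
                   - (absD 2 \o S \o absD (- 2)
                      \o fcalc (fun x => (x ^+ 2)%:C))) T.

Definition mi_prefix m (k : {ffun 'I_m -> nat}) (i : 'I_m) : nat :=
  (\sum_(j < m | (j <= i)%N) k j)%N.

Definition mi_size m (k : {ffun 'I_m -> nat}) : nat := (\sum_(j < m) k j)%N.

Definition alpha m (k : {ffun 'I_m -> nat}) : C :=
  ((\prod_(i < m) ((k i)`! * (mi_prefix k i + i.+1)))%N%:R)^-1.

Definition sigma_tilde (n j : nat) : C :=
  (\prod_(l < n) ('X + (l%:R + 2^-1)%:P) : {poly R[i]})`_j.

Definition ansatz_op m (k : {ffun 'I_m -> nat}) (a : 'I_m.+1 -> op) : op :=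
  Fop \o a ord0
  \o (\big[(fun S T : op => S \o T)/idfun]_(i < m)
        iter_tcomm2 (k i)
          (tcomm (twist 1)
             (twist (- (2 * mi_prefix k i)%:Z - 1) (a (lift ord0 i)))))
  \o absD (- (2 * mi_size k + m)%:Z).

(* phi_m(a_0, ..., a_m) = c; (m - 1)/2 is m./2 for odd m. *)
Definition ansatz_is m (a : 'I_m.+1 -> op) (c : C) : Prop :=
  exists phi_mjk : nat -> {ffun 'I_m -> nat} -> C,
    (forall j k, (j <= mi_size k + m./2)%N ->
       tau_is j (ansatz_op k a) (phi_mjk j k)) /\
    let summand k := (-1) ^+ mi_size k * alpha k *
      \sum_(j < (mi_size k + m./2).+1)
         sigma_tilde (mi_size k + m./2) j * phi_mjk j k in
    csummable summand /\ c = csum summand.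

Definition cochain : Type := forall m : nat, ('I_m.+1 -> op) -> C.

Definition moscovici_cochain (A : set op) (phi : cochain) : Prop :=
  forall m (a : 'I_m.+1 -> op), odd m -> (forall i, A (a i)) ->
    ansatz_is a (phi m a).

Definition matrix_adj N (u : 'I_N -> 'I_N -> op) : 'I_N -> 'I_N -> op :=
  fun i j => adj (u j i).

Definition matrix_mul N (u v : 'I_N -> 'I_N -> op) : 'I_N -> 'I_N -> op :=
  fun i j => \sum_(l < N) (u i l \o v l j).

Definition matrix_one N : 'I_N -> 'I_N -> op :=
  fun i j => if i == j then idfun else 0.

(* The unitary matrices over A represent the classes of K_1(A). *)
Definition unitary_over (A : set op) N (u : 'I_N -> 'I_N -> op) : Prop :=
  [/\ forall i j, A (u i j), matrix_mul (matrix_adj u) u = @matrix_one N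
    & matrix_mul u (matrix_adj u) = @matrix_one N].

(* phi_m(Ch_m(u)) for m = 2l+1, where phi_m is extended to matrices by means of
   the trace: phi_m(M_0 x a_0, ..., M_m x a_m) = Tr(M_0...M_m) phi_m(a_0,...,a_m) *)
Definition chern_term (phi : cochain) N (u : 'I_N -> 'I_N -> op) (l : nat) : C :=
  (-1) ^+ l * (l`!)%:R *
  \sum_(J : {ffun 'I_(2 * l + 1).+1 -> 'I_N})
     phi (2 * l + 1)%N (fun i =>
       (if odd i then u else matrix_adj u) (J i) (J (ordS i))).

Definition chern_pairing_is (phi : cochain) N (u : 'I_N -> 'I_N -> op) (c : C) :
    Prop :=
  series (chern_term phi u) @ \oo --> c.

(* dim (V / (W cap V)) = n *)
Definition quotient_dim (E : lmodType C) (V W : set E) (n : nat) : Prop :=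
  exists2 e : 'I_n -> E, (forall i, V (e i)) &
    forall x, V x -> exists! c : 'I_n -> C, W (x - \sum_(i < n) c i *: e i).

Definition fredholm_index_is (E : lmodType C) (V : set E) (T : E -> E) (n : int) :
    Prop :=
  exists p q : nat,
    [/\ quotient_dim (V `&` [set x | T x = 0]) [set 0] p,
        quotient_dim V (T @` V) q & n = p%:Z - q%:Z].

Definition Pop : op := 2^-1 *: (Fop + idfun).

(* Index (PuP : PH^N -> PH^N) = n *)
Definition index_pairing_is N (u : 'I_N -> 'I_N -> op) (n : int) : Prop :=
  fredholm_index_is
    (range (fun (x : 'I_N -> H) i => Pop (x i)))
    (fun (x : 'I_N -> H) i => Pop (\sum_(j < N) u i j (Pop (x j)))) n.

Definition pairs_nontrivially_with_K1 (A : set op) : Prop :=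
  exists N (u : 'I_N -> 'I_N -> op), unitary_over A u /\
    exists2 n, index_pairing_is u n & n != 0.

Definition saturation (A : set op) : set op :=
  smallest (@star_algebra R I) (\bigcup_(k in [set: int]) (twist k @` A)).

End SpectralTriples.

Section FreeGroupTriple.
Variables (R : realType) (d : nat) (t : boundary d).
Local Notation C := (R[i])^o.
Local Notation H := (ell2 R (fgroup d)).

(* the eigenvalues of D_{af,t} *)
Definition D_af (mu : fgroup d) : R :=
  (2 * (ell mu t == 0%N)%:R - 1) *
  expR (`|(size mu)%:R - 2 * (ell mu t)%:R| + (ell mu t)%:R).

(* the finite sums of operators a lambda_gamma, where
   a lambda_gamma delta_mu = a (gamma mu t) delta_(gamma mu) *)
Definition crossed_product : set (H -> H) :=
  [set T | bounded_op T /\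
    exists n (a : 'I_n -> boundary d -> C) (gamma : 'I_n -> fgroup d),
      (forall i, locally_constant (a i)) /\
      forall mu, T (delta R mu) =
        \sum_(i < n) a i (bact (gamma i * mu)%g t) *: delta R (gamma i * mu)%g].

End FreeGroupTriple.

(* Main.v *)
(* Let [g] be the inverse of the letter repeated in [t]. Every [mu] is uniquely
   [nu g^l] with [nu] not ending in [g], and then [l = l(mu, t)]; hence |D| is
   [e^L] with [L = max(|nu|, 2 l - |nu|)], and [D] is positive exactly where
   [l = 0]. Left translation by [gamma] moves [|nu|] and [l] by at most
   [|gamma|], and it changes the sign of [D] at finitely many points only. So
   the operators of the triple are bands (finite sums of translations with
   coefficients), and the coefficients of the twisted commutators have finite
   support. The operators of the ansatz contain such a factor, so their zeta
   functions are entire and all residues vanish. On the other hand, [P] is the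
   projection onto the [mu] with [l = 0], and it compresses the translation by
   the letter of [t] to an isometry with range of codimension 1.

   On finitely many cells, the coefficients of the operators in Psi are
   exponential sums in [|nu|] and [l]. Summing over [min(|nu|, l)] and
   [||nu| - l|] turns their zeta functions into sums of products of two geometric
   series in powers of [e^(-2z)], since the reduced words are counted by a
   transfer matrix with eigenvalues [2d - 1] and [±1]. *)

Require Import Defs.
From mathcomp Require Import all_boot all_order all_algebra monoid.
From mathcomp Require Import boolp classical_sets functions cardinality fsbigop.
From mathcomp Require Import reals ereal topology normedtype sequences numfun.
From mathcomp Require Import esum exp trigo derive realfun complex ring lra zify.


Set Implicit Arguments.
Unset Strict Implicit.
Unset Printing Implicit Defensive.

Import Order.TTheory GRing.Theory Num.Theory.
Import numFieldNormedType.Exports.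

Local Open Scope classical_set_scope.
Local Open Scope complex_scope.
Local Open Scope ring_scope.


(** * Moduli and absolutely summable families *)

(** Everything is read off from coefficients: a band is a finite family of pairs (coefficient,
    translation), so that boundedness, composition, adjoints and the twist become closure properties
    of sets of functions on the group. The obstacle is to find a class of coefficients that contains
    the locally constant functions, the signs and the powers of |D|, is stable under translation,
    and still has zeta functions that can be summed in closed form. Cells answer this. A cell of
    precision n records n letters of the core, which of the core length and the trail is larger, and
    their minimum and distance truncated at n. A translation by one letter costs two units of
    precision, hence the precision of a coefficient is left existential instead of being fixed. The
    zeta functions are obtained as limits of partial sums over finite sets on which the two
    summation indices run independently; absolute convergence identifies these limits with the
    traces. Each of the two geometric factors is granted a pole of order 2, hence the uniform bound
    4 on the orders. *)

Section Modulus.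
Variable R : realType.
Local Notation C := (R[i])^o.
Implicit Types x y z : C.

Lemma modulus_ge0 x : 0 <= modulus x.
Proof. by case: x => a b; rewrite /modulus /= sqrtr_ge0. Qed.

Lemma modulus0 : modulus (0 : C) = 0.
Proof. by rewrite /modulus Normc.normc0. Qed.

Lemma modulus1 : modulus (1 : C) = 1.
Proof. by rewrite /modulus Normc.normc1. Qed.

Lemma modulus_eq0 x : modulus x = 0 -> x = 0.
Proof. exact: Normc.eq0_normc. Qed.

Lemma modulus_gt0 x : x != 0 -> 0 < modulus x.
Proof. by move=> x0; rewrite lt_neqAle modulus_ge0 andbT eq_sym; apply: contra x0 => /eqP /modulus_eq0 ->. Qed.

Lemma modulusM x y : modulus (x * y) = modulus x * modulus y.
Proof. exact: Normc.normcM. Qed.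

Lemma modulusD x y : modulus (x + y) <= modulus x + modulus y.
Proof. exact: le_normcD. Qed.

Lemma modulusN x : modulus (- x) = modulus x.
Proof. exact: normcN. Qed.

Lemma modulus_distC x y : modulus (x - y) = modulus (y - x).
Proof. by rewrite -modulusN opprB. Qed.

Lemma modulusV x : modulus (x^-1) = (modulus x)^-1.
Proof. exact: Normc.normcV. Qed.

Lemma modulusX x n : modulus (x ^+ n) = modulus x ^+ n.
Proof. by elim: n => [|n IH]; rewrite ?modulus1// !exprS modulusM IH. Qed.

Lemma modulus_real (a : R) : modulus a%:C = `|a|.
Proof. by rewrite /modulus /= expr0n /= addr0 sqrtr_sqr. Qed.

Lemma modulus_conj x : modulus (x^* : R[i])%R = modulus x.
Proof. by case: x => a b; rewrite /modulus /= sqrrN. Qed.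

Lemma modulus_norm x : `|x : R[i]| = (modulus x)%:C.
Proof. by case: x. Qed.

Lemma ler_Re_modulus x : `|complex.Re x| <= modulus x.
Proof.
case: x => a b; rewrite /modulus /= -sqrtr_sqr ler_sqrt ?lerDl ?sqr_ge0//.
by rewrite addr_ge0 ?sqr_ge0.
Qed.

Lemma ler_Im_modulus x : `|complex.Im x| <= modulus x.
Proof.
case: x => a b; rewrite /modulus /= -sqrtr_sqr ler_sqrt ?lerDr ?sqr_ge0//.
by rewrite addr_ge0 ?sqr_ge0.
Qed.

Lemma ler_modulus_ReIm x : modulus x <= `|complex.Re x| + `|complex.Im x|.
Proof.
case: x => a b; rewrite -[_ +i* _]/(Complex a b).
have -> : a +i* b = a%:C + 'i%C * b%:C by simpc.
apply: le_trans (modulusD _ _) _.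
by rewrite modulusM !modulus_real /= /modulus /= expr0n expr1n add0r sqrtr1 mul1r; simpc.
Qed.

Lemma modulus_sum (J : Type) (s : seq J) (P : pred J) (f : J -> C) :
  modulus (\sum_(i <- s | P i) f i) <= \sum_(i <- s | P i) modulus (f i).
Proof.
elim/big_ind2: _ => // [|x x' y y' h1 h2]; first by rewrite modulus0.
exact: le_trans (modulusD _ _) (lerD h1 h2).
Qed.

Lemma Re_sum (J : Type) (s : seq J) (P : pred J) (f : J -> C) :
  complex.Re (\sum_(i <- s | P i) f i) = \sum_(i <- s | P i) complex.Re (f i).
Proof. by apply: (big_morph (@complex.Re R)) => // -[a b] [c e]. Qed.

Lemma Im_sum (J : Type) (s : seq J) (P : pred J) (f : J -> C) :
  complex.Im (\sum_(i <- s | P i) f i) = \sum_(i <- s | P i) complex.Im (f i).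
Proof. by apply: (big_morph (@complex.Im R)) => // -[a b] [c e]. Qed.

End Modulus.

Section Sums.
Variables (R : realType) (I : choiceType).
Local Notation C := (R[i])^o.

Lemma sum_le_esum (f : I -> \bar R) (X : seq I) : uniq X ->
  (forall i, 0 <= f i)%E ->
  (\sum_(i <- X) f i <= \esum_(i in [set: I]) f i)%E.
Proof.
move=> uX f0; apply: esum_ge; exists [set` X].
  by split => //; exact: finite_seq.
by rewrite -fsbig_seq.
Qed.

Lemma esum_le_seq (f : I -> \bar R) (M : \bar R) : (forall i, 0 <= f i)%E ->
  (forall X, uniq X -> \sum_(i <- X) f i <= M)%E ->
  (\esum_(i in [set: I]) f i <= M)%E.
Proof.
move=> f0 h; apply: ge_ereal_sup => _ [A [fA _] <-].
rewrite fsbig_finite//=; apply: h; exact: finmap.fset_uniq.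
Qed.

Lemma big_uniq_subset (V : nmodType) (f : I -> V) (X0 X : seq I) :
  uniq X0 -> uniq X -> {subset X0 <= X} ->
  \sum_(i <- X) f i = \sum_(i <- X0) f i + \sum_(i <- X | i \notin X0) f i.
Proof.
move=> u0 u s; rewrite (bigID (mem X0))/=; congr (_ + _).
rewrite -big_filter; apply: perm_big; apply: uniq_perm => //.
  exact: filter_uniq.
by move=> i; rewrite mem_filter; case: (boolP (i \in X0)) => // /s ->.
Qed.

Lemma esum_approx (f : I -> R) (e : R) : (forall i, 0 <= f i) -> 0 < e ->
  (\esum_(i in [set: I]) (f i)%:E < +oo)%E ->
  exists X0 : seq I, forall X, uniq X -> {subset X0 <= X} ->
   `|\sum_(i <- X) f i - fine (\esum_(i in [set: I]) (f i)%:E)| <= e.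
Proof.
move=> f0 e0 foo; set s := esum _ _ in foo *.
have s0 : (0 <= s)%E by apply: esum_ge0 => i _; rewrite lee_fin.
have sfin : s \is a fin_num by rewrite ge0_fin_numE.
have : (s - e%:E < s)%E by rewrite lteBlDr// lteDl// lte_fin.
rewrite {2}/s => /ereal_sup_gt [_ [A [fA _] <-]].
rewrite fsbig_finite//= => h; exists (finmap.enum_fset (fset_set A)) => X uX sX.
have le1 : (\sum_(i <- X) (f i)%:E <= s)%E.
  by apply: sum_le_esum => // i; rewrite lee_fin.
have le2 : \sum_(i <- finmap.enum_fset (fset_set A)) f i <= \sum_(i <- X) f i.
  rewrite (big_uniq_subset _ (finmap.fset_uniq (fset_set A)) uX sX).
  by rewrite lerDl sumr_ge0.
move: h le1; rewrite !sumEFin -(fineK sfin) -EFinB !lte_fin !lee_fin => h le1.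
rewrite distrC ger0_norm; last by rewrite subr_ge0.
by rewrite lerBlDl -lerBlDr; apply: ltW; apply: lt_le_trans h le2.
Qed.

(** Convergence along the net of finite subsets. It is visibly linear in [f], unlike the formula for
    [csum], which goes through positive and negative parts. *)
Definition hassum (f : I -> C) (c : C) : Prop :=
  forall e : R, 0 < e -> exists X0 : seq I,
    forall X, uniq X -> {subset X0 <= X} -> modulus (\sum_(i <- X) f i - c) <= e.

Lemma hassum_unique f a b : hassum f a -> hassum f b -> a = b.
Proof.
move=> fa fb; apply/eqP; rewrite -subr_eq0; apply/eqP/modulus_eq0/eqP.
rewrite eq_le modulus_ge0 andbT; apply/ler_addgt0Pr => e e0; rewrite add0r.
have e20 : 0 < e / 2 by rewrite divr_gt0.
have [X ha] := fa _ e20; have [Y hb] := fb _ e20.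
pose Z := undup (X ++ Y).
have {}ha := ha Z (undup_uniq _) _; have {}hb := hb Z (undup_uniq _) _.
rewrite (_ : a - b = (\sum_(i <- Z) f i - b) - (\sum_(i <- Z) f i - a)); last by ring.
rewrite (splitr e); apply: le_trans (modulusD _ _) _.
rewrite modulusN lerD ?hb ?ha// => i; rewrite mem_undup mem_cat => -> //.
by rewrite orbT.
Qed.

Lemma hassumD f g a b : hassum f a -> hassum g b ->
  hassum (fun i => f i + g i) (a + b).
Proof.
move=> fa fb e e0; have e20 : 0 < e / 2 by rewrite divr_gt0.
have [X ha] := fa _ e20; have [Y hb] := fb _ e20.
exists (X ++ Y) => Z uZ sZ; rewrite big_split/= opprD addrACA (splitr e).
apply: le_trans (modulusD _ _) _.
by rewrite lerD ?hb ?ha// => i iX; apply: sZ; rewrite mem_cat iX ?orbT.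
Qed.

Lemma hassumZ f a (c : C) : hassum f a -> hassum (fun i => c * f i) (c * a).
Proof.
move=> fa e e0; have c0 : 0 < modulus c + 1 by rewrite ltr_wpDl// modulus_ge0.
have [X ha] := fa (e / (modulus c + 1)) (divr_gt0 e0 c0).
exists X => Z uZ sZ; rewrite -mulr_sumr -mulrBr modulusM.
apply: (@le_trans _ _ ((modulus c + 1) * (e / (modulus c + 1)))).
  by apply: ler_pM; rewrite ?modulus_ge0 ?lerDl ?ha.
by rewrite mulrC divfK// gt_eqF.
Qed.

Lemma hassum0 : hassum (fun=> 0) 0.
Proof. by move=> e e0; exists [::] => X _ _; rewrite big1// subr0 modulus0 ltW. Qed.

Lemma hassum_fin (f : I -> C) (X : seq I) : uniq X ->
  (forall i, i \notin X -> f i = 0) -> hassum f (\sum_(i <- X) f i).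
Proof.
move=> uX f0 e e0; exists X => Y uY sXY.
rewrite (big_uniq_subset _ uX uY sXY) addrAC subrr add0r big1 ?modulus0 ?ltW//.
Qed.

Lemma csummable_bound (f : I -> C) (M : R) :
  (forall X, uniq X -> \sum_(i <- X) modulus (f i) <= M) -> csummable f.
Proof.
move=> h; rewrite /csummable /summable; apply: (@le_lt_trans _ _ M%:E); last exact: ltry.
apply: esum_le_seq => [i|X uX]; first exact: abse_ge0.
rewrite (eq_bigr (fun i => (modulus (f i))%:E)) ?sumEFin ?lee_fin ?h// => i _.
by rewrite /= ger0_norm// modulus_ge0.
Qed.

Lemma rsum_approx (f : I -> R) (e : R) : 0 < e ->
  (\esum_(i in [set: I]) `|f i|%:E < +oo)%E ->
  exists X0 : seq I, forall X, uniq X -> {subset X0 <= X} ->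
   `|\sum_(i <- X) f i - rsum f| <= e.
Proof.
move=> e0 foo; have e20 : 0 < e / 2 by rewrite divr_gt0.
pose p i := Num.max (f i) 0; pose n i := Num.max (- f i) 0.
have p0 i : 0 <= p i by rewrite /p le_max lexx orbT.
have n0 i : 0 <= n i by rewrite /n le_max lexx orbT.
have poo : (\esum_(i in [set: I]) (p i)%:E < +oo)%E.
  apply: le_lt_trans foo; apply: le_esum => i _.
  by rewrite lee_fin /p ge_max ler_norm normr_ge0.
have noo : (\esum_(i in [set: I]) (n i)%:E < +oo)%E.
  apply: le_lt_trans foo; apply: le_esum => i _.
  by rewrite lee_fin /n ge_max -normrN ler_norm normr_ge0.
have [X hX] := esum_approx p0 e20 poo; have [Y hY] := esum_approx n0 e20 noo.
exists (X ++ Y) => Z uZ sZ.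
have -> : rsum f = fine (\esum_(i in [set: I]) (p i)%:E)
    - fine (\esum_(i in [set: I]) (n i)%:E).
  rewrite /rsum -fineB; last 2 first.
  - by rewrite ge0_fin_numE// esum_ge0// => i _; rewrite lee_fin.
  - by rewrite ge0_fin_numE// esum_ge0// => i _; rewrite lee_fin.
  congr (fine (_ - _)); apply: eq_esum => i _.
    by rewrite funeposE/= -EFin_max.
  by rewrite funenegE/= -EFin_max.
have -> : \sum_(i <- Z) f i = \sum_(i <- Z) p i - \sum_(i <- Z) n i.
  rewrite -sumrB; apply: eq_bigr => i _; rewrite /p /n.
  case: (lerP 0 (f i)) => h; first by rewrite max_r ?oppr_le0// subr0.
  by rewrite max_l ?oppr_ge0 ?ltW// sub0r opprK.
have -> a b c1 c2 : a - b - (c1 - c2) = (a - c1) - (b - c2) :> R by ring.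
rewrite (splitr e); apply: le_trans (ler_normB _ _) _.
by rewrite lerD ?hX ?hY// => i iX; apply: sZ; rewrite mem_cat iX ?orbT.
Qed.

Lemma csummableP (f : I -> C) : csummable f -> hassum f (csum f).
Proof.
move=> sf e e0; have e20 : 0 < e / 2 by rewrite divr_gt0.
have key (g : I -> R) : (forall i, `|g i| <= modulus (f i)) ->
    (\esum_(i in [set: I]) `|g i|%:E < +oo)%E.
  move=> h; apply: le_lt_trans sf; apply: le_esum => i _.
  by rewrite lee_fin (ger0_norm (modulus_ge0 _)).
have [X hX] := rsum_approx e20 (key _ (fun i => ler_Re_modulus (f i))).
have [Y hY] := rsum_approx e20 (key _ (fun i => ler_Im_modulus (f i))).
exists (X ++ Y) => Z uZ sZ.
apply: le_trans (ler_modulus_ReIm _) _; rewrite (splitr e).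
have -> : complex.Re (\sum_(i <- Z) f i - csum f) =
   \sum_(i <- Z) complex.Re (f i) - rsum (fun i => complex.Re (f i)).
  by rewrite -Re_sum; case: (\sum_(i <- Z) f i).
have -> : complex.Im (\sum_(i <- Z) f i - csum f) =
   \sum_(i <- Z) complex.Im (f i) - rsum (fun i => complex.Im (f i)).
  by rewrite -Im_sum; case: (\sum_(i <- Z) f i).
by rewrite lerD ?hX ?hY// => i iX; apply: sZ; rewrite mem_cat iX ?orbT.
Qed.

Lemma csum_eq (f : I -> C) (c : C) : csummable f -> hassum f c -> csum f = c.
Proof. by move=> /csummableP h; exact: hassum_unique. Qed.

(** The extended sums behind [rsum] are invariant under bijections, whether or not they are
    finite. *)
Lemma csum_reindex (h h' : I -> I) (f : I -> C) : cancel h h' -> cancel h' h ->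
  csum (fun i => f (h i)) = csum f.
Proof.
move=> hK h'K; have bij : set_bij [set: I] [set: I] h.
  split => //; first by move=> i j _ _; exact: can_inj hK i j.
  by move=> i _; exists (h' i).
have key (g : I -> \bar R) : \esum_(i in [set: I]) g (h i) = \esum_(i in [set: I]) g i.
  exact/esym/reindex_esum.
have rkey (g : I -> R) : rsum (fun i => g (h i)) = rsum g.
  rewrite /rsum; congr (fine (_ - _)).
    by rewrite -[RHS]key; apply: eq_esum => i _; rewrite !funeposE.
  by rewrite -[RHS]key; apply: eq_esum => i _; rewrite !funenegE.
by rewrite /csum (rkey (fun i => complex.Re (f i))) (rkey (fun i => complex.Im (f i))).
Qed.

End Sums.

(** * Square summable families and bounded operators *)

Section Ell2Norm.
Variables (R : realType) (I : choiceType).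
Local Notation C := (R[i])^o.
Local Notation H := (ell2 R I).
Implicit Types x y : H.

Lemma ell2P x y : (forall i, x i = y i) -> x = y.
Proof. by move=> xy; apply/val_inj/funext. Qed.

Lemma ell2D x y i : (x + y) i = x i + y i. Proof. by []. Qed.
Lemma ell2Z (c : C) x i : (c *: x) i = c * x i. Proof. by []. Qed.
Lemma ell2N x i : (- x) i = - x i. Proof. by []. Qed.
Lemma ell2B x y i : (x - y) i = x i - y i. Proof. by []. Qed.
Lemma ell20 i : (0 : H) i = 0. Proof. by []. Qed.

Lemma ell2_sum (J : Type) (s : seq J) (P : pred J) (f : J -> H) i :
  (\sum_(j <- s | P j) f j) i = \sum_(j <- s | P j) f j i.
Proof. by apply: (big_morph (fun x : H => x i)). Qed.

Lemma hnorm_ge0 x : 0 <= hnorm x. Proof. exact: sqrtr_ge0. Qed.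

Lemma sqsum_ge0 (x : I -> C) : (0 <= sqsum x)%E.
Proof. by apply: esum_ge0 => i _; exact: modulus2_ge0. Qed.

Lemma sqsumE x : sqsum x = (hnorm x ^+ 2)%:E.
Proof.
have /asboolP h := valP x; rewrite /hnorm sqr_sqrtr ?fine_ge0 ?sqsum_ge0//.
by rewrite fineK// ge0_fin_numE// sqsum_ge0.
Qed.

Lemma sum_sq_le x (X : seq I) : uniq X ->
  \sum_(i <- X) modulus (x i) ^+ 2 <= hnorm x ^+ 2.
Proof.
move=> uX; rewrite -lee_fin -sqsumE -sumEFin; apply: sum_le_esum => // i.
exact: modulus2_ge0.
Qed.

Lemma hnorm_le x (M : R) : 0 <= M ->
  (forall X, uniq X -> \sum_(i <- X) modulus (x i) ^+ 2 <= M ^+ 2) -> hnorm x <= M.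
Proof.
move=> M0 h; rewrite -(@ler_pXn2r _ 2) ?nnegrE ?hnorm_ge0// -lee_fin -sqsumE.
apply: esum_le_seq => [i|X uX]; first exact: modulus2_ge0.
by rewrite sumEFin lee_fin h.
Qed.

Lemma square_summable_bound (x : I -> C) (M : R) :
  (forall X, uniq X -> \sum_(i <- X) modulus (x i) ^+ 2 <= M) ->
  x \in @square_summable R I.
Proof.
move=> h; apply/asboolP; apply: (@le_lt_trans _ _ M%:E); last exact: ltry.
apply: esum_le_seq => [i|X uX]; first exact: modulus2_ge0.
by rewrite sumEFin lee_fin h.
Qed.

Lemma modulus_le_hnorm x i : modulus (x i) <= hnorm x.
Proof.
rewrite -(@ler_pXn2r _ 2) ?nnegrE ?hnorm_ge0 ?modulus_ge0//.
by have := @sum_sq_le x [:: i] isT; rewrite big_seq1.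
Qed.

Lemma hnorm_eq0 x : hnorm x = 0 -> x = 0.
Proof.
move=> x0; apply: ell2P => i; apply: modulus_eq0; apply/eqP.
by rewrite eq_le modulus_ge0 andbT -x0 modulus_le_hnorm.
Qed.

Lemma hnorm_small x : (forall e : R, 0 < e -> hnorm x <= e) -> x = 0.
Proof.
move=> h; apply: hnorm_eq0; apply/eqP; rewrite eq_le hnorm_ge0 andbT.
by apply/ler_addgt0Pr => e e0; rewrite add0r h.
Qed.

Lemma square_summable_dom (x : I -> C) y (M : R) :
  (forall i, modulus (x i) <= M * modulus (y i)) -> x \in @square_summable R I.
Proof.
move=> h; apply: (@square_summable_bound _ (M ^+ 2 * hnorm y ^+ 2)) => X uX.
apply: le_trans (_ : _ <= M ^+ 2 * \sum_(i <- X) modulus (y i) ^+ 2) _.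
  rewrite mulr_sumr ler_sum// => i _; rewrite -exprMn ler_pXn2r ?nnegrE ?modulus_ge0//.
  exact: le_trans (modulus_ge0 _) (h i).
by rewrite ler_wpM2l ?sqr_ge0 ?sum_sq_le.
Qed.

Lemma hnorm_dom x y (M : R) : 0 <= M ->
  (forall i, modulus (x i) <= M * modulus (y i)) -> hnorm x <= M * hnorm y.
Proof.
move=> M0 h; apply: hnorm_le => [|X uX]; first by rewrite mulr_ge0 ?hnorm_ge0.
apply: le_trans (_ : _ <= M ^+ 2 * \sum_(i <- X) modulus (y i) ^+ 2) _.
  rewrite mulr_sumr ler_sum// => i _; rewrite -exprMn ler_pXn2r ?nnegrE ?modulus_ge0//.
  exact: le_trans (modulus_ge0 _) (h i).
by rewrite exprMn ler_wpM2l ?sqr_ge0 ?sum_sq_le.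
Qed.

Lemma hnormN x : hnorm (- x) = hnorm x.
Proof.
by rewrite /hnorm /sqsum; congr (Num.sqrt (fine _)); apply: eq_esum => i _; rewrite ell2N modulusN.
Qed.

Lemma hnorm0 : hnorm (0 : H) = 0.
Proof.
apply/eqP; rewrite eq_le hnorm_ge0 andbT hnorm_le// => X _.
by rewrite big1 ?expr0n// => i _; rewrite ell20 modulus0 expr0n.
Qed.

(* The factor 2 avoids Minkowski's inequality. *)
Lemma hnormD x y : hnorm (x + y) <= 2 * (hnorm x + hnorm y).
Proof.
have x0 := hnorm_ge0 x; have y0 := hnorm_ge0 y.
apply: hnorm_le => [|X uX]; first by rewrite mulr_ge0 ?addr_ge0.
apply: le_trans (_ : _ <= \sum_(i <- X) (2 * modulus (x i) ^+ 2 + 2 * modulus (y i) ^+ 2)) _.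
  by apply: ler_sum => i _; exact: modulus2D.
rewrite big_split/= -!mulr_sumr.
have := sum_sq_le x uX; have := sum_sq_le y uX.
set a := \sum_(_ <- _) _; set b := \sum_(_ <- _) _; nra.
Qed.

Lemma square_summable_reindex x (h h' : I -> I) : cancel h h' ->
  (fun i => x (h i)) \in @square_summable R I.
Proof.
move=> hK; apply: (@square_summable_bound _ (hnorm x ^+ 2)) => X uX.
rewrite -(big_map h xpredT (fun i => modulus (x i) ^+ 2)); apply: sum_sq_le.
by rewrite map_inj_uniq//; exact: can_inj hK.
Qed.

Lemma hnorm_reindex x y (h h' : I -> I) : cancel h h' ->
  (forall i, y i = x (h i)) -> hnorm y <= hnorm x.
Proof.
move=> hK yE; apply: hnorm_le => [|X uX]; first exact: hnorm_ge0.
under eq_bigr do rewrite yE.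
rewrite -(big_map h xpredT (fun i => modulus (x i) ^+ 2)); apply: sum_sq_le.
by rewrite map_inj_uniq//; exact: can_inj hK.
Qed.

Lemma delta_val (i j : I) : delta R i j = (j == i)%:R. Proof. by []. Qed.

Definition restr (X : seq I) x : H := \sum_(i <- X) x i *: delta R i.

Lemma restr_val (X : seq I) x j : uniq X ->
  restr X x j = if j \in X then x j else 0.
Proof.
move=> uX; rewrite ell2_sum; case: ifPn => jX.
  rewrite (big_rem j)// big_seq big1 ?addr0 => [|i].
    by rewrite ell2Z delta_val eqxx mulr1; exact: addr0.
  rewrite (mem_rem_uniq _ uX) !inE ell2Z delta_val eq_sym => /andP[/negPf -> _].
  by rewrite mulr0.
rewrite big_seq big1// => i iX; rewrite ell2Z delta_val; case: eqP => [ji|_]; last by rewrite mulr0.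
by rewrite ji iX in jX.
Qed.

Lemma restr_approx x (e : R) : 0 < e ->
  exists2 X : seq I, uniq X & hnorm (x - restr X x) < e.
Proof.
move=> e0; have e20 : 0 < (e / 2) ^+ 2 by rewrite exprn_gt0// divr_gt0.
have x0 i : 0 <= modulus (x i) ^+ 2 by rewrite sqr_ge0.
have [|X0 hX0] := esum_approx x0 e20.
  by rewrite -/(sqsum x) sqsumE ltry.
exists (undup X0); first exact: undup_uniq.
apply: (@le_lt_trans _ _ (e / 2)); last by rewrite ltr_pdivrMr// ltr_pMr// ltr1n.
have u0 := undup_uniq X0.
apply: hnorm_le => [|X uX]; first by rewrite ltW// divr_gt0.
(* The mass of [x] on [Z] is at most its total mass, of which [X0] already carries all but
   [(e / 2) ^+ 2]; this bounds the mass on [X] outside [X0]. *)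
pose Z := undup X0 ++ [seq i <- X | i \notin X0].
have uZ : uniq Z.
  rewrite cat_uniq u0 filter_uniq// andbT /=; apply/hasPn => i.
  by rewrite mem_filter => /andP[h _] /=; rewrite mem_undup.
have := hX0 _ u0 (fun i (h : i \in X0) => etrans (mem_undup X0 i) h).
rewrite -/(sqsum x) sqsumE /= => h1.
have -> : \sum_(i <- X) modulus ((x - restr (undup X0) x) i) ^+ 2
   = \sum_(i <- [seq i <- X | i \notin X0]) modulus (x i) ^+ 2.
  rewrite big_filter [RHS]big_mkcond; apply: eq_bigr => i _.
  rewrite ell2B restr_val// mem_undup; case: ifPn => /= _; rewrite ?subr0//.
  by rewrite subrr modulus0 expr0n.
have h2 := sum_sq_le x uZ; rewrite big_cat/= in h2.
move: h1; rewrite ler_norml => /andP[h1 _].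
by move: h1 h2; set u := \sum_(i <- undup _) _; set v := \sum_(i <- _) _; lra.
Qed.

Definition finsupp_dense (U : set H) : Prop :=
  [/\ U 0, forall (c : C) x y, U x -> U y -> U (c *: x + y)
    & forall i, U (delta R i)].

Lemma dense_finsupp (U : set H) : finsupp_dense U -> dense_set U.
Proof.
move=> [U0 UD Ud] x e e0; have [X uX hX] := restr_approx x e0.
exists (restr X x) => //; rewrite /restr; elim: X {uX hX} => [|i X IH].
  by rewrite big_nil.
by rewrite big_cons; exact: UD.
Qed.

Lemma bounded_opB (T : H -> H) x y : bounded_op T -> T (x - y) = T x - T y.
Proof.
by move=> [lT _]; have := lT (-1) y x; rewrite !scaleN1r [- y + x]addrC [- T y + _]addrC.
Qed.

Lemma bounded_opD (T : H -> H) x y : bounded_op T -> T (x + y) = T x + T y.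
Proof. by move=> [lT _]; have := lT 1 x y; rewrite !scale1r. Qed.

Lemma bounded_op0 (T : H -> H) : bounded_op T -> T 0 = 0.
Proof. by move=> bT; rewrite -{1}(subrr 0) (bounded_opB _ _ bT) subrr. Qed.

Lemma bounded_opZ (T : H -> H) (c : C) x : bounded_op T -> T (c *: x) = c *: T x.
Proof.
by move=> bT; have [lT _] := bT; have := lT c x 0; rewrite addr0 (bounded_op0 bT) addr0.
Qed.

Lemma bounded_op_bound (T : H -> H) : bounded_op T ->
  exists2 M : R, 0 < M & forall x, hnorm (T x) <= M * hnorm x.
Proof.
move=> [_ [M h]]; exists (`|M| + 1) => [|x]; first by rewrite ltr_wpDl.
apply: le_trans (h x Logic.I) _; rewrite ler_wpM2r ?hnorm_ge0//.
by apply: le_trans (ler_norm _) _; rewrite lerDl.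
Qed.

Lemma bounded_op_eq_dense (U : set H) (S T : H -> H) : dense_set U ->
  bounded_op S -> bounded_op T -> (forall x, U x -> S x = T x) -> S = T.
Proof.
move=> dU bS bT h; apply/funext => x; apply/eqP; rewrite -subr_eq0; apply/eqP.
apply: hnorm_small => e e0.
have [M M0 hM] := bounded_op_bound bS; have [N N0 hN] := bounded_op_bound bT.
have MN0 : 0 < 2 * (M + N) by rewrite mulr_gt0// addr_gt0.
have [y Uy hy] := dU x _ (divr_gt0 e0 MN0).
have -> : S x - T x = S (x - y) - T (x - y).
  rewrite (bounded_opB _ _ bS) (bounded_opB _ _ bT) (h _ Uy).
  by rewrite opprB addrA subrK.
apply: le_trans (hnormD _ _) _; rewrite hnormN.
apply: (@le_trans _ _ (2 * (M + N) * (e / (2 * (M + N))))).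
  rewrite -mulrA ler_wpM2l// mulrDl.
  by apply: lerD; [apply: le_trans (hM _) _|apply: le_trans (hN _) _]; rewrite ler_wpM2l// ltW.
by rewrite mulrC divfK// gt_eqF.
Qed.

Lemma bounded_op_eq_delta (S T : H -> H) :
  bounded_op S -> bounded_op T -> (forall i, S (delta R i) = T (delta R i)) -> S = T.
Proof.
move=> bS bT h.
apply: (@bounded_op_eq_dense [set x | S x = T x]) => //; apply: dense_finsupp.
split=> //=; first by rewrite (bounded_op0 bS) (bounded_op0 bT).
move=> c x y xE yE; rewrite (bounded_opD _ _ bS) (bounded_opD _ _ bT).
by rewrite (bounded_opZ _ _ bS) (bounded_opZ _ _ bT) xE yE.
Qed.

(** Density makes the extension unique, so the choice made by [xget] can only return [S]. *)
Lemma bounded_extension_eq (U : set H) (S T : H -> H) : dense_set U ->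
  bounded_op S -> (forall x, U x -> S x = T x) -> bounded_extension U T = S.
Proof.
move=> dU bS h; rewrite /bounded_extension.
case: xgetP => [S' _ [_ bS' h']|/(_ S)]; last by case.
by apply: bounded_op_eq_dense dU bS' bS _ => x Ux; rewrite h' ?h.
Qed.

Lemma csummable_inner x y : csummable (fun i => ((x i)^* * y i)%C).
Proof.
apply: (@csummable_bound _ _ _ (hnorm x ^+ 2 + hnorm y ^+ 2)) => X uX.
apply: le_trans (lerD (sum_sq_le x uX) (sum_sq_le y uX)).
rewrite -big_split/=; apply: ler_sum => i _; rewrite modulusM modulus_conj.
have := modulus_ge0 (x i); have := modulus_ge0 (y i).
by move: (modulus _) (modulus _) => a b; nra.
Qed.

Lemma inner_deltal i y : inner (delta R i) y = y i.
Proof.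
apply: csum_eq; first exact: csummable_inner.
rewrite [X in hassum _ X](_ : _ =
  \sum_(j <- [:: i]) ((delta R i j)^* * y j)%C); last first.
  by rewrite big_seq1 delta_val eqxx conjC1 mul1r.
apply: hassum_fin => // j; rewrite inE delta_val => /negPf ->.
by rewrite conjC0 mul0r.
Qed.

(** Pairing with [delta R i] recovers the coordinate [i], so an adjoint is unique. *)
Lemma adj_eq (S T : H -> H) : bounded_op S ->
  (forall x y, inner (T x) y = inner x (S y)) -> adj T = S.
Proof.
move=> bS h; rewrite /adj; case: xgetP => [S' _ [_ h']|/(_ S)]; last by case.
by apply/funext => y; apply: ell2P => i; rewrite -!inner_deltal -h' h.
Qed.

Lemma bounded_op_cst0 : bounded_op (0 : H -> H).
Proof.
split; first by move=> a x y; rewrite scaler0 addr0.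
by exists 0 => x _; rewrite mul0r hnorm0.
Qed.

End Ell2Norm.

(** * Diagonal operators *)

Section Diagonal.
Variables (R : realType) (I : choiceType).
Local Notation C := (R[i])^o.
Local Notation H := (ell2 R I).
Implicit Types (k : I -> C) (x y : H).

Lemma diagE k x i : diag_dom k x -> diag k x i = k i * x i.
Proof. by move=> h; rewrite /diag insubdK. Qed.

Lemma diag_dom_bounded k (M : R) x : (forall i, modulus (k i) <= M) -> diag_dom k x.
Proof.
move=> h; apply: (@square_summable_dom _ _ _ x M) => i.
by rewrite /diag_fun modulusM ler_wpM2r ?modulus_ge0.
Qed.

Lemma diag_dom_lin k (c : C) x y : diag_dom k x -> diag_dom k y ->
  diag_dom k (c *: x + y).
Proof.
move=> hx hy; rewrite /diag_dom/= (_ : diag_fun k _ = c *: diag_fun k x + diag_fun k y).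
  by rewrite rpredD ?rpredZ.
by apply/funext => i; rewrite /diag_fun ell2D ell2Z mulrDr mulrCA.
Qed.

Lemma diag_lin k (c : C) x y : diag_dom k x -> diag_dom k y ->
  diag k (c *: x + y) = c *: diag k x + diag k y.
Proof.
move=> hx hy; apply: ell2P => i.
rewrite (diagE _ (diag_dom_lin c hx hy)).
rewrite -[RHS]/(c * diag k x i + diag k y i) (diagE i hx) (diagE i hy).
by rewrite -[X in k i * X]/(c * x i + y i) mulrDr mulrCA.
Qed.

Lemma diag_dom_finsupp k : finsupp_dense (diag_dom k).
Proof.
split.
- by apply: (@square_summable_dom _ _ _ 0 0) => i; rewrite mul0r /diag_fun ell20 mulr0 modulus0.
- by move=> c x y; exact: diag_dom_lin.
- move=> i; apply: (@square_summable_dom _ _ _ (delta R i) (modulus (k i))) => j.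
  rewrite /diag_fun modulusM delta_val; case: eqP => [->//|_].
  by rewrite modulus0 !mulr0.
Qed.

Lemma diag_bounded_op k (M : R) : (forall i, modulus (k i) <= M) -> bounded_op (diag k).
Proof.
move=> h; have hd x := diag_dom_bounded x h.
split; first by move=> c x y; exact: diag_lin.
exists `|M| => x _; apply: hnorm_dom => // i.
by rewrite diagE// modulusM ler_wpM2r ?modulus_ge0// (le_trans (h i))// ler_norm.
Qed.

Lemma bounded_op_comp (S T : H -> H) : bounded_op S -> bounded_op T -> bounded_op (S \o T).
Proof.
move=> bS bT; split.
  by move=> c x y /=; rewrite (bounded_opD _ _ bT) (bounded_opZ _ _ bT)
    (bounded_opD _ _ bS) (bounded_opZ _ _ bS).
have [M M0 hM] := bounded_op_bound bS; have [N N0 hN] := bounded_op_bound bT.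
exists (M * N) => x _; apply: le_trans (hM _) _.
by rewrite -mulrA ler_wpM2l// ltW.
Qed.

Lemma innerZl (c : C) x y : inner (c *: x) y = (c : R[i])^* * inner x y.
Proof.
apply: csum_eq; first exact: csummable_inner.
have := hassumZ ((c : R[i])^*) (csummableP (csummable_inner x y)).
congr hassum; apply/funext => i.
by rewrite mulrA -rmorphM.
Qed.

Lemma conj_realC (a : R) : (a%:C : R[i])^* = a%:C.
Proof. exact: conjc_real. Qed.

Lemma self_adjoint_diag (w : I -> R) : self_adjoint (domD w) (Dop w).
Proof.
split.
- by apply: dense_finsupp; exact: diag_dom_finsupp.
- move=> c x y hx hy; split; [exact: diag_dom_lin|exact: diag_lin].
- move=> y z; split.
    move=> [hy <-] x hx; rewrite /inner; congr csum; apply/funext => i.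
    rewrite (diagE i hx) (diagE i hy) rmorphM/= conj_realC.
    by rewrite [_ * (x i)^*]mulrC mulrA.
  (* Testing [h] on the basis vectors determines [z] coordinatewise as the product of [w] and [y],
     and square summability of [z] then puts [y] in the domain. *)
  move=> h; have dd i : domD w (delta R i).
    by have [_ _] := diag_dom_finsupp (fun i => (w i)%:C); exact.
  have zE i : z i = (w i)%:C * y i.
    rewrite -[LHS]inner_deltal -(h _ (dd i)).
    have -> : Dop w (delta R i) = (w i)%:C *: delta R i.
      apply: ell2P => j; rewrite (diagE j (dd i)) -[RHS]/((w i)%:C * delta R i j).
      by rewrite delta_val; case: eqP => [->//|_]; rewrite !mulr0.
    by rewrite innerZl conj_realC inner_deltal.
  have dy : domD w y.
    apply: (@square_summable_dom _ _ _ z 1) => i.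
    by rewrite mul1r /diag_fun zE.
  by split => //; apply: ell2P => i; rewrite zE; exact: diagE.
Qed.

(** A cluster point exists by Tychonoff's theorem in a product of segments; its neighbourhoods
    control finitely many coordinates at a time. *)
Lemma pointwise_cluster (J : eqType) (z : nat -> J -> R) (M : R) :
  (forall n j, `|z n j| <= M) ->
  exists p : J -> R, forall (X : seq J) (e : R) n0, 0 < e ->
    exists2 n, (n0 <= n)%N & forall j, j \in X -> `|z n j - p j| <= e.
Proof.
move=> zM; pose T := prod_topology (fun _ : J => (R : topologicalType)).
have cK : compact [set f : T | forall j, `[- M, M]%classic (f j)].
  by apply: (@tychonoff J (fun=> R : topologicalType) (fun=> `[- M, M]%classic)) => j;
    exact: segment_compact.
pose F : set_system T := (z : nat -> T) @ \oo.
have FA : F [set f : T | forall j, `[- M, M]%classic (f j)].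
  by exists 0%N => // n _ j; rewrite /= in_itv/= -ler_norml.
have [p [_ clp]] := cK F _ FA; exists p => X e n0 e0.
have FN : F [set z n | n in [set n | (n0 <= n)%N]].
  exists n0 => // n n0n; exists n => //.
have NB : nbhs (p : T) [set f : T | forall j, j \in X -> `|f j - p j| <= e].
  have Fp : Filter (nbhs (p : T)) := nbhs_filter p.
  elim: X => [|j X IH]; first by apply: (@filterS _ _ Fp setT) => [f _ j|]; [rewrite in_nil|exact: filterT].
  have h : \forall f \near (p : T), `|f j - p j| <= e.
    have := @proj_continuous J (fun=> R : topologicalType) j p.
    move=> /cvgr_dist_le /(_ e e0); apply: filterS => f.
    by rewrite distrC.
  apply: (@filterS _ _ Fp _ _ _ (filterI h IH)) => f [h1 h2] i; rewrite in_cons => /predU1P[->//|].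
  exact: h2.
by have [_ [[n n0n <-] h]] := clp _ _ FN NB; exists n.
Qed.

(** Off a finite set the weights are small; on it, closeness to a pointwise cluster point is enough.
    Balancing the two extracts a convergent subsequence. *)
Lemma compact_comp_diag (a : H -> H) k (B : R) : bounded_op a ->
  (forall i, modulus (k i) <= B) ->
  (forall e : R, 0 < e -> exists X : seq I, forall i, i \notin X -> modulus (k i) <= e) ->
  compact_op (a \o diag k).
Proof.
move=> ba kB k0; split.
  by apply: bounded_op_comp => //; exact: diag_bounded_op kB.
move=> x [M xM].
have M0 : 0 <= M by apply: le_trans (xM 0%N); exact: hnorm_ge0.
pose z n (j : I * bool) := if j.2 then complex.Re (x n j.1) else complex.Im (x n j.1).
have zM n j : `|z n j| <= M.
  apply: le_trans (xM n); apply: le_trans (modulus_le_hnorm (x n) j.1).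
  by rewrite /z; case: j.2; [exact: ler_Re_modulus|exact: ler_Im_modulus].
have [p hp] := pointwise_cluster zM.
pose yf i : C := p (i, true) +i* p (i, false).
have near_y (X : seq I) (e : R) n0 : 0 < e ->
    exists2 n, (n0 <= n)%N & forall i, i \in X -> modulus (x n i - yf i) <= e.
  move=> e0; have e20 : 0 < e / 2 by rewrite divr_gt0.
  have [n n0n hn] := hp [seq (i, b) | i <- X, b <- [:: true; false]] _ n0 e20.
  exists n => // i iX; apply: le_trans (ler_modulus_ReIm _) _.
  have hb b : (i, b) \in [seq (i, b) | i <- X, b <- [:: true; false]].
    by apply/allpairsP; exists (i, b); split => //; rewrite !inE; case: b.
  have := hn _ (hb true); have := hn _ (hb false); rewrite /z /= /yf.
  case: (x n i) => u v /= h1 h2; rewrite (splitr e).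
  by apply: lerD; [exact: h2|exact: h1].
have yss : yf \in @square_summable R I.
  apply: (@square_summable_bound _ _ _ (2 * M ^+ 2 + 2)) => X uX.
  (* With this accuracy the errors on [X] contribute at most [e ^+ 2 * size X <= 1], which bounds
     the mass of [yf] on [X] independently of [X]. *)
  pose e : R := (size X).+1%:R^-1.
  have e0 : 0 < e by rewrite invr_gt0.
  have [n _ hn] := near_y X e 0%N e0.
  apply: (@le_trans _ _ (\sum_(i <- X) (2 * modulus (x n i) ^+ 2 + 2 * e ^+ 2))).
    rewrite big_seq [leRHS]big_seq; apply: ler_sum => i iX.
    have -> : yf i = x n i + - (x n i - yf i) by rewrite opprB addrC subrK.
    apply: le_trans (modulus2D _ _) _; rewrite modulusN lerD2l ler_wpM2l//.
    by rewrite ler_pXn2r ?nnegrE ?modulus_ge0 ?hn// ltW.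
  rewrite big_split/= -mulr_sumr lerD//.
    rewrite ler_wpM2l//; apply: le_trans (sum_sq_le _ uX) _.
    by rewrite ler_pXn2r ?nnegrE ?hnorm_ge0.
  rewrite big_const_seq count_predT iter_addr_0 -[(_ * _) *+ _]mulr_natr -mulrA.
  have e1 : e * (size X)%:R <= 1 by rewrite mulrC ler_pdivrMr// mul1r ler_nat.
  have e2 : e <= 1 by rewrite invf_le1// ler1n.
  suff : e ^+ 2 * (size X)%:R <= 1 by lra.
  by rewrite expr2 -mulrA mulr_ile1 ?(ltW e0)// mulr_ge0// ltW.
pose y : H := Ell2 yss.
have eps0 n : 0 < n.+1%:R^-1 :> R by rewrite invr_gt0.
have /choice [Xs hXs] n := k0 _ (eps0 n).
(* The factor [(size (Xs n)).+1] makes the sum of the squared errors over [Xs n] at most the square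
   of [1 / n.+1]. *)
pose e n : R := (n.+1%:R * (size (Xs n)).+1%:R)^-1.
have e0 n : 0 < e n by rewrite invr_gt0 mulr_gt0.
have /choice [g hg] (q : nat * nat) :
    exists m, (q.2 <= m)%N /\ forall i, i \in undup (Xs q.1) -> modulus (x m i - yf i) <= e q.1.
  by have [m h1 h2] := near_y (undup (Xs q.1)) _ q.2 (e0 q.1); exists m.
(* [g (n, m)] is an index not below [m] with accuracy [e n] on [Xs n]; asking for an index beyond
   the previous one makes [kk] strictly increasing. *)
pose kk := fix kk n := if n is n'.+1 then g (n, (kk n').+1) else g (0, 0)%N.
have kkE n : exists m, kk n = g (n, m) by case: n => [|n]; [exists 0%N|exists (kk n).+1].
exists kk, (a (diag k y)); split.
  by move=> n; have [/= h _] := hg (n.+1, (kk n).+1).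
have dk v : diag_dom k v := diag_dom_bounded v kB.
have bk : bounded_op (diag k) := diag_bounded_op kB.
have B0 : 0 <= `|B| by [].
pose D := 2 * (M + hnorm y).
have D0 : 0 <= D by rewrite mulr_ge0// addr_ge0// hnorm_ge0.
have est n : hnorm (diag k (x (kk n) - y)) <= (`|B| + D) * n.+1%:R^-1.
  have [m ->] := kkE n; have [_ /= hm] := hg (n, m).
  set v := x _ - y.
  have vD : hnorm v <= D.
    by apply: le_trans (hnormD _ _) _; rewrite hnormN ler_wpM2l// lerD2r.
  have n0 := ltW (eps0 n).
  apply: hnorm_le => [|X uX]; first by rewrite mulr_ge0 ?addr_ge0.
  (* On [Xs n] the vectors are close and the weights bounded by [B]; off [Xs n] the weights are at
     most [1 / n.+1] and the vectors bounded by [D]. *)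
  rewrite (bigID (mem (Xs n)))/=.
  apply: (@le_trans _ _ ((`|B| * n.+1%:R^-1) ^+ 2 + (D * n.+1%:R^-1) ^+ 2)); last first.
    rewrite mulrDl; move: (mulr_ge0 B0 n0) (mulr_ge0 D0 n0).
    by set b1 := _ * _; set b2 := _ * _ => h1 h2; nra.
  apply: lerD.
    apply: (@le_trans _ _ (\sum_(i <- undup (Xs n)) (`|B| * e n) ^+ 2)).
      rewrite -big_filter; set Y := [seq i <- X | _].
      have uY : uniq Y by rewrite filter_uniq.
      have sY : {subset Y <= undup (Xs n)}.
        by move=> i; rewrite mem_filter mem_undup => /andP[].
      rewrite (big_uniq_subset _ uY (undup_uniq _) sY) -[leLHS]addr0; apply: lerD.
        rewrite big_seq [leRHS]big_seq; apply: ler_sum => i /sY iY.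
        rewrite (diagE _ (dk _)) modulusM.
        rewrite ler_pXn2r ?nnegrE ?mulr_ge0 ?modulus_ge0 ?(ltW (e0 n))//.
        by rewrite ler_pM ?modulus_ge0//; [exact: le_trans (kB i) (ler_norm _)|exact: hm].
      by apply: sumr_ge0 => i _; rewrite sqr_ge0.
    rewrite big_const_seq count_predT iter_addr_0 !exprMn -mulrnAr ler_wpM2l ?sqr_ge0//.
    have s1 : (size (undup (Xs n)) <= (size (Xs n)).+1)%N.
      by apply: leq_trans (size_undup _) _.
    rewrite /e invfM exprMn -mulrnAr ler_piMr ?sqr_ge0//.
    rewrite -mulr_natr expr2 -mulrA mulr_ile1 ?invf_le1 ?ler1n// ?mulr_ge0//.
    by rewrite mulrC ler_pdivrMr// mul1r ler_nat.
  apply: (@le_trans _ _ (\sum_(i <- X) (n.+1%:R^-1) ^+ 2 * modulus (v i) ^+ 2)).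
    rewrite [leRHS](bigID (mem (Xs n)))/= -[leLHS]add0r; apply: lerD.
      by apply: sumr_ge0 => i _; rewrite mulr_ge0 ?sqr_ge0.
    apply: ler_sum => i iX; rewrite (diagE _ (dk _)) modulusM exprMn.
    rewrite ler_wpM2r ?sqr_ge0// ler_pXn2r ?nnegrE ?modulus_ge0//; exact: hXs.
  rewrite -mulr_sumr exprMn mulrC ler_wpM2r ?sqr_ge0//.
  apply: le_trans (sum_sq_le _ uX) _.
  by rewrite ler_pXn2r ?nnegrE ?hnorm_ge0.
have [N N0 hN] := bounded_op_bound ba.
have lim0 : (fun n => N * (`|B| + D) * harmonic n) @ \oo --> (0 : R).
  rewrite -[X in _ --> X](mulr0 (N * (`|B| + D))).
  by apply: cvgM; [exact: cvg_cst|exact: cvg_harmonic].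
apply: (@squeeze_cvgr _ _ _ _ (fun=> 0) _ _ _ _ _ lim0); last exact: cvg_cst.
apply: nearW => n; rewrite hnorm_ge0/=.
have -> : a (diag k (x (kk n))) - a (diag k y) = a (diag k (x (kk n) - y)).
  by rewrite (bounded_opB _ _ bk) (bounded_opB _ _ ba).
by apply: le_trans (hN _) _; rewrite -mulrA ler_wpM2l// ltW.
Qed.

Lemma singular_value_le (T S : H -> H) n (M : R) : 0 <= M -> bounded_op S -> rank_le n S ->
  (forall x, hnorm (T x - S x) <= M * hnorm x) -> 0 <= singular_value T n <= M.
Proof.
move=> M0 bS rS h; rewrite /singular_value; set A := [set _ | _].
have AM : A M by split => //; exists S.
have lA : lbound A 0 by move=> y [].
by rewrite lb_le_inf ?ge_inf//; [exists 0|exists M].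
Qed.

Lemma rank_le_mono m n (T : H -> H) : (m <= n)%N -> rank_le m T -> rank_le n T.
Proof.
move=> mn [v hv].
exists (fun i : 'I_n => if insub (val i) is Some j then v j else 0) => x.
have [c cE] := hv x.
exists (fun i : 'I_n => if insub (val i) is Some j then c j else 0).
pose F (i : nat) : H := if insub i is Some j then c j *: v j else 0.
transitivity (\sum_(i < m) F i).
  by rewrite cE; apply: eq_bigr => i _; rewrite /F valK.
rewrite (big_ord_widen _ F mn) [LHS]big_mkcond; apply: eq_bigr => i _.
rewrite /F; case: ifPn => [im|/negPf im]; last by rewrite insubF// scaler0.
by rewrite insubT.
Qed.

Lemma rank_le_finite_diag (S : H -> H) k (X : seq I) (M : R) : bounded_op S -> uniq X ->
  (forall i, modulus (k i) <= M) -> (forall i, i \notin X -> k i = 0) ->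
  rank_le (size X) (S \o diag k).
Proof.
move=> bS uX kM k0; exists (fun i => S (delta R (tnth (in_tuple X) i))) => x.
exists (fun i => diag k x (tnth (in_tuple X) i)).
have -> : (S \o diag k) x = S (restr X (diag k x)).
  rewrite /=; congr S; apply: ell2P => i; rewrite restr_val//; case: ifPn => // iX.
  by rewrite (diagE _ (diag_dom_bounded x kM)) k0// mul0r.
rewrite /restr -(big_tnth _ _ X xpredT (fun i => diag k x i *: S (delta R i))).
elim: X {uX k0} => [|i X IH]; first by rewrite !big_nil (bounded_op0 bS).
by rewrite !big_cons (bounded_opD _ _ bS) (bounded_opZ _ _ bS) IH.
Qed.

Lemma sum_inv_sq_le (N : nat) : \sum_(0 <= n < N) (n.+1%:R ^+ 2)^-1 <= 2 :> R.
Proof.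
case: N => [|N]; first by rewrite big_geq.
(* The sharper bound goes through by induction, since [1 / (a + 1)^2 <= 1 / a - 1 / (a + 1)]. *)
suff : \sum_(0 <= n < N.+1) (n.+1%:R ^+ 2)^-1 <= 2 - N.+1%:R^-1 :> R.
  by move=> h; apply: le_trans h _; rewrite gerBl invr_ge0.
elim: N => [|N IH]; first by rewrite big_nat1 expr1n invr1; lra.
rewrite big_nat_recr//=; apply: le_trans (lerD IH (lexx _)) _.
have a0 : 0 < N.+1%:R :> R by rewrite ltr0n.
rewrite -(natr1 N.+1); move: (N.+1%:R : R) a0 => a a0.
have -> : 2 - (a + 1)^-1 = (2 - a^-1) + (a * (a + 1))^-1.
  by field; rewrite !gt_eqF//; lra.
by rewrite lerD2l lef_pV2 ?posrE; [nra|nra|nra].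
Qed.

Definition height_growth (L : I -> nat) (Q : nat) : Prop :=
  forall n : nat, exists X : seq I,
    [/\ uniq X, (size X <= Q ^ n)%N & forall i, (L i <= n)%N -> i \in X].

(** Cutting [k] off at height [j] leaves rank at most [Q ^ j] and an error of size
    [exp (- s (j + 1))]. For [Q ^ j <= n < Q ^ (j + 1)] the last hypothesis turns the power [p] of
    this error into a bound by a multiple of [1 / (n + 1)^2]. *)
Lemma schatten_comp_diag (L : I -> nat) (Q : nat) (p s M : R) (S : H -> H) k :
  height_growth L Q -> (1 < Q)%N -> bounded_op S -> 0 < p -> 0 <= s -> 0 <= M ->
  (forall i, modulus (k i) <= M * expR (- (s * (L i)%:R))) ->
  Q%:R ^+ 2 <= expR (s * p) ->
  schatten p (S \o diag k).
Proof.
move=> hL Q1 bS p0 s0 M0 kM Qs.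
have e1 n : expR (- (s * n%:R)) <= 1 by rewrite -expR0 ler_expR oppr_le0 mulr_ge0.
have kM' i : modulus (k i) <= M by apply: le_trans (kM i) _; rewrite ler_piMr.
split; first by apply: bounded_op_comp => //; exact: diag_bounded_op kM'.
have [B B0 hB] := bounded_op_bound bS.
have approx (X : seq I) (c : R) n : uniq X -> (size X <= n)%N -> 0 <= c ->
    (forall i, i \notin X -> modulus (k i) <= c) ->
    0 <= singular_value (S \o diag k) n <= B * c.
  move=> uX sX c0 hc; pose k' i := if i \in X then k i else 0.
  have k'M i : modulus (k' i) <= M by rewrite /k'; case: ifP; rewrite ?modulus0.
  apply: (@singular_value_le _ (S \o diag k')).
  - by rewrite mulr_ge0// ltW.
  - by apply: bounded_op_comp => //; exact: diag_bounded_op k'M.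
  - apply: rank_le_mono sX _; apply: rank_le_finite_diag k'M _ => // i iX.
    by rewrite /k' (negPf iX).
  - move=> x /=; rewrite -(bounded_opB _ _ bS); apply: le_trans (hB _) _.
    rewrite -mulrA ler_wpM2l ?(ltW B0)//; apply: hnorm_dom => // i.
    rewrite -[(_ - _ : H) i]/(diag k x i - diag k' x i).
    rewrite (diagE _ (diag_dom_bounded x kM')) (diagE _ (diag_dom_bounded x k'M)).
    rewrite -mulrBl modulusM ler_wpM2r ?modulus_ge0// /k'.
    by case: ifPn => [_|iX]; rewrite ?subrr ?modulus0// subr0 hc.
have BM0 : 0 <= B * M by rewrite mulr_ge0// ltW.
have bound n : ((singular_value (S \o diag k) n) `^ p <=
    (B * M) `^ p * (n.+1%:R ^+ 2)^-1).
  case: n => [|n].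
    have /andP[h0 h1] := @approx [::] M 0 isT isT M0 (fun i _ => kM' i).
    by rewrite expr1n invr1 mulr1; apply: ge0_ler_powR => //; rewrite ltW.
  pose j := trunc_log Q n.+1.
  have /andP[j1 j2] := trunc_log_bounds Q1 (ltn0Sn n).
  have [X [uX sX hX]] := hL j.
  have c0 : 0 <= M * expR (- (s * j.+1%:R)) by rewrite mulr_ge0// expR_ge0.
  have /andP[h0 h1] : 0 <= singular_value (S \o diag k) n.+1
      <= B * (M * expR (- (s * j.+1%:R))).
    apply: (approx X) => //; first exact: leq_trans sX j1.
    move=> i iX; apply: le_trans (kM i) _; rewrite ler_wpM2l// ler_expR lerN2 ler_wpM2l//.
    by rewrite ler_nat ltnNge; apply: contra iX => /hX.
  apply: (@le_trans _ _ ((B * (M * expR (- (s * j.+1%:R)))) `^ p)).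
    by apply: ge0_ler_powR; rewrite ?nnegrE ?(ltW p0)// (le_trans h0).
  rewrite mulrA powRM// ?expR_ge0// ler_wpM2l ?powR_ge0// -expRM.
  have -> : - (s * j.+1%:R) * p = - (s * p * j.+1%:R) by rewrite mulNr mulrAC.
  rewrite expRN lef_pV2 ?posrE ?expR_gt0 ?exprn_gt0// expRM_natr.
  apply: (@le_trans _ _ ((Q%:R ^+ 2) ^+ j.+1)).
    by rewrite -!natrX ler_nat -expnM mulnC expnM leq_exp2r.
  by rewrite lerXn2r ?nnegrE ?sqr_ge0 ?expR_ge0.
pose c := (B * M) `^ p.
have c0 : 0 <= c by exact: powR_ge0.
apply: (@le_lt_trans _ _ (c * 2)%:E); last exact: ltry.
apply: lime_le.
  by apply: is_cvg_nneseries => n _ _; rewrite lee_fin powR_ge0.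
apply: nearW => N; rewrite sumEFin lee_fin.
apply: (@le_trans _ _ (\sum_(0 <= n < N) c * (n.+1%:R ^+ 2)^-1)).
  by apply: ler_sum => n _; exact: bound.
by rewrite -mulr_sumr ler_wpM2l// sum_inv_sq_le.
Qed.

End Diagonal.

(** * Words ending in powers of a letter *)

Section CellArithmetic.
Local Open Scope nat_scope.
Implicit Types a b i c n : nat.

Lemma minn_near a b n : minn a n = minn b n -> a = b \/ n <= a /\ n <= b.
Proof. by rewrite /minn; do 2![case: ltnP => ?]; lia. Qed.

Lemma near_minn a b n : a = b \/ n <= a /\ n <= b -> minn a n = minn b n.
Proof. by move=> [->//|[/minn_idPr -> /minn_idPr ->]]. Qed.

(** Replaces a pair by its order, minimum and distance, so that no truncated subtraction is left for
    linear arithmetic. The last clause excludes distance 0 when [z] is false. *)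
Lemma min_distP a b : exists z i c, [/\ (b <= a) = z, minn a b = i, (a - b) + (b - a) = c,
  a = (if z then i + c else i) & b = (if z then i else i + c) /\ (z || (0 < c))].
Proof. by exists (b <= a), (minn a b), ((a - b) + (b - a)); rewrite /minn; case: leqP => h; split=> //; lia. Qed.

(** One coordinate moves, by at most one, so minimum and distance move by at most one. Two units of
    precision are lost because the comparison must survive also for [n = 0]: only a distance of at
    most 1 can be reversed, and truncation at 2 still tells it from larger ones. *)
Lemma cell_shift n a b a' b' a2 b2 a2' b2' :
  (b <= a) = (b' <= a') -> minn (minn a b) n.+2 = minn (minn a' b') n.+2 ->
  minn ((a - b) + (b - a)) n.+2 = minn ((a' - b') + (b' - a')) n.+2 ->
  a2 + a' = a2' + a -> b2 + b' = b2' + b ->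
  a2 = a \/ b2 = b -> a2 <= a.+1 -> a <= a2.+1 -> b2 <= b.+1 -> b <= b2.+1 ->
  [/\ (b2 <= a2) = (b2' <= a2'), minn (minn a2 b2) n = minn (minn a2' b2') n
    & minn ((a2 - b2) + (b2 - a2)) n = minn ((a2' - b2') + (b2' - a2')) n].
Proof.
have [z [i [c [-> -> -> -> [-> h]]]]] := min_distP a b.
have [z' [i' [c' [-> -> -> -> [-> h']]]]] := min_distP a' b'.
have [y [j [e [-> -> -> -> [-> hy]]]]] := min_distP a2 b2.
have [y' [j' [e' [-> -> -> -> [-> hy']]]]] := min_distP a2' b2'.
move=> zz /minn_near hi /minn_near hm; rewrite -{}zz {z'} in h' *.
move=> ha hb one u1 u2 u3 u4.
suff [? [? ?]] : y = y' /\ (j = j' \/ n <= j /\ n <= j') /\ (e = e' \/ n <= e /\ n <= e').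
  by split=> //; exact: near_minn.
case: z y y' h h' hy hy' ha hb one u1 u2 u3 u4 => [] [] [] /= h h' hy hy' ha hb one u1 u2 u3 u4.
all: by case: hi => [?|[? ?]]; case: hm => [?|[? ?]]; case: one => ?; lia.
Qed.

End CellArithmetic.

Section Words.
Variables (d : nat) (g : letter d).
Local Notation letter := (letter d).
Implicit Types (w v : seq letter) (x y : letter) (p : seq letter * nat).

(* A word w is core w ++ g^(trail w), with core w not ending in g. *)
Fixpoint core w : seq letter :=
  if w is x :: w' then
    if nilp (core w') && (x == g) then [::] else x :: core w'
  else [::].

Lemma core_cons x w :
  core (x :: w) = if nilp (core w) && (x == g) then [::] else x :: core w.
Proof. by []. Qed.

Definition trail w : nat := size w - size (core w).

Definition coreless v := nilp v || (last g v != g).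

Lemma core_cat w : w = core w ++ nseq (trail w) g.
Proof.
rewrite /trail; elim: w => //= x w IH.
case: ifPn => [/andP[cw /eqP ->]|_] /=; last by rewrite subSS -IH.
by rewrite (nilP cw) /= subn0 in IH *; rewrite -IH.
Qed.

Lemma size_core_trail w : size w = (size (core w) + trail w)%N.
Proof. by rewrite {1}(core_cat w) size_cat size_nseq. Qed.

Lemma core_coreless w : coreless (core w).
Proof.
elim: w => //= x w IH; case: ifPn => // h.
rewrite /coreless /=; move: IH h; rewrite /coreless; case: (core w) => [|y v] //= _.
Qed.

Lemma core_nseq k : core (nseq k g) = [::].
Proof. by elim: k => //= k ->; rewrite eqxx. Qed.

Lemma core_eq v k : coreless v -> core (v ++ nseq k g) = v.
Proof.
elim: v => [|x v IH]; first by rewrite core_nseq.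
move=> h; case: v IH h => [|y v] IH h.
  by rewrite /= core_nseq /=; move: h; rewrite /coreless /= => /negPf ->.
by rewrite cat_cons core_cons (IH h).
Qed.

Lemma trail_eq v k : coreless v -> trail (v ++ nseq k g) = k.
Proof. by move=> h; rewrite /trail core_eq// size_cat size_nseq addKn. Qed.

(** Left multiplication by a letter in the coordinates (core, trail); the trail moves only if the
    core is empty. *)
Definition lstep x p : seq letter * nat :=
  if p.1 is y :: r then if y == linv x then (r, p.2) else (x :: p.1, p.2)
  else if (0 < p.2)%N && (x == linv g) then ([::], p.2.-1)
  else if x == g then ([::], p.2.+1) else ([:: x], p.2).

Lemma core_lcons x w :
  (core (lcons x w), trail (lcons x w)) = lstep x (core w, trail w).
Proof.
rewrite {1 2}(core_cat w); have := core_coreless w.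
move: (core w) (trail w) => v k cv.
have ct v' k' : coreless v' -> (core (v' ++ nseq k' g), trail (v' ++ nseq k' g)) = (v', k').
  by move=> h; rewrite core_eq// trail_eq.
rewrite /lstep; case: v cv => [|y v] cv; rewrite [RHS]/= [lcons _ _]/=.
  case: k => [|k]; rewrite [RHS]/= ?[lcons _ _]/=.
    case: eqVneq => [->|xg]; first exact: (ct [::] 1%N).
    by apply: (ct [:: x] 0%N); rewrite /coreless/= xg.
  rewrite linv_eq; case: ifPn => _; first exact: (ct [::] k).
  case: eqVneq => [->|xg]; first exact: (ct [::] k.+2).
  by apply: (ct [:: x] k.+1); rewrite /coreless/= xg.
case: ifPn => _; last by apply: (ct [:: x, y & v] k); move: cv; rewrite /coreless.
by apply: ct; move: cv; rewrite /coreless /=; case: v.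
Qed.

(* Cells take finitely many values, and by [cell_lstep] multiplication by a letter
   maps cells into cells, up to a loss of precision. *)
Definition cell n p : seq letter * bool * nat * nat :=
  (take n p.1, (p.2 <= size p.1)%N, minn (minn (size p.1) p.2) n,
   minn ((size p.1 - p.2) + (p.2 - size p.1)) n).

Lemma cell_mono m n p q : (m <= n)%N -> cell n p = cell n q -> cell m p = cell m q.
Proof.
move=> mn [h1 h2 h3 h4]; rewrite /cell h2.
have -> : take m p.1 = take m q.1 by rewrite -(take_takel _ mn) h1 take_takel.
by congr (_, _, _, _); move: h3 h4; lia.
Qed.

(** The tests in [lstep] read the first letter of the core and whether the trail is zero, so all
    points of a cell take the same branch and undergo the same displacement. *)
Lemma cell_lstep n x p q : cell n.+2 p = cell n.+2 q ->
  [/\ cell n (lstep x p) = cell n (lstep x q),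
      (size (lstep x p).1 + size q.1 = size (lstep x q).1 + size p.1)%N
    & ((lstep x p).2 + q.2 = (lstep x q).2 + p.2)%N].
Proof.
case: p q => [v k] [v' k']; rewrite /cell /lstep /=; case=> h1 h2 h3 h4.
have {h3 h4} shift := cell_shift h2 h3 h4.
case: v v' h1 h2 shift => [|y v] [|y' v'] //= h1 h2 shift.
  (* For an empty core, the comparison stored in the cell says whether the trail vanishes. *)
  have -> : (0 < k)%N = (0 < k')%N by move: h2; rewrite !leqn0 !lt0n => ->.
  case: ifPn => [/andP[k0 _]|_] /=.
    have k1 : (0 < k)%N by rewrite lt0n -leqn0 h2 leqn0 -lt0n.
    by have [|||||||-> -> ->] := shift 0%N k.-1 0%N k'.-1; try lia; split=> //; lia.
  case: ifPn => _ /=.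
    by have [|||||||-> -> ->] := shift 0%N k.+1 0%N k'.+1; try lia; split=> //; lia.
  by have [|||||||-> -> ->] := shift 1%N k 1%N k'; try lia; split=> //; lia.
case: h1 => <- h1; have h1' : take n v = take n v'.
  by rewrite -(take_takel _ (leqnSn n)) h1 take_takel.
case: ifPn => _ /=.
  rewrite h1'; have [|||||||-> -> ->] := shift (size v) k (size v') k'; try lia.
  by split=> //; lia.
have -> : take n [:: x, y & v] = take n [:: x, y & v'].
  case: n h1 {h1' h2 shift} => [|[|n]] //= h1.
  have n3 : (n <= n.+3)%N by lia.
  by rewrite -(take_takel _ n3) h1 take_takel.
have [|||||||-> -> ->] := shift (size v).+2 k (size v').+2 k'; try lia.
by split=> //; lia.
Qed.

Lemma lstep_bound x p :
  [/\ (size (lstep x p).1 <= (size p.1).+1)%N, (size p.1 <= (size (lstep x p).1).+1)%N,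
      ((lstep x p).2 <= p.2.+1)%N, (p.2 <= (lstep x p).2.+1)%N
    & (0 < size p.1)%N -> (lstep x p).2 = p.2].
Proof.
case: p => [[|y v] k]; rewrite /lstep /=; last by case: ifPn => _ /=; split => //; lia.
case: ifPn => [/andP[k0 _]|_] /=; first by split => //; lia.
by case: ifPn => _ /=; split => //; lia.
Qed.

(** Nothing is truncated here: points near the identity are alone in their cells. *)
Lemma cell_inj n p q : (size p.1 < n)%N -> (p.2 < n)%N -> cell n p = cell n q -> p = q.
Proof.
case: p q => [v k] [v' k']; rewrite /cell /= => h1 h2 [h3 h4 h5 h6].
have [sE ->] : size v = size v' /\ k = k' by lia.
have h1' : (size v' <= n)%N by rewrite -sE ltnW.
by rewrite -(take_oversize (ltnW h1)) h3 (take_oversize h1').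
Qed.

End Words.

(** * Left translations, heights and growth of the free group *)

Section GroupGeometry.
Variables (d : nat) (g : letter d).
Local Notation letter := (letter d).
Local Notation I := (fgroup d).
Implicit Types mu nu : I.

Definition dec mu : seq letter * nat := (core g mu, trail g mu).
Definition Nn mu := size (core g mu).
Definition Ll mu := trail g mu.

(* In the notation of the theorem, this is ||mu| - 2 l(mu, t)| + l(mu, t). *)
Definition height mu : nat := maxn (Nn mu) (2 * Ll mu - Nn mu).

Lemma size_dec mu : size mu = (Nn mu + Ll mu)%N.
Proof. exact: size_core_trail. Qed.

Lemma core_trail_inj : injective dec.
Proof. by move=> mu nu [h1 h2]; apply: val_inj; rewrite /= (core_cat g mu) (core_cat g nu) h1 h2. Qed.

Definition lgen x : I := @Fgroup d [:: x] isT.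

Lemma dec_lgen x mu : dec (lgen x * mu)%g = lstep g x (dec mu).
Proof. exact: core_lcons. Qed.

Lemma fgroup_ind (P : I -> Prop) : P 1%g ->
  (forall x mu, P mu -> P (lgen x * mu)%g) -> forall mu, P mu.
Proof.
move=> P1 PM [w rw]; elim: w rw => [|x w IH] rw.
  by rewrite (_ : Fgroup rw = 1%g)//; apply: val_inj.
have rw' : reduced w by exact: path_sorted rw.
rewrite (_ : Fgroup rw = (lgen x * Fgroup rw')%g); first exact: PM.
apply: val_inj => /=; case: w rw {IH rw'} => //= y w /andP[+ _].
by rewrite /no_cancel => /negPf ->.
Qed.

(** Each letter of [gam] moves a coordinate by at most one. The trail is touched only after the core
    has been emptied, which takes as many letters as the core is long. *)
Lemma geometry_lipschitz gam mu :
  [/\ (Nn (gam * mu)%g <= Nn mu + size gam)%N, (Nn mu <= Nn (gam * mu)%g + size gam)%N,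
      (Ll (gam * mu)%g <= Ll mu + size gam)%N, (Ll mu <= Ll (gam * mu)%g + size gam)%N
    & (size gam <= Nn mu)%N -> Ll (gam * mu)%g = Ll mu].
Proof.
pose P (p : seq letter * nat) n :=
  [/\ (size p.1 <= Nn mu + n)%N, (Nn mu <= size p.1 + n)%N,
      (p.2 <= Ll mu + n)%N, (Ll mu <= p.2 + n)%N & (n <= Nn mu)%N -> p.2 = Ll mu].
suff key (u : seq letter) : P (core g (foldr (@lcons d) mu u),
    trail g (foldr (@lcons d) mu u)) (size u) by exact: key.
elim: u => [|x u]; first by rewrite /P /= !addn0.
rewrite [foldr _ _ (x :: u)]/= core_lcons; set w := foldr _ _ _.
rewrite /P /= => -[h1 h2 h3 h4 h5].
have := lstep_bound g x (core g w, trail g w); set p := lstep _ _ _.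
rewrite /= => -[b1 b2 b3 b4 b5].
by split; lia.
Qed.

(** The factor 3 comes from the branch [2 * Ll - Nn] of the height. *)
Lemma height_lipschitz gam mu :
  (height (gam * mu)%g <= height mu + 3 * size gam)%N /\
  (height mu <= height (gam * mu)%g + 3 * size gam)%N.
Proof. by rewrite /height; have [] := geometry_lipschitz gam mu; lia. Qed.

Lemma Nn_le_height mu : (Nn mu <= height mu)%N.
Proof. by rewrite /height; lia. Qed.

Lemma Ll_le_height mu : (Ll mu <= height mu)%N.
Proof. by rewrite /height; lia. Qed.

(** A core at least as long as [gam] protects the trail. Otherwise the core is short, and so is the
    trail, since one of the two trails is zero. Hence the sign of D changes at finitely many points
    only. *)
Lemma sign_change gam mu : (Ll (gam * mu)%g == 0%N) != (Ll mu == 0%N) ->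
  (size mu <= 2 * size gam)%N.
Proof.
have [h1 h2 h3 h4 h5] := geometry_lipschitz gam mu; rewrite (size_dec mu).
by case: (leqP (size gam) (Nn mu)) => [/h5 ->|h6]; [rewrite eqxx|lia].
Qed.

(** Each of the [k] places carries a letter or a blank; the resulting overcount is harmless for an
    upper bound. *)
Definition words_le (k : nat) : seq I :=
  undup (pmap insub [seq pmap id (val s) | s : k.-tuple (option letter)]).

Lemma words_le_uniq k : uniq (words_le k). Proof. exact: undup_uniq. Qed.

Lemma size_words_le k : (size (words_le k) <= (d * 2).+1 ^ k)%N.
Proof.
apply: leq_trans (size_undup _) _; rewrite size_pmap.
apply: leq_trans (count_size _ _) _; rewrite size_map -cardE card_tuple card_option.
by rewrite card_prod card_ord card_bool.
Qed.

Lemma mem_words_le k mu : (size mu <= k)%N -> mu \in words_le k.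
Proof.
move=> sk; rewrite mem_undup mem_pmap; apply/mapP.
pose s := map some mu ++ nseq (k - size mu) None.
have ss : size s == k by rewrite size_cat size_map size_nseq subnKC.
exists (val mu); last by rewrite valK.
apply/mapP; exists (Tuple ss); first by rewrite mem_enum.
rewrite /= /s pmap_cat (_ : pmap id (nseq _ None) = [::]) ?cats0; last by elim: (k - _)%N.
by elim: (val mu) => //= x w <-.
Qed.

(** The length is the sum of two coordinates, neither above the height, whence the exponent 2. *)
Lemma height_growth_fgroup : height_growth height ((d * 2).+1 ^ 2).
Proof.
move=> k; exists (words_le (2 * k)); split.
- exact: words_le_uniq.
- by rewrite -expnM; exact: size_words_le.
- move=> mu h; apply: mem_words_le; rewrite size_dec.
  have := Nn_le_height mu; have := Ll_le_height mu; lia.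
Qed.

Lemma core_reduced (mu : I) : reduced (core g mu).
Proof.
have := valP mu; rewrite /= {1}(core_cat g mu) /reduced.
by case: (core g mu) => //= x v; rewrite cat_path => /andP[].
Qed.

End GroupGeometry.

(** * The boundary action *)

Section BoundaryAction.
Variable d : nat.
Local Notation letter := (letter d).
Local Notation I := (fgroup d).
Local Notation boundary := (boundary d).
Implicit Types (s : boundary) (x : letter) (w : seq letter).

Lemma boundaryP s s' : (forall n, s n = s' n) -> s = s'.
Proof.
case: s => f hf; case: s' => f' hf' /= /funext ff'.
by case: _ / ff' in hf' *; congr Boundary; exact: Prop_irrelevance.
Qed.

Lemma bconsE x s n : bcons x s n = bcons_fun x s n. Proof. by []. Qed.

Lemma bconsK x s : bcons (linv x) (bcons x s) = s.
Proof.
have b0 : bcons x s 0%N = if s 0%N == linv x then s 1%N else x.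
  by rewrite bconsE /bcons_fun; case: ifP.
have bS n : bcons x s n.+1 = if s 0%N == linv x then s n.+2 else s n.
  by rewrite bconsE /bcons_fun; case: ifP.
apply: boundaryP => n; rewrite bconsE /bcons_fun linvK b0.
case: ifPn => [/eqP|]; last first.
  case: ifP => [/eqP s0 _|_]; last by rewrite eqxx.
  by case: n => [|n]; rewrite ?s0// bconsE /bcons_fun s0 eqxx.
case: ifP => [/eqP s0 s1|s0 _]; last by rewrite bS s0.
by have := bseq_reduced s 0%N; rewrite /no_cancel s0 linvK s1 eqxx.
Qed.

Lemma bconsVK x s : bcons x (bcons (linv x) s) = s.
Proof. by rewrite -{1}(linvK x) bconsK. Qed.

Lemma foldr_bcons_lcons x w s :
  foldr (@bcons d) s (lcons x w) = bcons x (foldr (@bcons d) s w).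
Proof. by case: w => //= y w; case: eqP => [->|] //=; rewrite bconsVK. Qed.

Lemma bactM (u v : I) s : bact (u * v)%g s = bact u (bact v s).
Proof.
have key w (w' : seq letter) : foldr (@bcons d) s (foldr (@lcons d) w' w) =
    foldr (@bcons d) (foldr (@bcons d) s w') w.
  by elim: w => //= x w <-; rewrite foldr_bcons_lcons.
exact: key.
Qed.

Lemma bact_continuous (u : I) s n : exists m, forall s',
  (forall i, (i < m)%N -> s' i = s i) -> forall i, (i < n)%N -> bact u s' i = bact u s i.
Proof.
elim/fgroup_ind: u n => [|x u IH] n; first by exists n.
have [m hm] := IH n.+1; exists m => s' /hm h i iN; rewrite !bactM.
rewrite -[bact (lgen x) _]/(bcons x _) -[bact (lgen x) (bact u s)]/(bcons x _).
rewrite !bconsE /bcons_fun h//; case: ifP => _; first exact: h.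
by case: i iN => // i iN; apply: h; lia.
Qed.

Section LocallyConstant.
Variable X : Type.
Implicit Type a : boundary -> X.

Lemma locally_constant_bact a (u : I) : locally_constant a ->
  locally_constant (fun s => a (bact u s)).
Proof.
move=> ha s; have [n hn] := ha (bact u s); have [m hm] := bact_continuous u s n.
by exists m => s' h; apply: hn => i; apply: hm.
Qed.

Lemma locally_constant_cst (c : X) : locally_constant (fun _ : boundary => c).
Proof. by move=> s; exists 0%N. Qed.

Lemma locally_constant_op (Y Z : Type) (op : X -> Y -> Z) a (b : boundary -> Y) :
  locally_constant a -> locally_constant b -> locally_constant (fun s => op (a s) (b s)).
Proof.
move=> ha hb s; have [n hn] := ha s; have [m hm] := hb s.
exists (maxn n m) => s' h.
congr (op _ _); [apply: hn|apply: hm] => i iN; apply: h; apply: leq_trans iN _.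
  exact: leq_maxl.
exact: leq_maxr.
Qed.

(* Compactness of the boundary, by König's lemma. *)
Lemma locally_constant_uniform a : locally_constant a ->
  exists n, forall s s', (forall i, (i < n)%N -> s i = s' i) -> a s = a s'.
Proof.
move=> ha; apply: contrapT => hN.
pose pre w s := forall i, (i < size w)%N -> forall x0, s i = nth x0 w i.
(* A word is bad if no precision works on the cylinder of its extensions; the branch to be built
   consists of bad words. *)
pose bad w := forall n, exists s s', [/\ pre w s, pre w s',
  forall i, (i < n)%N -> s i = s' i & a s <> a s'].
have bad0 : bad [::].
  move=> n; apply: contrapT => h; apply: hN; exists n => s s' ss'.
  by apply: contrapT => ass'; apply: h; exists s, s'; split.
(* The implication sits under the quantifier so that choice yields a total function; for a word that
   is not bad any letter will do. *)
have ext w : exists x, bad w -> bad (rcons w x).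
  have [bw|nbw] := pselect (bad w); last first.
    by have [s [_ _]] := bad0 0%N; exists (s 0%N).
  apply: contrapT => h.
  have /choice [f hf] x : exists n, ~ exists s s', [/\ pre (rcons w x) s,
      pre (rcons w x) s', forall i, (i < n)%N -> s i = s' i & a s <> a s'].
    by apply: contrapT => h'; apply: h; exists x => _ n; apply: contrapT => h2; apply: h'; exists n.
  (* The first argument of the maximum makes the two points share the letter after [w], the second
     exceeds the precision that works for that letter. *)
  have [s [s' [ps ps' ss' ass']]] := bw (maxn (size w).+1 (\max_(x : letter) f x)).
  have sw : s (size w) = s' (size w) by apply: ss'; rewrite leq_max leqnn.
  apply: (hf (s (size w))); exists s, s'; split => //.
  - move=> i; rewrite size_rcons ltnS leq_eqVlt => /predU1P[->|iw] x0.
      by rewrite nth_rcons ltnn eqxx.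
    by rewrite nth_rcons iw; exact: ps.
  - move=> i; rewrite size_rcons ltnS leq_eqVlt => /predU1P[->|iw] x0.
      by rewrite nth_rcons ltnn eqxx -sw.
    by rewrite nth_rcons iw; exact: ps'.
  - move=> i iN; apply: ss'; apply: leq_trans iN _; rewrite leq_max.
    by rewrite (leq_bigmax (F := f)) orbT.
have [f hf] := choice ext.
pose v := fix v n := if n is n'.+1 then rcons (v n') (f (v n')) else [::].
have badv n : bad (v n) by elim: n => //= n IH; exact: hf.
have sv n : size (v n) = n by elim: n => //= n IH; rewrite size_rcons IH.
have nv n i x0 : (i < n)%N -> nth x0 (v n) i = f (v i).
  elim: n => //= n IH; rewrite nth_rcons sv ltnS leq_eqVlt => /predU1P[->|iN].
    by rewrite ltnn eqxx.
  by rewrite iN; exact: IH.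
(* Consecutive letters of the branch occur consecutively in an actual boundary point. *)
have red n : no_cancel (f (v n)) (f (v n.+1)).
  have [s [_ [ps _ _ _]]] := badv n.+2 0%N.
  have e1 : s n = f (v n) by rewrite (ps n _ (f [::])) ?sv ?nv.
  have e2 : s n.+1 = f (v n.+1) by rewrite (ps n.+1 _ (f [::])) ?sv ?nv.
  by rewrite -e1 -e2; exact: bseq_reduced.
have [n hn] := ha (Boundary red).
have [s [s' [ps ps' _]]] := badv n 0%N; apply.
rewrite (hn s) ?(hn s')// => i iN.
  by rewrite (ps' i _ (f [::])) ?sv// nv.
by rewrite (ps i _ (f [::])) ?sv// nv.
Qed.

End LocallyConstant.

End BoundaryAction.

(** * Piecewise exponential functions *)

Section ExponentialSums.
Variable R : realType.
Local Notation C := (R[i])^o.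
Implicit Types P Q : nat -> nat -> C.

Definition expmon (k j : int) (N l : nat) : R := expR (k%:~R * N%:R + j%:~R * l%:R).

Definition expsum P := exists s : seq (C * (int * int)), forall N l,
  P N l = \sum_(c <- s) c.1 * (expmon c.2.1 c.2.2 N l)%:C.

Lemma expsum_mon (c : C) k j : expsum (fun N l => c * (expmon k j N l)%:C).
Proof. by exists [:: (c, (k, j))] => N l; rewrite big_seq1. Qed.

Lemma expmon00 N l : expmon 0 0 N l = 1.
Proof. by rewrite /expmon !mul0r addr0 expR0. Qed.

Lemma expsum_cst (c : C) : expsum (fun _ _ => c).
Proof.
exists [:: (c, (0, 0))] => N l; rewrite big_seq1 expmon00.
by rewrite -[1%:C]/(1 : C) mulr1.
Qed.

Lemma expsumD P Q : expsum P -> expsum Q -> expsum (fun N l => P N l + Q N l).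
Proof. by move=> [s hs] [r hr]; exists (s ++ r) => N l; rewrite big_cat hs hr. Qed.

Lemma expmonM k j k' j' N l :
  expmon k j N l * expmon k' j' N l = expmon (k + k') (j + j') N l.
Proof. by rewrite /expmon -expRD; congr expR; rewrite !rmorphD/=; ring. Qed.

Lemma expsumM P Q : expsum P -> expsum Q -> expsum (fun N l => P N l * Q N l).
Proof.
move=> [s hs] [r hr].
exists [seq (c.1 * e.1, (c.2.1 + e.2.1, c.2.2 + e.2.2)) | c <- s, e <- r] => N l.
rewrite hs hr big_distrlr/= big_allpairs_dep; apply: eq_bigr => c _; apply: eq_bigr => e _.
by rewrite -expmonM rmorphM/= mulrACA.
Qed.

Lemma expsum_conj P : expsum P -> expsum (fun N l => (P N l : R[i])^*).
Proof.
move=> [s hs]; exists [seq ((c.1 : R[i])^*, c.2) | c <- s] => N l.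
rewrite hs big_map rmorph_sum; apply: eq_bigr => c _.
by rewrite rmorphM/= conj_realC.
Qed.

(** A displacement of the variables only rescales the coefficients. It is written with natural
    numbers on both sides because it may be negative. *)
Lemma expsum_shift P (a b a' b' : nat) : expsum P -> exists2 Q, expsum Q &
  forall N l N' l' : nat, (N' + a = N + b)%N -> (l' + a' = l + b')%N -> P N' l' = Q N l.
Proof.
move=> [s hs].
pose e (c : C * (int * int)) : R :=
  expR (c.2.1%:~R * (b%:R - a%:R) + c.2.2%:~R * (b'%:R - a'%:R)).
exists (fun N l => \sum_(c <- [seq (c.1 * (e c)%:C, c.2) | c <- s])
    c.1 * (expmon c.2.1 c.2.2 N l)%:C); first by exists [seq (c.1 * (e c)%:C, c.2) | c <- s].
move=> N l N' l' h h'; rewrite hs big_map; apply: eq_bigr => c _ /=.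
rewrite -mulrA -rmorphM/=; congr (_ * _%:C); rewrite /e /expmon -expRD; congr expR.
have -> : N'%:R = N%:R + b%:R - a%:R :> R by rewrite -natrD -h natrD addrK.
have -> : l'%:R = l%:R + b'%:R - a'%:R :> R by rewrite -natrD -h' natrD addrK.
by ring.
Qed.

Lemma expsum_growth P : expsum P -> exists (M : R) (m : nat), 0 <= M /\
  forall (N l h : nat), (N <= h)%N -> (l <= h)%N -> modulus (P N l) <= M * expR (m%:R * h%:R).
Proof.
move=> [s hs].
suff [M [m [M0 hM]]] : exists (M : R) (m : nat), 0 <= M /\
  forall (N l h : nat), (N <= h)%N -> (l <= h)%N ->
  \sum_(c <- s) modulus (c.1 * (expmon c.2.1 c.2.2 N l)%:C) <= M * expR (m%:R * h%:R).
  exists M, m; split => // N l h Nh lh; rewrite hs.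
  exact: le_trans (modulus_sum _ _ _) (hM _ _ _ Nh lh).
elim: s {hs} => [|[c [k j]] s [M [m [M0 IH]]]].
  by exists 0, 0%N; split => // N l h _ _; rewrite big_nil mul0r.
exists (M + modulus c), (m + `|k| + `|j|)%N; split; first by rewrite addr_ge0 ?modulus_ge0.
move=> N l h Nh lh; rewrite big_cons addrC mulrDl; apply: lerD.
  apply: le_trans (IH _ _ _ Nh lh) _; rewrite ler_wpM2l// ler_expR ler_wpM2r//.
  by rewrite ler_nat -addnA leq_addr.
rewrite /= modulusM modulus_real ger0_norm ?expR_ge0// ler_wpM2l ?modulus_ge0//.
have bnd (i : int) (n : nat) : (n <= h)%N -> i%:~R * n%:R <= `|i|%N%:R * h%:R :> R.
  move=> nh; apply: le_trans (ler_norm _) _; rewrite normrM natr_absz intr_norm normr_nat.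
  by rewrite ler_wpM2l// ler_nat.
have := bnd k N Nh; have := bnd j l lh.
have : 0 <= m%:R * h%:R :> R by rewrite mulr_ge0.
by rewrite ler_expR !natrD !mulrDl => h1 h2 h3; lra.
Qed.

End ExponentialSums.

Section PiecewiseExponential.
Variables (R : realType) (d : nat) (g : letter d).
Local Notation C := (R[i])^o.
Local Notation I := (fgroup d).
Implicit Types f h : I -> C.

(* The functions that are exponential sums in (|core|, trail) on every cell of
   some precision: they are the coefficients of the operators in Psi. *)
Definition pwexp n f := forall nu, exists2 P, expsum P &
  forall mu, cell n (dec g mu) = cell n (dec g nu) -> f mu = P (Nn g mu) (Ll g mu).

Definition FF f := exists n, pwexp n f.

Lemma pwexp_mono n m f : (n <= m)%N -> pwexp n f -> pwexp m f.
Proof.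
move=> nm hf nu; have [P lP hP] := hf nu; exists P => // mu h.
by apply: hP; exact: cell_mono nm h.
Qed.

Lemma FF_op (op : C -> C -> C) f h :
  (forall P Q, expsum P -> expsum Q -> expsum (fun N l => op (P N l) (Q N l))) ->
  FF f -> FF h -> FF (fun mu => op (f mu) (h mu)).
Proof.
move=> hop [n hf] [m hh]; exists (maxn n m) => nu.
have [P lP hP] := pwexp_mono (leq_maxl n m) hf nu.
have [Q lQ hQ] := pwexp_mono (leq_maxr n m) hh nu.
by exists (fun N l => op (P N l) (Q N l)) => [|mu e]; [exact: hop|rewrite hP ?hQ].
Qed.

Lemma FFD f h : FF f -> FF h -> FF (fun mu => f mu + h mu).
Proof. by apply: FF_op; exact: expsumD. Qed.

Lemma FFM f h : FF f -> FF h -> FF (fun mu => f mu * h mu).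
Proof. by apply: FF_op; exact: expsumM. Qed.

Lemma FF_conj f : FF f -> FF (fun mu => (f mu : R[i])^*).
Proof.
move=> hf; apply: (@FF_op (fun a _ => (a : R[i])^*) f f) => // P Q lP _; exact: expsum_conj.
Qed.

Lemma FF_cell f n : (forall mu nu, cell n (dec g mu) = cell n (dec g nu) -> f mu = f nu) ->
  FF f.
Proof.
move=> h; exists n => nu; exists (fun _ _ => f nu); first exact: expsum_cst.
by move=> mu; exact: h.
Qed.

Lemma FF_cst (c : C) : FF (fun=> c).
Proof. exact: (@FF_cell _ 0). Qed.

Lemma FFZ (c : C) f : FF f -> FF (fun mu => c * f mu).
Proof. by apply: FFM; exact: FF_cst. Qed.

(** On a cell, a letter displaces both coordinates by constants ([cell_lstep]), and exponential sums
    absorb such displacements ([expsum_shift]); induction on the letters of [gam] does the rest. *)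
Lemma FF_translate f gam : FF f -> FF (fun mu => f (gam * mu)%g).
Proof.
elim/fgroup_ind: gam f => [|x u IH] f hf.
  by rewrite (_ : (fun=> _) = f)//; apply/funext => mu; rewrite mul1g.
rewrite (_ : (fun mu => _) = (fun mu => (fun nu => f (lgen x * nu)%g) (u * mu)%g)); last first.
  by apply/funext => mu; rewrite mulgA.
apply: (IH (fun nu => f (lgen x * nu)%g)); have [n hn] := hf; exists n.+2 => nu.
have [P lP hP] := hn (lgen x * nu)%g.
have [Q lQ hQ] := expsum_shift (Nn g nu) (Nn g (lgen x * nu)%g) (Ll g nu) (Ll g (lgen x * nu)%g) lP.
exists Q => // mu e.
have [e1 e2 e3] := cell_lstep g x e; rewrite -!dec_lgen in e1 e2 e3.
rewrite hP//; apply: hQ.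
  by rewrite addnC [RHS]addnC addnC e2 addnC.
by rewrite e3 addnC.
Qed.

(** With a precision above all coordinates on the support, each of its points is a cell by
    itself. *)
Lemma FF_finsupp f (X : seq I) : (forall mu, mu \notin X -> f mu = 0) -> FF f.
Proof.
move=> f0; pose n := (\max_(mu <- X) size mu).+1.
have hX mu : mu \in X -> (Nn g mu < n)%N /\ (Ll g mu < n)%N.
  move=> muX; have : (size mu < n)%N by rewrite /n ltnS; apply: leq_bigmax_seq.
  by rewrite (size_dec g); lia.
apply: (@FF_cell _ n) => mu nu e.
case: (boolP (nu \in X)) => [nuX|nX].
  have [h1 h2] := hX _ nuX; have -> // : mu = nu.
  exact: (core_trail_inj (esym (@cell_inj _ n (dec g nu) (dec g mu) h1 h2 (esym e)))).
case: (boolP (mu \in X)) => [muX|mX]; last by rewrite !f0.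
have [h1 h2] := hX _ muX; have -> // : mu = nu.
exact: (core_trail_inj (@cell_inj _ n (dec g mu) (dec g nu) h1 h2 e)).
Qed.

(** The height is linear on either side of the line where core length and trail agree, and a cell
    knows its side. *)
Lemma FF_expheight (k : int) : FF (fun mu => (expR (k%:~R * (height g mu)%:R))%:C).
Proof.
exists 1%N => nu; case: (leqP (Ll g nu) (Nn g nu)) => h.
  exists (fun N l => 1 * (expmon R k 0 N l)%:C); first exact: expsum_mon.
  move=> mu [_ e _ _]; have {}e : (Ll g mu <= Nn g mu)%N by rewrite [(_ <= _)%N]e.
  by rewrite mul1r /expmon mul0r addr0 /height (_ : maxn _ _ = Nn g mu)//; lia.
exists (fun N l => 1 * (expmon R (- k) (k + k) N l)%:C); first exact: expsum_mon.
move=> mu [_ e _ _]; have {}e : (Nn g mu < Ll g mu)%N by rewrite ltnNge [(_ <= _)%N]e -ltnNge.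
rewrite mul1r /height (_ : maxn _ _ = 2 * Ll g mu - Nn g mu)%N; last by lia.
have le2 : (Nn g mu <= 2 * Ll g mu)%N by lia.
rewrite (natrB _ le2) natrM /expmon; congr (expR _)%:C.
have -> : (- k)%:~R = - k%:~R :> R by rewrite rmorphN.
have -> : (k + k)%:~R = k%:~R + k%:~R :> R by rewrite rmorphD.
by ring.
Qed.

Definition cells n : seq (seq (letter d) * bool * nat * nat) :=
  let vs := [seq val s | k <- iota 0 n.+1, s <- enum {: k.-tuple (letter d)}] in
  [seq (q, m) | q <- [seq (p, i) | p <- [seq (v, b) | v <- vs, b <- [:: true; false]],
     i <- iota 0 n.+1], m <- iota 0 n.+1].

Lemma mem_cells n (p : seq (letter d) * nat) : cell n p \in cells n.
Proof.
have hm (q : nat) : minn q n \in iota 0 n.+1 by rewrite mem_iota /= add0n ltnS geq_minr.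
apply: (allpairs_f (fun q m => (q, m))) => //; apply: (allpairs_f (fun q m => (q, m))) => //.
apply: (allpairs_f (fun q m => (q, m))); last by case: (_ <= _)%N; rewrite !inE.
apply/allpairsPdep; exists (size (take n p.1)), (in_tuple (take n p.1)).
split=> //; last exact: mem_enum.
by rewrite mem_iota /= add0n ltnS size_take_min geq_minl.
Qed.

(** There are finitely many cells, so the largest of the bounds found on them serves everywhere. *)
Lemma cells_uniform n (Q : nat -> I -> Prop) :
  (forall m m' mu, (m <= m')%N -> Q m mu -> Q m' mu) ->
  (forall nu, exists m, forall mu, cell n (dec g mu) = cell n (dec g nu) -> Q m mu) ->
  exists m, forall mu, Q m mu.
Proof.
move=> Qmono Qcell.
suff [m hm] : exists m, forall mu, cell n (dec g mu) \in cells n -> Q m mu.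
  by exists m => mu; apply: hm; exact: mem_cells.
elim: (cells n) => [|c cs [m IH]]; first by exists 0%N.
have [[nu e]|nc] := pselect (exists nu, cell n (dec g nu) = c); last first.
  exists m => mu; rewrite in_cons => /predU1P[emu|]; last exact: IH.
  by case: nc; exists mu.
have [m' hm'] := Qcell nu; exists (maxn m m') => mu; rewrite in_cons => /predU1P[emu|/IH].
  by apply: Qmono (leq_maxr _ _) (hm' _ _); rewrite e.
exact: Qmono (leq_maxl _ _).
Qed.

Lemma cell_fun_bounded f n :
  (forall mu nu, cell n (dec g mu) = cell n (dec g nu) -> f mu = f nu) ->
  exists M : R, forall mu, modulus (f mu) <= M.
Proof.
move=> hf; suff [m hm] : exists m : nat, forall mu, modulus (f mu) <= m%:R by exists m%:R.
apply: (@cells_uniform n) => [m m' mu mm' h|nu]; first by rewrite (le_trans h)// ler_nat.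
by exists (Num.truncn (modulus (f nu))).+1 => mu /hf ->; rewrite ltW// truncnS_gt.
Qed.

Lemma FF_growth f : FF f -> exists (M : R) (m : nat), 0 <= M /\
  forall mu, modulus (f mu) <= M * expR (m%:R * (height g mu)%:R).
Proof.
move=> [n hf]; suff [m hm] : exists m : nat, forall mu,
    modulus (f mu) <= m%:R * expR (m%:R * (height g mu)%:R) by exists m%:R, m.
apply: (@cells_uniform n) => [m m' mu mm' h|nu].
  by apply: le_trans h _; apply: ler_pM; rewrite ?expR_ge0 ?ler_expR ?ler_wpM2r ?ler_nat.
have [P lP hP] := hf nu; have [M [m [M0 h]]] := expsum_growth lP.
exists (maxn (Num.truncn M).+1 m) => mu /hP ->.
apply: le_trans (h _ _ _ (Nn_le_height g mu) (Ll_le_height g mu)) _.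
apply: ler_pM; rewrite ?expR_ge0//.
  by apply: le_trans (ltW (truncnS_gt M)) _; rewrite ler_nat leq_maxl.
by rewrite ler_expR ler_wpM2r// ler_nat leq_maxr.
Qed.

End PiecewiseExponential.

(** * Band operators *)

Section BandOperators.
Variables (R : realType) (d : nat).
Local Notation C := (R[i])^o.
Local Notation I := (fgroup d).
Local Notation H := (ell2 R I).
Implicit Types (f h : I -> C) (x y : H) (gam mu : I) (K : set (I -> C)) (U : set H).

Lemma bounded_op_add (S T : H -> H) : bounded_op S -> bounded_op T ->
  bounded_op (fun x => S x + T x).
Proof.
move=> bS bT; split.
  move=> c x y; rewrite (bounded_opD _ _ bS) (bounded_opD _ _ bT).
  by rewrite (bounded_opZ _ _ bS) (bounded_opZ _ _ bT) scalerDr addrACA.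
have [M M0 hM] := bounded_op_bound bS; have [N N0 hN] := bounded_op_bound bT.
exists (2 * (M + N)) => x _; apply: le_trans (hnormD _ _) _.
by rewrite -mulrA ler_wpM2l// mulrDl lerD.
Qed.

Lemma bounded_op_sum (J : Type) (s : seq J) (T : J -> H -> H) :
  (forall j, bounded_op (T j)) -> bounded_op (fun x => \sum_(j <- s) T j x).
Proof.
move=> bT; elim: s => [|j s IH].
  rewrite (_ : (fun=> _) = (0 : H -> H)); first exact: bounded_op_cst0.
  by apply/funext => x; rewrite big_nil.
rewrite (_ : (fun=> _) = (fun x => T j x + \sum_(j <- s) T j x)).
  exact: bounded_op_add.
by apply/funext => x; rewrite big_cons.
Qed.

Definition bounded_fun f := exists M : R, forall mu, modulus (f mu) <= M.

Lemma bounded_funM f h gam : bounded_fun f -> bounded_fun h ->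
  bounded_fun (fun mu => f mu * h (gam * mu)%g).
Proof.
move=> [M hM] [N hN]; exists (M * N) => mu.
by rewrite modulusM ler_pM ?modulus_ge0.
Qed.

Definition mul_shift f gam x : H := insubd 0 (fun mu => f mu * x (gam * mu)%g).

Lemma mul_translate_ss f gam x : bounded_fun f ->
  (fun mu => f mu * x (gam * mu)%g) \in @square_summable R I.
Proof.
move=> [M hM].
have hx := square_summable_reindex x (mulKg gam).
apply: (@square_summable_dom _ _ _ (Ell2 hx) M) => mu.
by rewrite modulusM ler_wpM2r ?modulus_ge0.
Qed.

Lemma mul_shiftE f gam x mu : bounded_fun f -> mul_shift f gam x mu = f mu * x (gam * mu)%g.
Proof. by move=> bf; rewrite /mul_shift insubdK//; exact: mul_translate_ss. Qed.

Lemma mul_shift_bounded f gam : bounded_fun f -> bounded_op (mul_shift f gam).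
Proof.
move=> bf; split.
  move=> c x y; apply: ell2P => mu; rewrite -[RHS]/(c * mul_shift f gam x mu + mul_shift f gam y mu).
  by rewrite !(mul_shiftE _ _ _ bf) -[X in _ * X]/(c * x (gam * mu)%g + y (gam * mu)%g) mulrDr mulrCA.
have [M hM] := bf; exists `|M| => x _.
have hx := square_summable_reindex x (mulKg gam).
apply: (@le_trans _ _ (`|M| * hnorm (Ell2 hx))).
  apply: hnorm_dom => // mu; rewrite (mul_shiftE _ _ _ bf) modulusM ler_wpM2r ?modulus_ge0//.
  exact: le_trans (hM mu) (ler_norm _).
by rewrite ler_wpM2l//; apply: (hnorm_reindex (mulKg gam)).
Qed.

Definition translate gam f : I -> C := fun mu => f (gam * mu)%g.
Definition conjf f : I -> C := fun mu => (f mu : R[i])^*.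

Lemma bounded_translate gam f : bounded_fun f -> bounded_fun (translate gam f).
Proof. by move=> [M hM]; exists M => mu; exact: hM. Qed.

Lemma bounded_conjf f : bounded_fun f -> bounded_fun (conjf f).
Proof. by move=> [M hM]; exists M => mu; rewrite modulus_conj. Qed.

Lemma mul_shift_adjoint f gam x y : bounded_fun f ->
  inner (mul_shift f gam x) y = inner x (mul_shift (translate gam^-1%g (conjf f)) gam^-1%g y).
Proof.
move=> bf; rewrite /inner -[RHS](csum_reindex _ (mulKg gam) (mulVKg gam)).
congr csum; apply/funext => mu.
rewrite (mul_shiftE _ _ _ bf) (mul_shiftE _ _ _ (bounded_translate _ (bounded_conjf bf))).
by rewrite /translate /conjf mulKg rmorphM/= mulrA [_ * (x _)^*]mulrC.
Qed.

Lemma innerDl x x' y : inner (x + x') y = inner x y + inner x' y.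
Proof.
apply: csum_eq; first exact: csummable_inner.
have := hassumD (csummableP (csummable_inner x y)) (csummableP (csummable_inner x' y)).
congr hassum; apply/funext => i.
by rewrite -mulrDl -rmorphD.
Qed.

Lemma inner0l y : inner 0 y = 0.
Proof. by have := innerZl 0 0 y; rewrite scaler0 conjC0 mul0r. Qed.

Lemma innerDr x y y' : inner x (y + y') = inner x y + inner x y'.
Proof.
apply: csum_eq; first exact: csummable_inner.
have := hassumD (csummableP (csummable_inner x y)) (csummableP (csummable_inner x y')).
congr hassum; apply/funext => i.
by rewrite -mulrDr.
Qed.

Lemma inner0r x : inner x 0 = 0.
Proof. by apply: (@addrI _ (inner x 0)); rewrite -innerDr !addr0. Qed.

Definition bandop (J : finType) (f : J -> I -> C) (gam : J -> I) x : H :=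
  \sum_j mul_shift (f j) (gam j) x.

Lemma bandopE (J : finType) (f : J -> I -> C) (gam : J -> I) x mu :
  (forall j, bounded_fun (f j)) ->
  bandop f gam x mu = \sum_j f j mu * x (gam j * mu)%g.
Proof. by move=> bf; rewrite ell2_sum; apply: eq_bigr => j _; rewrite mul_shiftE. Qed.

Lemma bandop_bounded (J : finType) (f : J -> I -> C) (gam : J -> I) :
  (forall j, bounded_fun (f j)) -> bounded_op (bandop f gam).
Proof. by move=> bf; apply: bounded_op_sum => j; exact: mul_shift_bounded. Qed.

Lemma adj_bandop (J : finType) (f : J -> I -> C) (gam : J -> I) :
  (forall j, bounded_fun (f j)) ->
  adj (bandop f gam) = bandop (fun j => translate (gam j)^-1%g (conjf (f j))) (fun j => (gam j)^-1%g).
Proof.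
move=> bf; apply: adj_eq.
  by apply: bandop_bounded => j; apply: bounded_translate; exact: bounded_conjf.
move=> x y; rewrite /bandop (big_morph (fun z => inner z y) (fun u v => innerDl u v y) (inner0l y)).
rewrite (big_morph (fun z => inner x z) (innerDr x) (inner0r x)).
by apply: eq_bigr => j _; exact: mul_shift_adjoint.
Qed.

(* [T] is the sum of the [f_j lambda_(gam_j^-1)] on [U]. *)
Definition is_band K U (T : H -> H) := exists (J : finType) (f : J -> I -> C) (gam : J -> I),
  (forall j, K (f j)) /\ forall x, U x -> forall mu, T x mu = \sum_j f j mu * x (gam j * mu)%g.

Lemma is_band_bandop K T : K `<=` bounded_fun -> is_band K setT T ->
  exists (J : finType) (f : J -> I -> C) (gam : J -> I), (forall j, K (f j)) /\ T = bandop f gam.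
Proof.
move=> Kb [J [f [gam [hf hT]]]]; exists J, f, gam; split => //.
apply/funext => x; apply: ell2P => mu; rewrite hT// bandopE// => j; exact: Kb.
Qed.

Lemma is_band_bounded K T : K `<=` bounded_fun -> is_band K setT T -> bounded_op T.
Proof.
move=> Kb /(is_band_bandop Kb)[J [f [gam [hf ->]]]].
by apply: bandop_bounded => j; exact: Kb.
Qed.

Lemma bandop_is_band K (J : finType) (f : J -> I -> C) (gam : J -> I) :
  K `<=` bounded_fun -> (forall j, K (f j)) -> is_band K setT (bandop f gam).
Proof. by move=> Kb hf; exists J, f, gam; split => // x _ mu; apply: bandopE => j; exact: Kb. Qed.

Lemma is_band_sub K K' U T : K `<=` K' -> is_band K U T -> is_band K' U T.
Proof. by move=> KK' [J [f [gam [hf hT]]]]; exists J, f, gam; split => // j; exact: KK'. Qed.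

Lemma is_band_dom K U U' T : U' `<=` U -> is_band K U T -> is_band K U' T.
Proof. by move=> UU' [J [f [gam [hf hT]]]]; exists J, f, gam; split => // x /UU' /hT. Qed.

Lemma is_band0 K U : is_band K U 0.
Proof.
exists void, (of_void _), (of_void _); split; first by case.
by move=> x _ mu; rewrite big_pred0 => [|[]].
Qed.

Lemma is_bandD K U (S T : H -> H) : is_band K U S -> is_band K U T -> is_band K U (S + T).
Proof.
move=> [J [f [gam [hf hS]]]] [J' [f' [gam' [hf' hT]]]].
exists (J + J')%type, (fun j => match j with inl j => f j | inr j => f' j end),
  (fun j => match j with inl j => gam j | inr j => gam' j end); split; first by case.
by move=> x Ux mu; rewrite big_sumType/= -hS// -hT.
Qed.

Lemma is_bandZ K U (c : C) (T : H -> H) : (forall f, K f -> K (fun mu => c * f mu)) ->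
  is_band K U T -> is_band K U (c *: T).
Proof.
move=> Kc [J [f [gam [hf hT]]]]; exists J, (fun j mu => c * f j mu), gam; split.
  by move=> j; exact: Kc.
move=> x Ux mu; rewrite -[LHS]/(c * T x mu) hT// mulr_sumr.
by apply: eq_bigr => j _; rewrite mulrA.
Qed.

Lemma is_band_comp K1 K2 K3 U (S T : H -> H) :
  (forall f h gam, K1 f -> K2 h -> K3 (fun mu => f mu * h (gam * mu)%g)) ->
  (forall x, U x -> U (T x)) ->
  is_band K1 U S -> is_band K2 U T -> is_band K3 U (S \o T).
Proof.
move=> KM UT [J [f [gam [hf hS]]]] [J' [f' [gam' [hf' hT]]]].
exists (J * J')%type, (fun j mu => f j.1 mu * f' j.2 (gam j.1 * mu)%g),
  (fun j => gam' j.2 * gam j.1)%g; split; first by move=> j; exact: KM.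
move=> x Ux mu /=; rewrite hS; last exact: UT.
rewrite -(pair_big xpredT xpredT (fun j j' => f j mu * f' j' (gam j * mu)%g *
   x (gam' j' * gam j * mu)%g))/=.
apply: eq_bigr => j _; rewrite hT// mulr_sumr; apply: eq_bigr => j' _.
by rewrite mulrA mulgA.
Qed.

Lemma is_band_adj K (T : H -> H) : K `<=` bounded_fun ->
  (forall f gam, K f -> K (translate gam (conjf f))) ->
  is_band K setT T -> is_band K setT (adj T).
Proof.
move=> Kb Kadj /(is_band_bandop Kb)[J [f [gam [hf ->]]]].
rewrite adj_bandop; last by move=> j; exact: Kb.
by apply: bandop_is_band => // j; exact: Kadj.
Qed.

(** Sums of bands just enlarge the index set, so only scalars, products and adjoints constrain the
    coefficients. The lemma serves for bounded coefficients, for those from the boundary, and for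
    bounded piecewise exponential ones. *)
Lemma star_algebra_band K : K `<=` bounded_fun ->
  (forall (c : C) f, K f -> K (fun mu => c * f mu)) ->
  (forall f h gam, K f -> K h -> K (fun mu => f mu * h (gam * mu)%g)) ->
  (forall f gam, K f -> K (translate gam (conjf f))) ->
  star_algebra (is_band K setT).
Proof.
move=> Kb KZ KM Kadj; split.
- by move=> T; exact: is_band_bounded.
- split; [exact: is_band0|exact: is_bandD| |].
    by move=> c T; apply: is_bandZ => f; exact: KZ.
  by move=> S T; apply: is_band_comp.
- by move=> T; exact: is_band_adj.
Qed.

End BandOperators.

(** * Holomorphic and meromorphic functions *)

Section ComplexExponential.
Variable R : realType.
Local Notation C := (R[i])^o.

(** One integration step for Taylor remainders, by the mean value theorem; the gain of a factor
    [1 / (n + 1)] is given up. *)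
Lemma mvt_bound (f df : R -> R) (K : R) (n : nat) : (forall x, is_derive x (1 : R) f (df x)) ->
  f 0 = 0 -> (forall x, `|x| <= 1 / 2 -> `|df x| <= K * `|x| ^+ n) ->
  forall x, `|x| <= 1 / 2 -> `|f x| <= K * `|x| ^+ n.+1.
Proof.
move=> hd f0 hb x hx.
have cf a b : {within `[a, b], continuous f}.
  by apply: derivable_within_continuous => y _; have [] := hd y.
have K0 c : `|c| <= `|x| -> `|df c| <= K * `|x| ^+ n.
  move=> cx; apply: le_trans (hb c (le_trans cx hx)) _.
  (* A negative [K] contradicts the bound on [df] at the point 1/2. *)
  have [K0|K0] := lerP 0 K; first by rewrite ler_wpM2l// lerXn2r ?nnegrE.
  have := hb (1 / 2); rewrite ger0_norm// lexx => /(_ isT) h.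
  have : 0 <= K * (1 / 2) ^+ n by apply: le_trans h.
  by rewrite nmulr_rge0// leNgt exprn_gt0.
have [x0|x0|->] := ltgtP x 0; last by rewrite f0 normr0 exprS mul0r mulr0.
- have [c] := MVT x0 (fun y _ => hd y) (cf _ _); rewrite in_itv/= => /andP[xc c0].
  rewrite f0 sub0r => /(congr1 (fun z => `|z|)); rewrite normrN => ->.
  rewrite sub0r normrM normrN exprSr mulrA ler_wpM2r// K0//.
  by rewrite !ltr0_norm// lerN2 ltW.
- have [c] := MVT x0 (fun y _ => hd y) (cf _ _); rewrite in_itv/= => /andP[c0 cx].
  rewrite f0 subr0 => ->.
  rewrite subr0 normrM exprSr mulrA ler_wpM2r// K0//.
  by rewrite !gtr0_norm// ltW.
Qed.

Lemma expR_bound1 (x : R) : `|x| <= 1 / 2 -> `|expR x - 1| <= 2 * `|x| ^+ 1.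
Proof.
apply: (@mvt_bound (fun x => expR x - 1) expR 2 0).
- by move=> y; apply: is_derive_eq; rewrite subr0.
- by rewrite expR0 subrr.
- move=> y; rewrite ler_norml => /andP[_ hy]; rewrite expr0 mulr1 ger0_norm ?expR_ge0//.
  (* For [y <= 1/2] one has [exp (- y) >= 1 - y >= 1/2]. *)
  rewrite -[y]opprK expRN -[leRHS]invrK lef_pV2 ?posrE ?expR_gt0 ?invr_gt0//.
  by apply: le_trans (expR_ge1Dx _); lra.
Qed.

Lemma expR_bound2 (x : R) : `|x| <= 1 / 2 -> `|expR x - 1 - x| <= 2 * `|x| ^+ 2.
Proof.
apply: (@mvt_bound (fun x => expR x - 1 - x) (fun x => expR x - 1) 2 1).
- by move=> y; apply: is_derive_eq; rewrite subr0.
- by rewrite expR0 subrr subr0.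
- exact: expR_bound1.
Qed.

Lemma sin_bound0 (x : R) : `|x| <= 1 / 2 -> `|sin x| <= 1 * `|x| ^+ 1.
Proof.
apply: (@mvt_bound (@sin R) (@cos R) 1 0); last 2 first.
- exact: sin0.
- by move=> y _; rewrite expr0 mulr1 ler_norml cos_le1 cos_geN1.
Qed.

Lemma cos_bound1 (x : R) : `|x| <= 1 / 2 -> `|cos x - 1| <= 1 * `|x| ^+ 2.
Proof.
apply: (@mvt_bound (fun x => cos x - 1) (fun x => - sin x) 1 1).
- by move=> y; apply: is_derive_eq; rewrite subr0.
- by rewrite cos0 subrr.
- by move=> y hy; rewrite normrN; exact: sin_bound0.
Qed.

Lemma sin_bound1 (x : R) : `|x| <= 1 / 2 -> `|sin x - x| <= 1 * `|x| ^+ 3.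
Proof.
apply: (@mvt_bound (fun x => sin x - x) (fun x => cos x - 1) 1 2).
- by rewrite sin0 subrr.
- exact: cos_bound1.
Qed.

Definition cexp (z : C) : C :=
  (expR (complex.Re z))%:C * (cos (complex.Im z) +i* sin (complex.Im z)).

Lemma cexpD a b : cexp (a + b) = cexp a * cexp b.
Proof.
case: a b => [a1 a2] [b1 b2]; rewrite /cexp /= expRD cosD sinD; simpc.
by congr (_ +i* _); ring.
Qed.

Lemma cexp0 : cexp 0 = 1.
Proof. by rewrite /cexp /= expR0 cos0 sin0; simpc. Qed.

Lemma modulus_cexp z : modulus (cexp z) = expR (complex.Re z).
Proof.
rewrite /cexp modulusM modulus_real ger0_norm ?expR_ge0//.
by rewrite /modulus /= cos2Dsin2 sqrtr1 mulr1.
Qed.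

(** Real and imaginary parts are estimated separately; the mixed term [2 |a| |b|] goes into the
    squares, and 5 leaves some room. *)
Lemma cexp_bound (u : C) : modulus u <= 1 / 2 -> modulus (cexp u - 1 - u) <= 5 * modulus u ^+ 2.
Proof.
move=> hu; have ha := le_trans (ler_Re_modulus u) hu; have hb := le_trans (ler_Im_modulus u) hu.
apply: le_trans (ler_modulus_ReIm _) _.
have -> : complex.Re (cexp u - 1 - u) =
    expR (complex.Re u) * cos (complex.Im u) - 1 - complex.Re u.
  by case: u {hu ha hb} => a b; rewrite /cexp /=; ring.
have -> : complex.Im (cexp u - 1 - u) = expR (complex.Re u) * sin (complex.Im u) - complex.Im u.
  by case: u {hu ha hb} => a b; rewrite /cexp /=; ring.
have -> : modulus u ^+ 2 = complex.Re u ^+ 2 + complex.Im u ^+ 2.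
  by case: u {hu ha hb} => a b; rewrite /modulus /= sqr_sqrtr ?addr_ge0 ?sqr_ge0.
move: (complex.Re u) (complex.Im u) ha hb => a b ha hb.
have h1 := expR_bound1 ha; have h2 := expR_bound2 ha.
have h3 := cos_bound1 hb; have h4 := sin_bound1 hb; have h5 := sin_bound0 hb.
rewrite !expr1 ?mul1r in h1 h2 h3 h4 h5.
have c1 : `|cos b| <= 1 by rewrite ler_norml cos_le1 cos_geN1.
have a0 := normr_ge0 a; have b0 := normr_ge0 b.
rewrite -(real_normK (num_real a)) -(real_normK (num_real b)).
have -> : expR a * cos b - 1 - a = (expR a - 1 - a) * cos b + (1 + a) * (cos b - 1) by ring.
have -> : expR a * sin b - b = (expR a - 1) * sin b + (sin b - b) by ring.
have n1 : `|(expR a - 1 - a) * cos b + (1 + a) * (cos b - 1)| <= 2 * `|a| ^+ 2 + 2 * `|b| ^+ 2.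
  apply: le_trans (ler_normD _ _) _; rewrite !normrM; apply: lerD.
    by rewrite -[leRHS]mulr1 ler_pM.
  apply: ler_pM => //; apply: le_trans (ler_normD _ _) _; rewrite normr1; lra.
have n2 : `|(expR a - 1) * sin b + (sin b - b)| <= 2 * `|a| * `|b| + `|b| ^+ 2.
  apply: le_trans (ler_normD _ _) _; rewrite normrM; apply: lerD; first by rewrite ler_pM.
  by apply: le_trans h4 _; rewrite exprS ler_piMl ?sqr_ge0//; lra.
apply: le_trans (lerD n1 n2) _.
by have := sqr_ge0 (`|a| - `|b|); move: (`|a|) (`|b|) => p q; nra.
Qed.

End ComplexExponential.

(** * Complex derivatives with quadratic remainder *)

Section QuadraticDerivative.
Variable R : realType.
Local Notation C := (R[i])^o.
Implicit Types (f h : C -> C) (s z l m e : C).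

Definition small (P : C -> Prop) := exists2 r : R, 0 < r & forall e, modulus e <= r -> P e.

Lemma smallI (P Q : C -> Prop) : small P -> small Q -> small (fun e => P e /\ Q e).
Proof.
move=> [r r0 hr] [q q0 hq]; exists (Num.min r q); first by rewrite lt_min r0.
by move=> e; rewrite le_min => /andP[/hr ? /hq].
Qed.

Lemma smallW (P Q : C -> Prop) : (forall e, P e -> Q e) -> small P -> small Q.
Proof. by move=> PQ [r r0 hr]; exists r => // e /hr /PQ. Qed.

Lemma small_le (r : R) : 0 < r -> small (fun e => modulus e <= r).
Proof. by exists r. Qed.

(* The remainder is required to be quadratic rather than o(e), which is stable
   under the algebraic operations with shorter estimates. *)
Definition qderiv f s l := exists2 K : R, 0 <= K &
  small (fun e => modulus (f (s + e) - f s - l * e) <= K * modulus e ^+ 2).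

Lemma qderiv_cst (c : C) s : qderiv (fun=> c) s 0.
Proof.
by exists 0 => //; exists 1 => // e _; rewrite subrr mul0r subr0 modulus0 mul0r.
Qed.

Lemma qderiv_id s : qderiv id s 1.
Proof.
exists 0 => //; exists 1 => // e _.
by rewrite (_ : _ - _ = 0) ?modulus0 ?mul0r//=; ring.
Qed.

Lemma qderivD f h s l m : qderiv f s l -> qderiv h s m ->
  qderiv (fun z => f z + h z) s (l + m).
Proof.
move=> [K K0 hK] [M M0 hM]; exists (K + M); first exact: addr_ge0.
apply: smallW (smallI hK hM) => e [h1 h2]; rewrite [leRHS]mulrDl.
have -> : f (s + e) + h (s + e) - (f s + h s) - (l + m) * e =
  (f (s + e) - f s - l * e) + (h (s + e) - h s - m * e) by ring.
exact: le_trans (modulusD _ _) (lerD h1 h2).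
Qed.

Lemma qderivM f h s l m : qderiv f s l -> qderiv h s m ->
  qderiv (fun z => f z * h z) s (l * h s + f s * m).
Proof.
move=> [K K0 hK] [M M0 hM].
set a := f s in hK *; set b := h s in hM *.
exists (K * (modulus b + modulus m + M) + (modulus a + modulus l) * M + modulus l * modulus m).
  by rewrite !addr_ge0 ?mulr_ge0 ?addr_ge0 ?modulus_ge0.
apply: smallW (smallI (small_le ltr01) (smallI hK hM)) => e [e1 [h1 h2]].
have e0 := modulus_ge0 e.
set r := f (s + e) - a - l * e in h1; set q := h (s + e) - b - m * e in h2.
have -> : f (s + e) * h (s + e) - a * b - (l * b + a * m) * e =
    r * (b + m * e + q) + (a + l * e) * q + l * m * e ^+ 2.
  by rewrite /r /q; ring.
have q1 : modulus q <= M by apply: le_trans h2 _; rewrite ler_piMr// exprn_ile1.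
have B1 : modulus (r * (b + m * e + q)) <= K * (modulus b + modulus m + M) * modulus e ^+ 2.
  rewrite modulusM [leRHS]mulrAC; apply: ler_pM; rewrite ?modulus_ge0//.
  apply: le_trans (modulusD _ _) _; apply: lerD => //.
  apply: le_trans (modulusD _ _) _; apply: lerD => //.
  by rewrite modulusM ler_piMr ?modulus_ge0.
have B2 : modulus ((a + l * e) * q) <= (modulus a + modulus l) * M * modulus e ^+ 2.
  rewrite modulusM -[leRHS]mulrA; apply: ler_pM; rewrite ?modulus_ge0//.
  apply: le_trans (modulusD _ _) _; apply: lerD => //.
  by rewrite modulusM ler_piMr ?modulus_ge0.
apply: le_trans (modulusD _ _) _; rewrite [leRHS]mulrDl; apply: lerD.
  by rewrite [leRHS]mulrDl; exact: le_trans (modulusD _ _) (lerD B1 B2).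
by rewrite modulusM (modulusM l) modulusX.
Qed.

Lemma qderiv_near f s l : qderiv f s l -> forall r : R, 0 < r ->
  small (fun e => modulus (f (s + e) - f s) <= r).
Proof.
move=> [K K0 hK] r r0; have q0 : 0 < K + modulus l + 1.
  by rewrite ltr_wpDl// addr_ge0// modulus_ge0.
apply: smallW (smallI hK (smallI (small_le ltr01) (small_le (divr_gt0 r0 q0)))) => e [h1 [h2 h3]].
have e0 := modulus_ge0 e.
rewrite -[f (s + e) - f s](subrK (l * e)); apply: le_trans (modulusD _ _) _.
rewrite modulusM; apply: (@le_trans _ _ ((K + modulus l + 1) * modulus e)).
  rewrite mulrDl mul1r -[leLHS]addr0; apply: lerD => //; rewrite mulrDl; apply: lerD => //.
  by apply: le_trans h1 _; rewrite ler_wpM2l// expr2 ler_piMl.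
by rewrite mulrC -ler_pdivlMr.
Qed.

Lemma qderiv_neq0 f s l : qderiv f s l -> f s != 0 ->
  small (fun e => modulus (f s) / 2 <= modulus (f (s + e))).
Proof.
move=> hf fs0; have a0 : 0 < modulus (f s) / 2 by rewrite divr_gt0// modulus_gt0.
apply: smallW (qderiv_near hf a0) => e h.
have : modulus (f s) <= modulus (f (s + e)) + modulus (f (s + e) - f s).
  have -> : modulus (f s) = modulus (f (s + e) - (f (s + e) - f s)) by rewrite subKr.
  by apply: le_trans (modulusD _ _) _; rewrite modulusN.
by move: h; move: (modulus _) (modulus _) (modulus _) => x y u; lra.
Qed.

Lemma qderivV f s l : qderiv f s l -> f s != 0 ->
  qderiv (fun z => (f z)^-1) s (- l / f s ^+ 2).
Proof.
move=> hf fs0; have := qderiv_neq0 hf fs0; have [K K0 hK] := hf.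
set a := f s in fs0 hK * => hV.
have a0 : 0 < modulus a by exact: modulus_gt0.
exists ((modulus a * K + modulus l ^+ 2 + modulus l * K) / (modulus a ^+ 3 / 2)).
  by rewrite divr_ge0 ?divr_ge0 ?exprn_ge0 ?addr_ge0 ?mulr_ge0 ?modulus_ge0.
apply: smallW (smallI hV (smallI hK (small_le ltr01))) => e [h1 [h2 e1]].
have e0 := modulus_ge0 e.
set b := f (s + e) in h1 h2 *; set r := b - a - l * e in h2.
have b0 : 0 < modulus b by apply: lt_le_trans h1; rewrite divr_gt0.
have bn0 : b != 0 by apply: contraTneq b0 => ->; rewrite modulus0 ltxx.
have -> : b^-1 - a^-1 - - l / a ^+ 2 * e =
    (- a * r + l ^+ 2 * e ^+ 2 + l * e * r) / (a ^+ 2 * b).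
  by rewrite /r; field; rewrite fs0 bn0.
rewrite modulusM modulusV [leRHS]mulrAC; apply: ler_pM; rewrite ?modulus_ge0 ?invr_ge0 ?modulus_ge0//.
  have A1 : modulus (- a * r) <= modulus a * K * modulus e ^+ 2.
    by rewrite modulusM modulusN -[leRHS]mulrA ler_wpM2l ?modulus_ge0.
  have A2 : modulus (l ^+ 2 * e ^+ 2) <= modulus l ^+ 2 * modulus e ^+ 2.
    by rewrite (modulusM (l ^+ 2)) !modulusX.
  have A3 : modulus (l * e * r) <= modulus l * K * modulus e ^+ 2.
    rewrite !modulusM -mulrA -[leRHS]mulrA ler_wpM2l ?modulus_ge0//.
    by apply: le_trans h2; rewrite ler_piMl ?modulus_ge0.
  apply: le_trans (modulusD _ _) _; rewrite [leRHS]mulrDl; apply: lerD => //.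
  by rewrite [leRHS]mulrDl; exact: le_trans (modulusD _ _) (lerD A1 A2).
rewrite lef_pV2 ?posrE ?mulr_gt0 ?divr_gt0 ?exprn_gt0//; last first.
  by rewrite modulusM modulusX mulr_gt0// exprn_gt0.
by rewrite modulusM modulusX exprSr -mulrA ler_wpM2l// exprn_ge0// ltW.
Qed.

Lemma qderiv_ext f h s l : (forall z, f z = h z) -> qderiv f s l -> qderiv h s l.
Proof. by move=> /funext ->. Qed.

Lemma qderiv_simple_zero f s l : qderiv f s l -> f s = 0 -> l != 0 ->
  small (fun e => modulus l * modulus e / 2 <= modulus (f (s + e))).
Proof.
move=> [K K0 hK] fs0 l0.
have ml0 : 0 < modulus l by exact: modulus_gt0.
have q0 : 0 < modulus l / 2 / (K + 1) by rewrite !divr_gt0// ltr_wpDl.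
apply: smallW (smallI hK (small_le q0)) => e [h1 h2].
rewrite fs0 subr0 in h1; have e0 := modulus_ge0 e.
have : modulus (l * e) <= modulus (f (s + e)) + modulus (f (s + e) - l * e).
  have -> : modulus (l * e) = modulus (f (s + e) - (f (s + e) - l * e)) by rewrite subKr.
  by apply: le_trans (modulusD _ _) _; rewrite modulusN.
rewrite modulusM ler_pdivlMr in h2 *; last by rewrite ltr_wpDl.
move: h1 h2 e0 K0; move: (modulus (_ - _)) (modulus (f _)) (modulus e) (modulus l) => x y u v; nra.
Qed.

(** At [s] the quotient evaluates to 0, since an inverse of 0 is 0; this is the value that removes
    the singularity. *)
Lemma qderiv_double_pole f s l : qderiv f s l -> f s = 0 -> l != 0 ->
  qderiv (fun z => (z - s) ^+ 2 / f z) s l^-1.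
Proof.
move=> hf fs0 l0; have hV := qderiv_simple_zero hf fs0 l0; have [K K0 hK] := hf.
have ml0 : 0 < modulus l by exact: modulus_gt0.
exists (K / (modulus l ^+ 2 / 2)).
  by rewrite divr_ge0 ?divr_ge0 ?exprn_ge0// ltW.
apply: smallW (smallI hV hK) => e [h1 h2].
rewrite fs0 subr0 in h2 *; rewrite subrr expr0n mul0r subr0 addrAC subrr add0r.
have e0 := modulus_ge0 e.
have [->|en0] := eqVneq e 0.
  rewrite (_ : 0 ^+ 2 / _ - _ = 0); last by rewrite expr0n mul0r mulr0 subr0.
  by rewrite modulus0 mulr_ge0 ?sqr_ge0// divr_ge0 ?divr_ge0 ?sqr_ge0.
have me0 : 0 < modulus e by exact: modulus_gt0.
set b := f (s + e) in h1 h2 *.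
have b0 : 0 < modulus b by apply: lt_le_trans h1; rewrite divr_gt0// mulr_gt0.
have bn0 : b != 0 by apply: contraTneq b0 => ->; rewrite modulus0 ltxx.
have -> : e ^+ 2 / b - l^-1 * e = - (e * (b - l * e)) / (l * b).
  by field; rewrite l0 bn0.
rewrite modulusM modulusV modulusN !modulusM.
rewrite ler_pdivrMr ?mulr_gt0//.
apply: (@le_trans _ _ (modulus e * (K * modulus e ^+ 2))); first by rewrite ler_wpM2l.
apply: (@le_trans _ _ (K / (modulus l ^+ 2 / 2) * modulus e ^+ 2 *
   (modulus l * (modulus l * modulus e / 2)))).
  rewrite le_eqVlt; apply/orP; left; apply/eqP; field.
  by rewrite gt_eqF.
rewrite ler_wpM2l ?mulr_ge0 ?invr_ge0 ?divr_ge0 ?exprn_ge0//; first by rewrite ltW.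
by rewrite ler_wpM2l// ltW.
Qed.

Definition holo f z := small (fun e => exists l, qderiv f (z + e) l).

Lemma near_small (P : C -> Prop) z : small (fun e => P (z + e)) -> \forall s \near z, P s.
Proof.
move=> [r r0 hr]; apply/nbhs_ballP; exists (r%:C) => /=; first by rewrite ltcR.
move=> s; rewrite /ball/= => h.
have : `|z - s : R[i]| < r%:C by exact: h.
rewrite modulus_norm ltcR modulus_distC => /ltW /hr.
by rewrite addrC subrK.
Qed.

Lemma near_small_punctured (P : C -> Prop) z :
  small (fun e => e != 0 -> P (z + e)) -> \forall s \near z^', P s.
Proof.
move=> h; have : \forall s \near z, s != z -> P s.
  apply: near_small; apply: smallW h => e h ze; apply: h.
  by apply: contra ze => /eqP ->; rewrite addr0.
by [].
Qed.

Lemma qderiv_derivable f s l : qderiv f s l -> derivable f s 1.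
Proof.
move=> [K K0 [r r0 hK]]; apply/cvg_ex; exists l.
apply/cvgrPdist_le => /= eps eps0.
(* The order on the complex numbers compares only numbers with equal imaginary parts, so a positive
   [eps] is real. *)
have epsE : eps = (complex.Re eps)%:C.
  by move: eps0; rewrite ltcE => /andP[/eqP /= i0 _]; case: eps i0 => a b /= ->.
have re0 : 0 < complex.Re eps by move: eps0; rewrite epsE ltcR.
apply: near_small_punctured.
have q0 : 0 < complex.Re eps / (K + 1) by rewrite divr_gt0// ltr_wpDl.
apply: smallW (smallI (small_le r0) (small_le q0)) => e [h1 h2] e0.
rewrite add0r /= epsE modulus_norm lecR.
have me0 : 0 < modulus e by exact: modulus_gt0.
have := hK _ h1; set u := f (s + e) - _ - _ => hu.
have -> : l - e^-1 *: (f (e *: 1 + s) - f s) = - (e^-1 * u).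
  rewrite /u -[e *: 1]/(e * 1) mulr1 [e + s]addrC -[_ *: _]/(e^-1 * (f (s + e) - f s)).
  by field.
rewrite modulusN modulusM modulusV mulrC ler_pdivrMr//.
apply: le_trans hu _; rewrite expr2 mulrA ler_wpM2r ?modulus_ge0//.
rewrite ler_pdivlMr in h2; last by rewrite ltr_wpDl.
by apply: le_trans h2; rewrite mulrDr mulr1 mulrC lerDl modulus_ge0.
Qed.

Lemma holo_holomorphic_at f z : holo f z -> holomorphic_at f z.
Proof.
move=> h; apply: near_small; apply: smallW h => e [l hl]; exact: qderiv_derivable hl.
Qed.

End QuadraticDerivative.

(** * Meromorphic functions built from geometric series in exp(-2z) *)

Section MeromorphicClass.
Variable R : realType.
Local Notation C := (R[i])^o.
Implicit Types (f h : C -> C) (s z l m e x : C).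

Lemma smallT (P : C -> Prop) : (forall e, P e) -> small P.
Proof. by exists 1. Qed.

Lemma small_bool (P : bool -> C -> Prop) : (forall b, small (P b)) ->
  small (fun e => forall b, P b e).
Proof. by move=> h; apply: smallW (smallI (h true) (h false)) => e [h1 h2] []. Qed.

Definition entire f := forall s, exists l, qderiv f s l.

Lemma entire_holo f z : entire f -> holo f z.
Proof. by move=> h; apply: smallT. Qed.

Lemma entire_cst (c : C) : entire (fun=> c).
Proof. by move=> s; exists 0; exact: qderiv_cst. Qed.

Lemma entireD f h : entire f -> entire h -> entire (fun z => f z + h z).
Proof. by move=> hf hh s; have [l ?] := hf s; have [m ?] := hh s; exists (l + m); exact: qderivD. Qed.

Lemma entireM f h : entire f -> entire h -> entire (fun z => f z * h z).
Proof.
by move=> hf hh s; have [l ?] := hf s; have [m ?] := hh s; exists (l * h s + f s * m); exact: qderivM.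
Qed.

Lemma entireX f n : entire f -> entire (fun z => f z ^+ n).
Proof.
move=> hf; elim: n => [|n IH]; first exact: entire_cst.
rewrite (_ : (fun _ => _) = (fun z => f z * f z ^+ n)); first exact: entireM.
by apply/funext => z; rewrite exprS.
Qed.

Lemma entire_sum (J : Type) (s : seq J) (F : J -> C -> C) : (forall j, entire (F j)) ->
  entire (fun z => \sum_(j <- s) F j z).
Proof.
move=> hF; elim: s => [|j s IH].
  by rewrite (_ : (fun=> _) = fun=> 0); [exact: entire_cst|apply/funext => z; rewrite big_nil].
rewrite (_ : (fun=> _) = fun z => F j z + \sum_(j <- s) F j z); first exact: entireD.
by apply/funext => z; rewrite big_cons.
Qed.

Lemma entire_subX (z : C) n : entire (fun s => (s - z) ^+ n).
Proof.
apply: entireX => s; exists (1 + 0); apply: qderivD; [exact: qderiv_id|exact: qderiv_cst].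
Qed.

Lemma holoD f h z : holo f z -> holo h z -> holo (fun s => f s + h s) z.
Proof.
by move=> hf hh; apply: smallW (smallI hf hh) => e [[l hl] [m hm]]; exists (l + m); exact: qderivD.
Qed.

Lemma holoM f h z : holo f z -> holo h z -> holo (fun s => f s * h s) z.
Proof.
move=> hf hh; apply: smallW (smallI hf hh) => e [[l hl] [m hm]].
by exists (l * h (z + e) + f (z + e) * m); exact: qderivM.
Qed.

Definition pole f z N := exists2 h, holo h z &
  small (fun e => e != 0 -> f (z + e) = h (z + e) / e ^+ N).

Lemma poleD f h z N : pole f z N -> pole h z N -> pole (fun s => f s + h s) z N.
Proof.
move=> [f' hf' hf] [h' hh' hh]; exists (fun s => f' s + h' s); first exact: holoD.
by apply: smallW (smallI hf hh) => e [h1 h2] e0; rewrite h1// h2// mulrDl.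
Qed.

Lemma poleM f h z N M : pole f z N -> pole h z M -> pole (fun s => f s * h s) z (N + M).
Proof.
move=> [f' hf' hf] [h' hh' hh]; exists (fun s => f' s * h' s); first exact: holoM.
apply: smallW (smallI hf hh) => e [h1 h2] e0; rewrite h1// h2// exprD invfM.
by rewrite mulrACA.
Qed.

Lemma pole_entire f z N : entire f -> pole f z N.
Proof.
move=> hf; exists (fun s => f s * (s - z) ^+ N).
  by apply: entire_holo; apply: entireM => //; exact: entire_subX.
apply: smallT => e e0; rewrite addrAC subrr add0r mulfK//.
by rewrite expf_neq0.
Qed.

Lemma pole_pole_order_le f z N : pole f z N -> pole_order_le f z N.
Proof.
move=> [h hh hf]; exists h; first exact: holo_holomorphic_at.
apply: near_small_punctured; apply: smallW hf => e hf e0.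
by rewrite hf// addrAC subrr add0r.
Qed.

Lemma qderiv_cexp (c s : C) : qderiv (fun z => cexp (c * z)) s (c * cexp (c * s)).
Proof.
exists (modulus (cexp (c * s)) * (5 * modulus c ^+ 2)).
  by rewrite mulr_ge0 ?modulus_ge0// mulr_ge0 ?sqr_ge0.
have q0 : 0 < 1 / 2 / (modulus c + 1) :> R by rewrite !divr_gt0// ltr_wpDl ?modulus_ge0.
apply: smallW (small_le q0) => e he.
have ce : modulus (c * e) <= 1 / 2.
  rewrite modulusM; apply: (@le_trans _ _ ((modulus c + 1) * modulus e)).
    by rewrite ler_wpM2r ?modulus_ge0// lerDl.
  by rewrite mulrC -ler_pdivlMr// ltr_wpDl ?modulus_ge0.
have -> : cexp (c * (s + e)) - cexp (c * s) - c * cexp (c * s) * e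
    = cexp (c * s) * (cexp (c * e) - 1 - c * e) by rewrite mulrDr cexpD; ring.
rewrite modulusM -mulrA ler_wpM2l ?modulus_ge0//.
apply: le_trans (cexp_bound ce) _.
by rewrite modulusM exprMn mulrA.
Qed.

Lemma cexpX z n : cexp z ^+ n = cexp (n%:R * z).
Proof.
elim: n => [|n IH]; first by rewrite expr0 mul0r cexp0.
by rewrite exprS IH -cexpD -natr1 mulrDl mul1r addrC.
Qed.

(** The variable of the generating series: |D|^(-2z) has the eigenvalue [Ee z ^+ h] at height
    [h]. *)
Definition Ee (z : C) : C := cexp (- (2 * z)).

Lemma Ee_exp p z : Ee z ^+ p = cexp ((- (2 * p%:R)) * z).
Proof. by rewrite /Ee cexpX; congr cexp; ring. Qed.

Lemma modulus_Ee z : modulus (Ee z) = expR (- (2 * complex.Re z)).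
Proof.
rewrite /Ee modulus_cexp; congr expR.
have -> : 2 * z = z + z by ring.
by case: z => a b /=; ring.
Qed.

Lemma Ee_neq0 z : Ee z != 0.
Proof.
apply/eqP => e; have := modulus_Ee z; rewrite e modulus0 => /esym/eqP.
by rewrite gt_eqF// expR_gt0.
Qed.

Lemma entire_Ee p : entire (fun z => Ee z ^+ p).
Proof.
move=> s; exists ((- (2 * p%:R)) * cexp ((- (2 * p%:R)) * s)).
by apply: qderiv_ext (qderiv_cexp _ _) => z; rewrite Ee_exp.
Qed.

Definition den x p z : C := 1 - x * Ee z ^+ p.

Lemma qderiv_den x p s : qderiv (den x p) s (2 * p%:R * x * Ee s ^+ p).
Proof.
have h : qderiv (fun z => 1 + - x * cexp ((- (2 * p%:R)) * z)) s
    (0 + (0 * cexp ((- (2 * p%:R)) * s) + - x * ((- (2 * p%:R)) * cexp ((- (2 * p%:R)) * s)))).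
  apply: qderivD; first exact: qderiv_cst.
  by apply: qderivM; [exact: qderiv_cst|exact: qderiv_cexp].
have -> : 2 * p%:R * x * Ee s ^+ p = 0 + (0 * cexp ((- (2 * p%:R)) * s) +
    - x * ((- (2 * p%:R)) * cexp ((- (2 * p%:R)) * s))) by rewrite Ee_exp; ring.
by apply: qderiv_ext h => z; rewrite /den Ee_exp [- x * _]mulNr.
Qed.

Lemma den_deriv_neq0 x p s : x != 0 -> (0 < p)%N -> 2 * p%:R * x * Ee s ^+ p != 0.
Proof.
move=> x0 p0; have p1 : p%:R != 0 :> C by rewrite pnatr_eq0 -lt0n.
have two0 : 2 != 0 :> C by rewrite pnatr_eq0.
exact: mulf_neq0 (mulf_neq0 (mulf_neq0 two0 p1) x0) (expf_neq0 _ (Ee_neq0 s)).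
Qed.

(** The derivative of [den] is a multiple of an exponential and never vanishes, so all zeros are
    simple and isolated. *)
Lemma den_punctured x p z : x != 0 -> (0 < p)%N ->
  small (fun e => e != 0 -> den x p (z + e) != 0).
Proof.
move=> x0 p0; have hd := qderiv_den x p z.
have [d0|/eqP d0] := pselect (den x p z = 0).
  apply: smallW (qderiv_simple_zero hd d0 (den_deriv_neq0 z x0 p0)) => e h e0.
  apply/eqP => de; move: h; rewrite de modulus0 leNgt => /negP; apply.
  by rewrite divr_gt0// mulr_gt0 ?modulus_gt0// den_deriv_neq0.
apply: smallW (qderiv_neq0 hd d0) => e h _; apply/eqP => de.
move: h; rewrite de modulus0 leNgt => /negP; apply.
by rewrite divr_gt0// modulus_gt0.
Qed.

Lemma den_holo_inv x p z : den x p z != 0 -> holo (fun s => (den x p s)^-1) z.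
Proof.
move=> d0; have hd := qderiv_den x p z.
apply: smallW (qderiv_neq0 hd d0) => e h; eexists; apply: qderivV; first exact: qderiv_den.
apply/eqP => de; move: h; rewrite de modulus0 leNgt => /negP; apply.
by rewrite divr_gt0// modulus_gt0.
Qed.

(* Multiplying by (s - z)^2 rather than s - z makes the first derivative of the
   exponential suffice to remove the singularity. *)
Lemma pole_den_inv x p z : x != 0 -> (0 < p)%N -> pole (fun s => (den x p s)^-1) z 2.
Proof.
move=> x0 p0; exists (fun s => (s - z) ^+ 2 / den x p s); last first.
  apply: smallT => e e0; rewrite addrAC subrr add0r mulrC mulKf//.
  by rewrite expf_neq0.
apply: smallW (den_punctured z x0 p0) => e he.
have [->|e0] := eqVneq e 0; last first.
  have [l hl] := entire_subX z 2 (z + e).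
  eexists; apply: (qderivM hl); apply: qderivV; first exact: qderiv_den.
  exact: he.
rewrite addr0; have [d0|/eqP d0] := pselect (den x p z = 0).
  exists (2 * p%:R * x * Ee z ^+ p)^-1; apply: qderiv_double_pole => //.
    exact: qderiv_den.
  exact: den_deriv_neq0.
have [l hl] := entire_subX z 2 z.
by eexists; apply: (qderivM hl); apply: qderivV; first exact: qderiv_den.
Qed.

Section Spectrum.
Variable q : nat.
Hypothesis q0 : (0 < q)%N.

(* The bases of the geometric growth of the level sets, twisted by powers of |D|. *)
Definition rate (b r : bool) (k : int) : C := (-1) ^+ b * ((q%:R ^+ r * expR k%:~R)%:C).

Lemma modulus_rate b r k : modulus (rate b r k) = q%:R ^+ r * expR k%:~R.
Proof.
rewrite /rate modulusM modulusX modulusN modulus1 expr1n mul1r modulus_real ger0_norm//.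
Qed.

Lemma rate_neq0 b r k : rate b r k != 0.
Proof.
apply/eqP => e; have := modulus_rate b r k; rewrite e modulus0 => /esym/eqP.
by rewrite gt_eqF// mulr_gt0 ?expR_gt0// exprn_gt0// ltr0n.
Qed.

(** The exponent [p.+1] is 1 or 2, the speed at which the height grows with the distance of core
    length and trail on the two sides of the line where they agree. *)
Definition Sd : set C :=
  [set z | exists (b r p : bool) (k : int), rate b r k * Ee z ^+ p.+1 = 1].

(** Taking moduli gives [k - k' = 2 (p + 1) (Re z - Re z')], which is at most 1/2 in absolute
    value. *)
Lemma rate_root_close b r (p : bool) k k' z z' : modulus (z - z') <= 1 / 8 ->
  rate b r k * Ee z ^+ p.+1 = 1 -> rate b r k' * Ee z' ^+ p.+1 = 1 -> k = k'.
Proof.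
move=> hz /(congr1 (@modulus R)) h /(congr1 (@modulus R)) h'.
move: h h'; rewrite (modulusM (rate b r k)) (modulusM (rate b r k')) !modulus_rate.
rewrite !modulusX !modulus_Ee modulus1.
rewrite -!expRM_natl => h h'.
have qr : q%:R ^+ r != 0 :> R by rewrite expf_neq0// pnatr_eq0 -lt0n.
have e1 : expR (k%:~R + p.+1%:R * (- (2 * complex.Re z))) =
    expR (k'%:~R + p.+1%:R * (- (2 * complex.Re z'))) :> R.
  by rewrite !expRD; apply: (mulfI qr); rewrite !mulrA h h'.
move/expR_inj: e1 => e1.
have hre : `|complex.Re z - complex.Re z'| <= 1 / 8.
  by apply: le_trans hz; apply: le_trans (ler_Re_modulus _); case: (z) (z') => a c [a' c'].
have hp : p.+1%:R <= 2 :> R by case: (p); rewrite ler_nat.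
have hp0 : 0 <= p.+1%:R :> R by [].
have : `|(k - k')%:~R : R| < 1.
  rewrite rmorphB/= (_ : _ - _ = p.+1%:R * 2 * (complex.Re z - complex.Re z')); last by lra.
  rewrite !normrM (ger0_norm hp0) (ger0_norm (_ : 0 <= 2))//.
  by move: hre hp hp0; move: (`|_|) (p.+1%:R) => a c *; nra.
rewrite -intr_norm ltrz1 => h1.
by apply/eqP; rewrite -subr_eq0 -normr_eq0; move: h1; lia.
Qed.

Lemma discrete_Sd : Defs.discrete_closed Sd.
Proof.
move=> z; apply: near_small_punctured.
have key b r (p : bool) : small (fun e => e != 0 -> forall k, rate b r k * Ee (z + e) ^+ p.+1 <> 1).
  (* Two points within 1/16 of [z] are within 1/8 of each other, so at most one of the infinitely
     many [k] has roots near [z], and those are isolated. *)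
  have h16 : 0 < 1 / 16 :> R by [].
  have [[e0 [k0 [he0 hk0]]]|nex] := pselect (exists e0 k0, modulus e0 <= 1 / 16 /\
      rate b r k0 * Ee (z + e0) ^+ p.+1 = 1); last first.
    apply: smallW (small_le h16) => e he _ k hk; apply: nex; by exists e, k.
  apply: smallW (smallI (small_le h16) (den_punctured z (rate_neq0 b r k0) (ltn0Sn p))).
  move=> e [he hd] en0 k hk.
  have ee : modulus (z + e - (z + e0)) <= 1 / 8.
    have -> : z + e - (z + e0) = e - e0 by ring.
    apply: le_trans (modulusD _ _) _; rewrite modulusN; lra.
  have kk := rate_root_close ee hk hk0; rewrite kk in hk.
  by have := hd en0; rewrite /den hk subrr eqxx.
have h := small_bool (fun b => small_bool (fun r => small_bool (fun p => key b r p))).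
by apply: smallW h => e h e0 [b [r [p [k hk]]]]; exact: (h b r p e0 k).
Qed.

Definition mero N f := (forall z, ~ Sd z -> holo f z) /\ (forall z, pole f z N).

Lemma meroD N f h : mero N f -> mero N h -> mero N (fun z => f z + h z).
Proof.
by move=> [f1 f2] [h1 h2]; split => z; [move=> Sz; apply: holoD; [exact: f1|exact: h1]|exact: poleD].
Qed.

Lemma meroM N M f h : mero N f -> mero M h -> mero (N + M) (fun z => f z * h z).
Proof.
by move=> [f1 f2] [h1 h2]; split => z; [move=> Sz; apply: holoM; [exact: f1|exact: h1]|exact: poleM].
Qed.

Lemma mero_entire N f : entire f -> mero N f.
Proof. by move=> hf; split => z; [move=> _; exact: entire_holo|exact: pole_entire]. Qed.

Lemma meroZ N (c : C) f : mero N f -> mero N (fun z => c * f z).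
Proof. by move=> hf; apply: (@meroM 0 N) => //; apply: mero_entire; exact: entire_cst. Qed.

Lemma mero_geometric b r (p : bool) k : mero 2 (fun z => (den (rate b r k) p.+1 z)^-1).
Proof.
split => z; last by apply: pole_den_inv => //; exact: rate_neq0.
move=> Sz; apply: den_holo_inv; apply/eqP => d0; apply: Sz; exists b, r, p, k.
by apply/esym/eqP; rewrite -subr_eq0; apply/eqP.
Qed.

End Spectrum.

End MeromorphicClass.

(** * Zeta functions of piecewise exponential functions *)

Section Limits.
Variable R : realType.
Local Notation C := (R[i])^o.
Implicit Types (s r : nat -> C) (a b c x y : C).

Lemma seqlimP s a : (forall e : R, 0 < e -> exists N, forall K, (N <= K)%N -> modulus (s K - a) <= e) ->
  s @ \oo --> a.
Proof.
move=> h; apply/cvgrPdist_le => /= e e0.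
have eE : e = (complex.Re e)%:C by move: e0; rewrite ltcE => /andP[/eqP /= i0 _]; case: e i0 => u v /= ->.
have [|N hN] := h (complex.Re e); first by move: e0; rewrite eE ltcR.
by exists N => // K /hN hK; rewrite /= eE modulus_norm modulus_distC lecR.
Qed.

Lemma seqlim_ext s r a : (forall K, s K = r K) -> s @ \oo --> a -> r @ \oo --> a.
Proof. by move=> /funext ->. Qed.

Lemma seqlim_eventually s a N : (forall K, (N <= K)%N -> s K = a) -> s @ \oo --> a.
Proof. by move=> h; apply: seqlimP => e e0; exists N => K /h ->; rewrite subrr modulus0 ltW. Qed.

Lemma hassum_exhaust (I : choiceType) (f : I -> C) c (S : nat -> seq I) :
  hassum f c -> (forall K, uniq (S K)) ->
  (forall i, exists N, forall K, (N <= K)%N -> i \in S K) ->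
  (fun K => \sum_(i <- S K) f i) @ \oo --> c.
Proof.
move=> hf uS hS; apply: seqlimP => e e0; have [X hX] := hf e e0.
have [N hN] : exists N, forall K, (N <= K)%N -> {subset X <= S K}.
  elim: X {hX} => [|i X [N IH]]; first by exists 0%N.
  have [M hM] := hS i; exists (maxn N M) => K; rewrite geq_max => /andP[NK MK] j.
  by rewrite in_cons => /predU1P[->|/(IH _ NK)//]; exact: hM.
by exists N => K /hN; exact: hX.
Qed.

Lemma geometric_lim y : modulus y < 1 -> (fun K => \sum_(i < K) y ^+ i) @ \oo --> (1 - y)^-1.
Proof.
move=> y1; apply: seqlimP => e e0.
have ny1 : 1 - y != 0.
  by rewrite subr_eq0; apply: contraTneq y1 => <-; rewrite modulus1 ltxx.
have d0 : 0 < modulus (1 - y) by exact: modulus_gt0.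
have cv : (fun K => modulus y ^+ K) @ \oo --> (0 : R).
  by apply: cvg_expr; rewrite ger0_norm ?modulus_ge0.
have /cvgrPdist_le /(_ (e * modulus (1 - y)) (mulr_gt0 e0 d0)) [N _ hN] := cv.
exists N => K /hN /=; rewrite sub0r normrN ger0_norm ?exprn_ge0 ?modulus_ge0// => h.
have -> : \sum_(i < K) y ^+ i - (1 - y)^-1 = - (y ^+ K / (1 - y)).
  have -> : \sum_(i < K) y ^+ i = (1 - y ^+ K) / (1 - y); last by field.
  apply: (mulIf ny1); rewrite divfK// mulrC; elim: (K) => [|n IH].
    by rewrite big_ord0 mulr0 subrr.
  by rewrite big_ord_recr /= mulrDr IH exprS; ring.
by rewrite modulusN modulusM modulusV modulusX ler_pdivrMr.
Qed.

(** With such weights a geometric series is a multiple of the plain one plus a finite sum. *)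
Definition evconst (u : nat -> C) := exists n c, forall i, (n <= i)%N -> u i = c.

Lemma evconst_cst c : evconst (fun=> c). Proof. by exists 0%N, c. Qed.

Lemma evconst_fin (u : nat -> C) n : (forall i, (n <= i)%N -> u i = 0) -> evconst u.
Proof. by exists n, 0. Qed.

Lemma evconstM u v : evconst u -> evconst v -> evconst (fun i => u i * v i).
Proof.
move=> [n [c hn]] [m [a hm]]; exists (maxn n m), (c * a) => i.
by rewrite geq_max => /andP[/hn -> /hm ->].
Qed.

Variable q : nat.
Hypothesis q0 : (0 < q)%N.
Notation rate := (rate R q).

(** [F z K] is a partial sum; working with limits turns a product of geometric series into a product
    of finite sums. *)
Definition zlim N (F : C -> nat -> C) := exists2 Z : C -> C, mero q N Z &
  exists x0 : R, forall z, x0 < complex.Re z -> F z @ \oo --> Z z.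

Lemma zlim_ext N F G : (forall z K, F z K = G z K) -> zlim N F -> zlim N G.
Proof.
move=> e [Z mZ [x hx]]; exists Z => //; exists x => z /hx; apply: seqlim_ext => K; exact: e.
Qed.

Lemma zlim_cst N c : zlim N (fun _ _ => c).
Proof.
exists (fun=> c); first by apply: mero_entire; exact: entire_cst.
by exists 0 => z _; exact: cvg_cst.
Qed.

Lemma zlimD N F G : zlim N F -> zlim N G -> zlim N (fun z K => F z K + G z K).
Proof.
move=> [Z mZ [x hx]] [Y mY [y hy]]; exists (fun z => Z z + Y z); first exact: meroD.
by exists (Num.max x y) => z; rewrite gt_max => /andP[/hx h1 /hy]; exact: cvgD.
Qed.

Lemma zlimM N M F G : zlim N F -> zlim M G -> zlim (N + M) (fun z K => F z K * G z K).
Proof.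
move=> [Z mZ [x hx]] [Y mY [y hy]]; exists (fun z => Z z * Y z); first exact: meroM.
by exists (Num.max x y) => z; rewrite gt_max => /andP[/hx h1 /hy]; exact: cvgM.
Qed.

Lemma zlim_sum N (J : Type) (l : seq J) (F : J -> C -> nat -> C) :
  (forall j, zlim N (F j)) -> zlim N (fun z K => \sum_(j <- l) F j z K).
Proof.
move=> h; elim: l => [|j l IH].
  by apply: zlim_ext (zlim_cst N 0) => z K; rewrite big_nil.
by apply: zlim_ext (zlimD (h j) IH) => z K; rewrite big_cons.
Qed.

Lemma zlim_geometric u (b r p : bool) (k : int) : evconst u ->
  zlim 2 (fun z K => \sum_(i < K) u i * (rate b r k * Ee z ^+ p.+1) ^+ i).
Proof.
move=> [n [c hc]]; set x := rate b r k.
(* The first sum corrects the terms before the weights become constant and is entire. *)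
exists (fun z => \sum_(i < n) (u i - c) * (x * Ee z ^+ p.+1) ^+ i + c * (den x p.+1 z)^-1).
  apply: meroD; last by apply: meroZ; exact: mero_geometric.
  apply: mero_entire; apply: entire_sum => i; apply: entireM; first exact: entire_cst.
  apply: entireX; apply: entireM; [exact: entire_cst|exact: entire_Ee].
(* Beyond this abscissa the ratio is contracting: [|x| < 1 + Re z <= exp (2 (p + 1) Re z)]. *)
exists (modulus x) => z hz.
have z0 : 0 < complex.Re z by apply: le_lt_trans hz; exact: modulus_ge0.
have y1 : modulus (x * Ee z ^+ p.+1) < 1.
  rewrite modulusM modulusX modulus_Ee -expRM_natl mulrN expRN ltr_pdivrMr ?expR_gt0// mul1r.
  apply: lt_trans hz _; apply: lt_le_trans (_ : _ < 1 + complex.Re z) _.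
    by rewrite ltrDr.
  apply: le_trans (expR_ge1Dx _) _; rewrite ler_expR mulrA ler_pMl//.
  by rewrite -natrM ler1n.
set y := x * _ in y1 *.
have h1 : (fun K => \sum_(i < K) (u i - c) * y ^+ i : C) @ \oo --> (\sum_(i < n) (u i - c) * y ^+ i : C).
  apply: (@seqlim_eventually _ _ n) => K nK; rewrite -(big_mkord xpredT (fun i => (u i - c) * y ^+ i)).
  rewrite (@big_cat_nat _ _ _ n)//= [X in _ + X]big_nat_cond [X in _ + X]big1 ?addr0 ?big_mkord//.
  by move=> i /andP[/andP[ni _] _]; rewrite hc// subrr mul0r.
apply: (@seqlim_ext (fun K => \sum_(i < K) (u i - c) * y ^+ i + c * \sum_(i < K) y ^+ i)) => [K|].
  by rewrite mulr_sumr -big_split/=; apply: eq_bigr => i _; ring.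
apply: cvgD; first exact: h1.
by apply: cvgM; [exact: cvg_cst|exact: geometric_lim y1].
Qed.

Definition bexp (x : bool * bool * int) : C := rate x.1.1 x.1.2 x.2.

(* The kernels whose double generating series is a sum of products of geometric
   series, up to finitely many terms in each factor. *)
Definition sep (kap : nat -> nat -> C) := exists (J : finType) (u v : J -> nat -> C)
    (x y : J -> bool * bool * int),
  [/\ forall j, evconst (u j), forall j, evconst (v j) &
   forall i m, kap i m = \sum_j u j i * bexp (x j) ^+ i * (v j m * bexp (y j) ^+ m)].

Lemma sep_ext kap kap' : (forall i m, kap i m = kap' i m) -> sep kap -> sep kap'.
Proof.
move=> e [J [u [v [x [y [hu hv h]]]]]]; exists J, u, v, x, y; split => // i m.
by rewrite -e h.
Qed.

Lemma sepD kap kap' : sep kap -> sep kap' -> sep (fun i m => kap i m + kap' i m).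
Proof.
move=> [J [u [v [x [y [hu hv h]]]]]] [J' [u' [v' [x' [y' [hu' hv' h']]]]]].
pose cmb T (f : J -> T) (f' : J' -> T) (j : J + J') := match j with inl j => f j | inr j => f' j end.
exists (J + J')%type, (cmb _ u u'), (cmb _ v v'), (cmb _ x x'), (cmb _ y y').
split; [by case|by case|]; move=> i m; by rewrite big_sumType h h'.
Qed.

Lemma sepM kap u v : evconst u -> evconst v -> sep kap ->
  sep (fun i m => u i * v m * kap i m).
Proof.
move=> hu hv [J [u' [v' [x [y [hu' hv' h]]]]]].
exists J, (fun j i => u i * u' j i), (fun j m => v m * v' j m), x, y; split.
- by move=> j; exact: evconstM.
- by move=> j; exact: evconstM.
- by move=> i m; rewrite h mulr_sumr; apply: eq_bigr => j _; ring.
Qed.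

Lemma bexp_shift (x : bool * bool * int) (k : int) i :
  bexp x ^+ i * (expR (k%:~R * i%:R))%:C = bexp (x.1, x.2 + k) ^+ i.
Proof.
rewrite expRM_natr rmorphXn/= -exprMn; congr (_ ^+ _); rewrite /bexp /rate /=.
by rewrite rmorphD expRD -mulrA -rmorphM/= -mulrA.
Qed.

Lemma sep_exp kap (k j : int) : sep kap ->
  sep (fun i m => kap i m * (expR (k%:~R * i%:R + j%:~R * m%:R))%:C).
Proof.
move=> [J [u [v [x [y [hu hv h]]]]]].
exists J, u, v, (fun l => ((x l).1, (x l).2 + k)), (fun l => ((y l).1, (y l).2 + j)).
split; [exact: hu|exact: hv|].
move=> i m; rewrite h mulr_suml; apply: eq_bigr => l _.
by rewrite -(bexp_shift (x l) k i) -(bexp_shift (y l) j m) expRD rmorphM/=; ring.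
Qed.

Lemma sep1 (x y : bool * bool * int) u v : evconst u -> evconst v ->
  sep (fun i m => u i * bexp x ^+ i * (v m * bexp y ^+ m)).
Proof.
by move=> hu hv; exists 'I_1, (fun=> u), (fun=> v), (fun=> x), (fun=> y); split => // i m; rewrite big_ord1.
Qed.

(** The power of [Ee z] splits over the two indices, and each geometric factor contributes 2 to the
    pole order. *)
Lemma zlim_sep kap (p : bool) : sep kap ->
  zlim 4 (fun z K => \sum_(i < K) \sum_(m < K) kap i m * Ee z ^+ (i + p.+1 * m)).
Proof.
move=> [J [u [v [x [y [hu hv h]]]]]].
have hj j := zlimM (zlim_geometric (x j).1.1 (x j).1.2 false (x j).2 (hu j))
  (zlim_geometric (y j).1.1 (y j).1.2 p (y j).2 (hv j)).
apply: zlim_ext (zlim_sum (index_enum J) hj) => z K.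
transitivity (\sum_j \sum_(i < K) \sum_(m < K) u j i * bexp (x j) ^+ i * (v j m * bexp (y j) ^+ m)
    * Ee z ^+ (i + p.+1 * m)).
  apply: eq_bigr => j _; rewrite big_distrlr/=; apply: eq_bigr => i _; apply: eq_bigr => m _.
  have e1 : (bexp (x j) * Ee z ^+ false.+1) ^+ i = bexp (x j) ^+ i * Ee z ^+ i by rewrite exprMn.
  have e2 : (bexp (y j) * Ee z ^+ p.+1) ^+ m = bexp (y j) ^+ m * Ee z ^+ (p.+1 * m).
    by rewrite exprMn -exprM.
  by rewrite e1 e2 (exprD (Ee z) i); ring.
rewrite exchange_big; apply: eq_bigr => i _; rewrite exchange_big; apply: eq_bigr => m _.
by rewrite h mulr_suml.
Qed.

End Limits.

(** * Counting reduced words with a transfer matrix *)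

Section WordCounting.
Variables (R : realType) (d : nat) (g : letter d).
Hypothesis d0 : (0 < d)%N.
Local Notation C := (R[i])^o.
Local Notation letter := (letter d).
Local Notation I := (fgroup d).
Implicit Types (w v : seq letter) (x y : letter) (mu : I) (P : pred letter).
Let q := (d * 2).-1.

Definition reduced_words N := [seq w <- [seq val s | s : N.-tuple letter] | reduced w].
Definition tails m x := [seq w <- [seq val s | s : m.-tuple letter] | path (@no_cancel d) x w].

Lemma mem_all_words N w : (w \in [seq val s | s : N.-tuple letter]) = (size w == N).
Proof.
apply/mapP/idP => [[s _ ->]|/eqP sw]; first by rewrite size_tuple.
by rewrite -sw; exists (in_tuple w) => //; rewrite mem_enum.
Qed.

Lemma all_words_uniq N : uniq [seq val s | s : N.-tuple letter].
Proof. by rewrite map_inj_uniq ?enum_uniq//; exact: val_inj. Qed.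

Lemma mem_reduced_words N w : (w \in reduced_words N) = (size w == N) && reduced w.
Proof. by rewrite mem_filter mem_all_words andbC. Qed.

Lemma reduced_words_uniq N : uniq (reduced_words N).
Proof. by rewrite filter_uniq// all_words_uniq. Qed.

Lemma mem_tails m x w : (w \in tails m x) = (size w == m) && path (@no_cancel d) x w.
Proof. by rewrite mem_filter mem_all_words andbC. Qed.

Lemma tails_uniq m x : uniq (tails m x).
Proof. by rewrite filter_uniq// all_words_uniq. Qed.

(** The power [m] of the transfer matrix, applied to the weight [p] and evaluated at [x]. *)
Definition ecount (p : letter -> C) m x : C := \sum_(w <- tails m x) p (last x w).

Lemma ecount0 p x : ecount p 0 x = p x.
Proof.
rewrite /ecount (perm_big [:: [::]]) ?big_seq1//.
apply: uniq_perm; rewrite ?tails_uniq// => w.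
by rewrite mem_tails size_eq0 inE; case: w.
Qed.

Lemma ecountS p m x : ecount p m.+1 x = \sum_(y | no_cancel x y) ecount p m y.
Proof.
rewrite /ecount.
rewrite (perm_big [seq y :: w | y <- [seq y <- enum {: letter} | no_cancel x y], w <- tails m y]); last first.
  apply: uniq_perm; rewrite ?tails_uniq//.
    apply: allpairs_uniq_dep; first by rewrite filter_uniq// enum_uniq.
      by move=> y _; exact: tails_uniq.
    by move=> [y w] [y' w'] _ _ /= [-> ->].
  move=> [|y w]; rewrite mem_tails /=; apply/idP/allpairsPdep => //.
    by move=> [y [w [_ _]]].
    move=> /andP[sw /andP[xy yw]]; exists y, w; split => //.
      by rewrite mem_filter xy mem_enum.
    by rewrite mem_tails -eqSS sw.
  move=> [y' [w' [hy hw [-> ->]]]].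
  move: hy hw; rewrite mem_filter mem_tails => /andP[-> _] /andP[/eqP -> ->].
  by rewrite eqxx.
by rewrite big_allpairs_dep big_filter big_enum_cond; apply: eq_bigl => y; rewrite inE.
Qed.

Lemma card_letter : #|{: letter}| = (d * 2)%N.
Proof. by rewrite card_prod card_ord card_bool. Qed.

Lemma qE : (q%:R : C) = (d * 2)%:R - 1.
Proof. by rewrite /q -subn1 natrB// muln_gt0 d0. Qed.

Lemma two_d_neq0 : (d * 2)%:R != 0 :> C.
Proof. by rewrite pnatr_eq0 muln_eq0 negb_or -lt0n d0. Qed.

(* The transfer matrix on letters has eigenvalues 2d - 1 and ±1. *)
Lemma ecountE (p : letter -> C) m x : ecount p m x =
  (\sum_y p y) / (d * 2)%:R * q%:R ^+ m + (p x - p (linv x)) / 2 +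
  ((p x + p (linv x)) / 2 - (\sum_y p y) / (d * 2)%:R) * (-1) ^+ m.
Proof.
have n0 := two_d_neq0; have hq := qE.
have hc (z : C) : z *+ #|{: letter}| = z * (d * 2)%:R by rewrite card_letter mulr_natr.
move: ((d * 2)%:R : C) n0 hq hc => D n0 hq hc.
set s := \sum_y p y.
have sl : \sum_y p (linv y) = s.
  by rewrite /s [RHS](reindex_inj (can_inj (@linvK d))).
elim: m x => [|m IH] x; first by rewrite ecount0 !expr0; field.
rewrite ecountS.
(* A transfer step sums over all letters and subtracts the value at the inverse. Constants have
   eigenvalue 2d - 1, odd functions under [linv] have 1, even functions of sum zero have -1; the
   formula splits [p] accordingly. *)
have -> : \sum_(y | no_cancel x y) ecount p m y = \sum_y ecount p m y - ecount p m (linv x).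
  by rewrite [in RHS](bigD1 (linv x))//= addrAC subrr add0r.
have -> : \sum_y ecount p m y = s * q%:R ^+ m.
  rewrite (eq_bigr _ (fun y _ => IH y)) !big_split/=.
  have -> : \sum_y (p y - p (linv y)) / 2 = 0 by rewrite -mulr_suml sumrB sl subrr mul0r.
  rewrite -[X in _ + _ + X]mulr_suml.
  have -> : \sum_y ((p y + p (linv y)) / 2 - s / D) = 0.
    by rewrite sumrB -mulr_suml big_split/= sl -/s sumr_const hc; field.
  by rewrite sumr_const hc mul0r !addr0; field.
rewrite IH linvK !exprS hq; move: ((D - 1) ^+ m) ((-1) ^+ m : C) => Q E1.
by field.
Qed.

(** The formula starts at some [n] because words shorter than a prescribed prefix are
    exceptional. *)
Definition evexp (A : nat -> C) := exists n c0 c1 c2, forall N, (n <= N)%N ->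
  A N = c0 * q%:R ^+ N + c1 + c2 * (-1) ^+ N.

(* In [acount], the words with prefix [v] are counted by the condition [P] on the
   last letter; it says whether some power of [g] can be appended. *)
Definition endok P w := nilp w || P (last g w).

Definition acount P v n N : C := \sum_(w <- reduced_words N | (take n w == v) && endok P w) 1.

Lemma q_neq0 : q%:R != 0 :> C.
Proof. by rewrite pnatr_eq0 -lt0n /q; case: d d0 => // e _; rewrite mulSn. Qed.

(** Of a fixed prefix only the last letter constrains the continuation, so the count is an [ecount]
    with [N - n] steps. *)
Lemma acount_evexp P v n : (0 < n)%N -> evexp (acount P v n).
Proof.
move=> n0; exists n.
(* If [v] is not a reduced word of length [n], it is no prefix and all these counts vanish. *)
have [/andP[/eqP sv rv]|nv] := boolP ((size v == n) && reduced v); last first.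
  exists 0, 0, 0 => N nN; rewrite !mul0r !addr0 /acount big_seq_cond big1// => w.
  rewrite mem_reduced_words => /andP[/andP[/eqP sw rw] /andP[/eqP tw _]].
  case/negP: nv; rewrite -tw size_takel ?sw// eqxx /=; exact: take_sorted.
case/lastP: v sv rv => [|v x]; first by move=> /= e; rewrite -e in n0.
move=> sv rv; pose p y : C := (P y)%:R.
pose s := (\sum_y p y) / (d * 2)%:R.
(* The coefficients of [ecountE], corrected for the shift of the exponent from [N - n] to [N]. *)
exists (s / q%:R ^+ n), ((p x - p (linv x)) / 2), (((p x + p (linv x)) / 2 - s) * (-1) ^+ n).
move=> N nN.
have -> : acount P (rcons v x) n N = ecount p (N - n) x.
  rewrite /acount -big_filter.
  rewrite (perm_big [seq rcons v x ++ w | w <- [seq w <- tails (N - n) x | P (last x w)]]).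
    rewrite big_map big_filter /ecount big_mkcond; apply: eq_bigr => w _.
    by rewrite /p; case: (P _).
  apply: uniq_perm.
  - by rewrite filter_uniq// reduced_words_uniq.
  - rewrite map_inj_uniq; first by rewrite filter_uniq// tails_uniq.
    by move=> a b /eqP; rewrite eqseq_cat// => /andP[_ /eqP].
  move=> w; rewrite mem_filter mem_reduced_words; apply/idP/mapP.
    move=> /andP[/andP[/eqP tw ok] /andP[/eqP sw rw]].
    have wE : w = rcons v x ++ drop n w by rewrite -tw cat_take_drop.
    exists (drop n w) => //; rewrite mem_filter mem_tails size_drop sw eqxx /=.
    move: ok rw; rewrite wE /endok /reduced drop_cat sv ltnn subnn drop0.
    rewrite /nilp size_cat sv addn_eq0 eqn0Ngt n0 /= last_cat last_rcons => -> /=.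
    case: (v) => [|y v'] //=; rewrite cat_path => /andP[_].
    by rewrite last_rcons.
  move=> [a]; rewrite mem_filter mem_tails => /andP[Pa /andP[/eqP sa pa]] ->.
  rewrite take_cat sv ltnn subnn take0 cats0 eqxx /= /endok size_cat sv sa subnKC// eqxx /=.
  rewrite last_cat last_rcons Pa orbT /=.
  move: rv; rewrite /reduced; case: (v) => [|y v'] //=; rewrite cat_path => -> /=.
  by rewrite last_rcons.
have eN (z : C) : z ^+ N = z ^+ (N - n) * z ^+ n by rewrite -exprD subnK.
rewrite ecountE -/s !eN.
have s1 : ((-1) ^+ n * (-1) ^+ n : C) = 1 by rewrite -exprMn mulrNN mulr1 expr1n.
have q1 : q%:R ^+ n != 0 :> C by rewrite expf_neq0// q_neq0.
transitivity (s * q%:R ^+ (N - n) + (p x - p (linv x)) / 2 +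
   ((p x + p (linv x)) / 2 - s) * (-1) ^+ (N - n) * ((-1) ^+ n * (-1) ^+ n)).
  by rewrite s1 mulr1.
by field; rewrite q1.
Qed.

End WordCounting.

(** * Level sets of the minimum and the distance of core length and trail *)

Section LevelSets.
Variables (R : realType) (d : nat) (g : letter d).
Local Notation C := (R[i])^o.
Local Notation letter := (letter d).
Local Notation I := (fgroup d).
Implicit Types (w v : seq letter) (mu : I).
Let q := (d * 2).-1.
Local Notation sep := (sep q).
Local Notation evconst := (@evconst R).

(** Minimum and distance of the coordinates: on each zone core length, trail and height are linear
    in them, and they range independently, up to the diagonal, which is counted in one zone only. *)
Definition ii mu := minn (Nn g mu) (Ll g mu).
Definition mm mu := ((Nn g mu - Ll g mu) + (Ll g mu - Nn g mu))%N.
Definition zone mu := (Ll g mu <= Nn g mu)%N.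
Definition Nof (b : bool) (i m : nat) : nat := if b then (i + m)%N else i.
Definition Lof (b : bool) (i m : nat) : nat := if b then i else (i + m)%N.

Lemma Nn_of mu : Nn g mu = Nof (zone mu) (ii mu) (mm mu).
Proof. by rewrite /Nof /zone /ii /mm; case: leqP; lia. Qed.

Lemma Ll_of mu : Ll g mu = Lof (zone mu) (ii mu) (mm mu).
Proof. by rewrite /Lof /zone /ii /mm; case: leqP; lia. Qed.

Lemma height_of mu : height g mu = (ii mu + (~~ zone mu).+1 * mm mu)%N.
Proof. by rewrite /height /zone /ii /mm; case: leqP; lia. Qed.

(** The length is [2 * ii + mm], hence below [3 * K]. *)
Definition levels K : seq I := [seq mu <- words_le d (3 * K) | (ii mu < K)%N && (mm mu < K)%N].

Lemma levels_uniq K : uniq (levels K). Proof. by rewrite filter_uniq// words_le_uniq. Qed.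

Lemma mem_levels K mu : (mu \in levels K) = (ii mu < K)%N && (mm mu < K)%N.
Proof.
rewrite mem_filter; apply: andb_idr => /andP[h1 h2].
by apply: mem_words_le; rewrite (size_dec g); move: h1 h2; rewrite /ii /mm; lia.
Qed.

Lemma levels_exhaust mu : exists N, forall K, (N <= K)%N -> mu \in levels K.
Proof.
exists (ii mu + mm mu).+1 => K h; rewrite mem_levels.
by apply/andP; split; apply: leq_trans h; rewrite ltnS ?leq_addr ?leq_addl.
Qed.

(** A core never ends in [g], and before a non-empty trail it cannot end in the inverse of [g]
    either; [l0] says that the trail is empty. *)
Definition endpred (l0 : bool) : pred letter :=
  fun y => (y != g) && (l0 || (y != linv g)).

(** The first factor is zero on the diagonal in the zone of long trails, to which it does not
    belong. *)
Definition cnt b v n i m : C := (b || (0 < m)%N)%:R * acount R g (endpred (Lof b i m == 0%N)) v n (Nof b i m).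

Lemma g_linv : g != linv g.
Proof. by case: g => j b; rewrite /linv xpair_eqE eqxx; case: b. Qed.

Lemma reduced_nseq v l : reduced v -> reduced (v ++ nseq l g) =
  [|| l == 0%N, nilp v | last g v != linv g].
Proof.
have hn x k : path (@no_cancel d) x (nseq k g) = (k == 0%N) || (g != linv x).
  elim: k x => //= k IH x; by rewrite IH /no_cancel g_linv orbT andbT.
case: v => [|x v] /= rv.
  by case: l => //= l; rewrite hn g_linv orbT.
rewrite cat_path hn /reduced /= in rv *; rewrite rv /=.
by case: l => //= l; rewrite linv_eq eq_sym.
Qed.

(** The indices [b], [i], [m] determine the trail, so an element of the fibre is the same as its
    core. *)
Lemma fiber_count b v n i m K : (i < K)%N -> (m < K)%N ->
  \sum_(mu <- levels K | [&& ii mu == i, mm mu == m, zone mu == b & take n (core g mu) == v]) 1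
  = cnt b v n i m.
Proof.
move=> iK mK; rewrite /cnt; case: (boolP (b || (0 < m)%N)) => [hb|nb]; last first.
  rewrite mul0r big_pred0// => mu; apply/negbTE; apply: contra nb.
  by move=> /and4P[_ /eqP <- /eqP <- _]; rewrite /zone /mm; case: leqP => //=; lia.
pose l := Lof b i m.
pose Q mu := [&& ii mu == i, mm mu == m, zone mu == b & take n (core g mu) == v].
pose s := [seq w <- reduced_words d (Nof b i m) | (take n w == v) && endok g (endpred (l == 0%N)) w].
have LQ mu : Q mu -> Ll g mu = l /\ Nn g mu = Nof b i m.
  by move=> /and4P[/eqP h1 /eqP h2 /eqP h3 _]; rewrite Nn_of Ll_of h1 h2 h3.
transitivity (\sum_(w <- [seq core g (fword mu) | mu <- [seq mu <- levels K | Q mu]]) (1 : C)).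
  by rewrite big_map big_filter.
rewrite mul1r; transitivity (\sum_(w <- s) (1 : C)); last by rewrite big_filter.
apply: perm_big; apply: uniq_perm.
- rewrite map_inj_in_uniq; first by rewrite filter_uniq// levels_uniq.
  move=> mu nu; rewrite !mem_filter => /andP[/LQ[h1 h2] _] /andP[/LQ[h3 h4] _] e.
  by apply: (@core_trail_inj _ g); rewrite /dec e -/(Ll g mu) -/(Ll g nu) h1 h3.
- by rewrite filter_uniq// reduced_words_uniq.
move=> w; rewrite mem_filter mem_reduced_words; apply/mapP/idP.
  move=> [mu]; rewrite mem_filter => /andP[Qm _] ->; have [h1 h2] := LQ _ Qm.
  have /and4P[_ _ _ tv] := Qm.
  have sN : size (core g mu) == Nof b i m by rewrite -h2.
  rewrite tv sN core_reduced /= andbT.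
  rewrite /endok; case: (boolP (nilp (core g mu))) => //= nn.
  have := core_coreless g mu; rewrite /coreless (negPf nn) /= /endpred -/l -h1 => -> /=.
  have := valP mu; rewrite /= {1}(core_cat g mu) reduced_nseq ?core_reduced//.
  by rewrite (negPf nn).
move=> /andP[/andP[tw ok] /andP[/eqP sw rw]].
have cw : coreless g w.
  by move: ok; rewrite /endok /coreless; case: (nilp w) => //= /andP[].
have rw' : reduced (w ++ nseq l g).
  rewrite reduced_nseq//; move: ok; rewrite /endok /endpred -/l.
  by case: (nilp w); rewrite ?orbT//= => /andP[_].
have hN : Nn g (Fgroup rw') = Nof b i m by rewrite /Nn /= core_eq.
have hL : Ll g (Fgroup rw') = l by rewrite /Ll /= trail_eq.
have [h1 h2 h3] : [/\ ii (Fgroup rw') = i, mm (Fgroup rw') = m & zone (Fgroup rw') = b].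
  rewrite /ii /mm /zone hN hL /l /Nof /Lof; case: (b) hb => /= hb; split; lia.
exists (Fgroup rw'); last by rewrite /= core_eq.
rewrite mem_filter mem_levels h1 h2 iK mK andbT /Q h1 h2 h3 !eqxx /=.
by rewrite core_eq// tw.
Qed.

Lemma levels_sum b v n (kap : nat -> nat -> C) (F : I -> C) K :
  (forall mu, F mu = if (zone mu == b) && (take n (core g mu) == v) then kap (ii mu) (mm mu) else 0) ->
  \sum_(mu <- levels K) F mu = \sum_(i < K) \sum_(m < K) cnt b v n i m * kap i m.
Proof.
move=> hF.
transitivity (\sum_(mu <- levels K) \sum_(i < K) \sum_(m < K)
    (if [&& ii mu == i, mm mu == m, zone mu == b & take n (core g mu) == v] then kap i m else 0)).
  rewrite big_seq [RHS]big_seq; apply: eq_bigr => mu; rewrite mem_levels => /andP[hi hm].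
  rewrite (bigD1 (Ordinal hi))//= [X in _ = _ + X]big1 ?addr0 => [|i ni]; last first.
    apply: big1 => m _; rewrite ifF//; apply/negbTE; rewrite negb_and.
    by apply/orP; left; apply: contra ni => /eqP e; apply/eqP/val_inj; rewrite /= e.
  rewrite (bigD1 (Ordinal hm))//= [X in _ = _ + X]big1 ?addr0 => [|m nm]; last first.
    rewrite ifF//; apply/negbTE; rewrite eqxx /= negb_and.
    by apply/orP; left; apply: contra nm => /eqP e; apply/eqP/val_inj; rewrite /= e.
  by rewrite hF !eqxx.
rewrite exchange_big/=; apply: eq_bigr => i _; rewrite exchange_big/=; apply: eq_bigr => m _.
rewrite -(@fiber_count b v n i m K)// mulr_suml [RHS]big_mkcond/=; apply: eq_bigr => mu _.
by case: ifP; rewrite ?mul1r.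
Qed.

Let one : bool * bool * int := (false, false, 0).
Let qq : bool * bool * int := (false, true, 0).
Let mo : bool * bool * int := (true, false, 0).

Lemma bexp_one i : bexp R q one ^+ i = 1.
Proof. by rewrite /bexp /rate /= expr0 mul1r expR0 mulr1 expr1n. Qed.

Lemma evexp_bexp (A : nat -> C) : evexp d A -> exists n r c0 c1 c2,
  (forall N, (n <= N)%N -> r N = 0) /\ forall N,
  A N = c0 * bexp R q qq ^+ N + c1 * bexp R q one ^+ N + c2 * bexp R q mo ^+ N + r N.
Proof.
move=> [n [c0 [c1 [c2 hA]]]].
have eq1 i : bexp R q qq ^+ i = q%:R ^+ i.
  by rewrite /bexp /rate /= expR0 expr0 mul1r mulr1 expr1 rmorph_nat.
have em i : bexp R q mo ^+ i = (-1) ^+ i.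
  by rewrite /bexp /rate /= expR0 expr1 expr0 mulr1 mulN1r.
exists n, (fun N => A N - (c0 * q%:R ^+ N + c1 + c2 * (-1) ^+ N)), c0, c1, c2.
split=> N; first by move=> /hA ->; rewrite subrr.
by rewrite bexp_one eq1 em; ring.
Qed.

Lemma evexp_sum_sep (A : nat -> C) : evexp d A -> sep (fun i m => A (i + m)%N).
Proof.
move=> /evexp_bexp[n [r [c0 [c1 [c2 [r0 hA]]]]]].
have S1 := sep1 q qq qq (evconst_cst c0) (evconst_cst 1).
have S2 := sep1 q one one (evconst_cst c1) (evconst_cst 1).
have S3 := sep1 q mo mo (evconst_cst c2) (evconst_cst 1).
(* The remainder vanishes from [n] on, so it is a finite sum of products of point masses. *)
have S4 : sep (fun i m => r (i + m)%N).
  exists ('I_n * 'I_n)%type, (fun (j : 'I_n * 'I_n) (i : nat) => (i == j.1 :> nat)%:R * r (j.1 + j.2)%N),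
    (fun (j : 'I_n * 'I_n) (m : nat) => (m == j.2 :> nat)%:R), (fun=> one), (fun=> one); split.
  - move=> [[j hj] j']; apply: (@evconst_fin _ _ n) => i ni /=.
    by rewrite (gtn_eqF (leq_trans hj ni)) mul0r.
  - move=> [j' [j hj]]; apply: (@evconst_fin _ _ n) => i ni /=.
    by rewrite (gtn_eqF (leq_trans hj ni)).
  - move=> i m; under eq_bigr do rewrite !bexp_one !mulr1.
    case: (ltnP i n) => hi; last first.
      rewrite r0 ?big1//; last by apply: leq_trans hi _; exact: leq_addr.
      by move=> [[j hj] j'] _ /=; rewrite (gtn_eqF (leq_trans hj hi)) !mul0r.
    case: (ltnP m n) => hm; last first.
      rewrite r0 ?big1//; last by apply: leq_trans hm _; exact: leq_addl.
      by move=> [j' [j hj]] _ /=; rewrite (gtn_eqF (leq_trans hj hm)) mulr0.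
    rewrite (bigD1 (Ordinal hi, Ordinal hm))//= !eqxx mul1r mulr1 big1 ?addr0//.
    move=> [j j'] /=; rewrite xpair_eqE negb_and => /orP[] h.
      by rewrite (_ : (i == j) = false) ?mul0r//; apply/negbTE; apply: contra h => /eqP e; apply/eqP/val_inj.
    by rewrite (_ : (m == j') = false) ?mulr0//; apply/negbTE; apply: contra h => /eqP e; apply/eqP/val_inj.
apply: sep_ext (sepD (sepD (sepD S1 S2) S3) S4) => i m.
by rewrite hA !exprD; ring.
Qed.

Lemma evexp_sep (A : nat -> C) : evexp d A -> sep (fun i _ => A i).
Proof.
move=> /evexp_bexp[n [r [c0 [c1 [c2 [r0 hA]]]]]].
have S1 := sep1 q qq one (evconst_cst c0) (evconst_cst 1).
have S2 := sep1 q one one (evconst_cst c1) (evconst_cst 1).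
have S3 := sep1 q mo one (evconst_cst c2) (evconst_cst 1).
have S4 := sep1 q one one (@evconst_fin _ r n r0) (evconst_cst 1).
apply: sep_ext (sepD (sepD (sepD S1 S2) S3) S4) => i m.
by rewrite hA !bexp_one; ring.
Qed.

Lemma evconst_ge1 : evconst (fun m => (0 < m)%N%:R).
Proof. by exists 1%N, 1 => -[]. Qed.

Lemma evconst_eq0 : evconst (fun m => (m == 0%N)%:R).
Proof. by exists 1%N, 0 => -[]. Qed.

Hypothesis d0 : (0 < d)%N.

Lemma cnt_sep b v n : (0 < n)%N -> sep (cnt b v n).
Proof.
move=> n0; have hA P := acount_evexp R g d0 P v n0.
case: b.
  (* In this zone the trail is [i], so only [i = 0] allows the core to end in the inverse of [g]. *)
  have S0 := sepM evconst_eq0 (evconst_cst 1) (evexp_sum_sep (hA (endpred true))).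
  have S1 := sepM evconst_ge1 (evconst_cst 1) (evexp_sum_sep (hA (endpred false))).
  apply: sep_ext (sepD S0 S1) => i m; rewrite /cnt /Lof /Nof /= mul1r.
  by case: i => [|i] /=; rewrite ?mul1r ?mul0r ?add0r ?addr0.
(* In this zone the core length is [i] alone, and the trail [i + m] is never empty because [m] is
   positive. *)
have S1 := sepM (evconst_cst 1) evconst_ge1 (evexp_sep (hA (endpred false))).
apply: sep_ext S1 => i m; rewrite /cnt /Lof /Nof /= mul1r.
by case: m => [|m] /=; rewrite ?mul0r// addnS.
Qed.

End LevelSets.

(** * Convergence and continuation of the zeta functions *)

Section ZetaFunctions.
Variables (R : realType) (d : nat) (g : letter d).
Hypothesis d1 : (1 < d)%N.
Local Notation C := (R[i])^o.
Local Notation letter := (letter d).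
Local Notation I := (fgroup d).
Local Notation hgt := (height g).
Implicit Types (f : I -> C) (mu : I).
Let q := (d * 2).-1.
Let d0 : (0 < d)%N := ltnW d1.

(** There are at most [Q ^ k] elements of height [k], and [exp s >= 2 Q] makes the sum over heights
    smaller than a geometric series of ratio 1/2. *)
Lemma exp_height_sum (s : R) (X : seq I) : uniq X -> (2 * (d * 2).+1 ^ 2)%:R <= s ->
  \sum_(mu <- X) expR (- (s * (hgt mu)%:R)) <= 2.
Proof.
move=> uX; set Q := ((d * 2).+1 ^ 2)%N => hs.
have Q0 : (0 < Q)%N by rewrite expn_gt0.
have r2 : Q%:R * expR (- s) <= 1 / 2 :> R.
  rewrite expRN ler_pdivrMr ?expR_gt0//.
  have : (2 * Q)%:R <= expR s :> R.
    by apply: le_trans (expR_ge1Dx _); apply: le_trans hs _; rewrite lerDr.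
  by rewrite natrM; lra.
pose K := (\max_(mu <- X) hgt mu).+1.
have hK mu : mu \in X -> (hgt mu < K)%N by move=> muX; rewrite /K ltnS; exact: leq_bigmax_seq.
apply: (@le_trans _ _ (\sum_(k < K) (1 / 2) ^+ k)); last first.
  suff -> : \sum_(k < K) (1 / 2) ^+ k = 2 - 2 * (1 / 2) ^+ K :> R.
    by rewrite gerBl mulr_ge0// exprn_ge0.
  elim: (K) => [|n IH]; first by rewrite big_ord0 expr0; ring.
  by rewrite big_ord_recr /= IH exprS; field.
have -> : \sum_(mu <- X) expR (- (s * (hgt mu)%:R)) =
    \sum_(k < K) \sum_(mu <- X | hgt mu == k) expR (- (s * k%:R)).
  transitivity (\sum_(mu <- X) \sum_(k < K) (if hgt mu == k then expR (- (s * k%:R)) else 0)).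
    rewrite big_seq [RHS]big_seq; apply: eq_bigr => mu /hK h.
    rewrite (bigD1 (Ordinal h))//= eqxx big1 ?addr0// => k nk.
    by rewrite ifF//; apply/negbTE; apply: contra nk => /eqP e; apply/eqP/val_inj; rewrite /= e.
  by rewrite exchange_big; apply: eq_bigr => k _; rewrite [RHS]big_mkcond.
apply: ler_sum => k _; rewrite -big_filter big_const_seq count_predT iter_addr_0.
have [Y [uY sY hY]] := height_growth_fgroup g k.
have sz : (size [seq mu <- X | hgt mu == k] <= Q ^ k)%N.
  apply: leq_trans sY; apply: uniq_leq_size; first by rewrite filter_uniq.
  by move=> mu; rewrite mem_filter => /andP[/eqP e _]; apply: hY; rewrite e.
apply: (@le_trans _ _ (expR (- (s * k%:R)) *+ (Q ^ k))); first by rewrite -[leLHS]mulr_natl -[leRHS]mulr_natl ler_wpM2r ?expR_ge0// ler_nat.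
have -> : expR (- (s * k%:R)) *+ (Q ^ k) = (Q%:R * expR (- s)) ^+ k.
  by rewrite -[LHS]mulr_natl natrX exprMn -expRM_natr mulNr.
by rewrite lerXn2r ?nnegrE ?mulr_ge0 ?expR_ge0.
Qed.

Lemma csummable_zeta f (M : R) (m : nat) : 0 <= M ->
  (forall mu, modulus (f mu) <= M * expR (m%:R * (hgt mu)%:R)) ->
  forall z : C, (2 * (d * 2).+1 ^ 2)%:R + m%:R <= complex.Re z ->
  csummable (fun mu => f mu * Ee z ^+ hgt mu).
Proof.
move=> M0 hf z hz; apply: (@csummable_bound _ _ _ (M * 2)) => X uX.
have hz0 : 0 <= complex.Re z by apply: le_trans hz; rewrite addr_ge0.
have hs : (2 * (d * 2).+1 ^ 2)%:R <= 2 * complex.Re z - m%:R.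
  by move: hz; set A := _%:R; set m' := m%:R => hz; lra.
apply: le_trans (_ : _ <= M * \sum_(mu <- X) expR (- ((2 * complex.Re z - m%:R) * (hgt mu)%:R))) _.
  rewrite mulr_sumr; apply: ler_sum => mu _.
  rewrite modulusM modulusX modulus_Ee -expRM_natr.
  apply: le_trans (ler_wpM2r (expR_ge0 _) (hf mu)) _.
  by rewrite -mulrA -expRD ler_wpM2l// ler_expR; lra.
by rewrite ler_wpM2l// exp_height_sum.
Qed.

Definition has_zeta f :=
  zlim q 4 (fun z K => \sum_(mu <- levels g K) f mu * Ee z ^+ hgt mu).

Lemma has_zeta_ext f h : (forall mu, f mu = h mu) -> has_zeta f -> has_zeta h.
Proof. by move=> /funext ->. Qed.

Lemma has_zeta0 : has_zeta (fun=> 0).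
Proof. by apply: zlim_ext (zlim_cst q 4 (0 : C)) => z K; rewrite big1// => mu _; rewrite mul0r. Qed.

Lemma has_zetaZ (c : C) f : has_zeta f -> has_zeta (fun mu => c * f mu).
Proof.
move=> /(zlimM (zlim_cst q 0 (c : C))); apply: zlim_ext => z K.
by rewrite mulr_sumr; apply: eq_bigr => mu _; rewrite mulrA.
Qed.

Lemma has_zeta_sum (J : Type) (s : seq J) (F : J -> I -> C) : (forall j, has_zeta (F j)) ->
  has_zeta (fun mu => \sum_(j <- s) F j mu).
Proof.
move=> /(zlim_sum s); apply: zlim_ext => z K.
by rewrite exchange_big; apply: eq_bigr => mu _; rewrite mulr_suml.
Qed.

Lemma evconst_minn n a : evconst (fun i => (minn i n == a)%:R : C).
Proof. by exists n, (n == a)%:R => i ni; rewrite (minn_idPr ni). Qed.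

Lemma has_zeta_cell n c (k j : int) : (0 < n)%N ->
  has_zeta (fun mu => if cell n (dec g mu) == c then (expmon R k j (Nn g mu) (Ll g mu))%:C else 0).
Proof.
move=> n0; case: c => [[[v b] a] m0].
(* The truncated coordinates of the cell become eventually constant weights, and [k * Nn + j * Ll]
   is rewritten in the indices [i] and [m]. *)
pose kap := (fun i m => (minn i n == a)%:R * (minn m n == m0)%:R * cnt R g b v n i m *
  (expR ((k + j)%:~R * i%:R + (if b then k else j)%:~R * m%:R))%:C : C).
have skap : sep q kap.
  by apply: sep_exp; apply: sepM; [exact: evconst_minn|exact: evconst_minn|exact: cnt_sep].
have q0 : (0 < q)%N by rewrite /q; move: d1; lia.
apply: zlim_ext (zlim_sep q0 (~~ b) skap) => z K; symmetry.
rewrite (@levels_sum R d g b v n (fun i m => (minn i n == a)%:R * (minn m n == m0)%:R *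
  (expR ((k + j)%:~R * i%:R + (if b then k else j)%:~R * m%:R))%:C * Ee z ^+ (i + (~~ b).+1 * m))).
  by apply: eq_bigr => i _; apply: eq_bigr => m _; rewrite /kap; ring.
move=> mu; rewrite /cell /= !xpair_eqE -/(Nn g mu) -/(Ll g mu) -/(zone g mu) -/(ii g mu) -/(mm g mu).
case: eqVneq => [tv|_] /=; last by rewrite andbF mul0r.
case: eqVneq => [zb|_] /=; last by rewrite mul0r.
case: eqVneq => [_|_] /=; last by rewrite !mul0r.
case: eqVneq => [_|_] /=; last by rewrite mul0r mulr0 !mul0r.
rewrite !mul1r -zb -height_of.
suff -> : expmon R k j (Nn g mu) (Ll g mu) = expR ((k + j)%:~R * (ii g mu)%:R +
  (if zone g mu then k else j)%:~R * (mm g mu)%:R) by [].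
rewrite /expmon Nn_of Ll_of; congr expR.
by rewrite /Nof /Lof rmorphD/=; case: (zone g mu); rewrite natrD; ring.
Qed.

Lemma FF_has_zeta f : FF g f -> has_zeta f.
Proof.
move=> [n' hf']; have hf := pwexp_mono (leqnSn n') hf'; set n := n'.+1 in hf.
pose cs := undup (cells d n).
have fE mu : f mu = \sum_(c <- cs) (if cell n (dec g mu) == c then f mu else 0).
  have hc : cell n (dec g mu) \in cs by rewrite mem_undup mem_cells.
  rewrite (big_rem _ hc)/= eqxx big_seq big1 ?addr0// => c.
  rewrite (mem_rem_uniq _ (undup_uniq _)) !inE => /andP[/negPf e _].
  by rewrite eq_sym e.
apply: (@has_zeta_ext (fun mu => \sum_(c <- cs) (if cell n (dec g mu) == c then f mu else 0))).
  by move=> mu; rewrite -fE.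
apply: has_zeta_sum => c.
have [[nu e]|nc] := pselect (exists nu, cell n (dec g nu) = c); last first.
  apply: has_zeta_ext has_zeta0 => mu; case: eqP => // e; by case: nc; exists mu.
have [P [s hs] hP] := hf nu.
apply: (@has_zeta_ext (fun mu => \sum_(x <- s) x.1 * (if cell n (dec g mu) == c then
   (expmon R x.2.1 x.2.2 (Nn g mu) (Ll g mu))%:C else 0))).
  move=> mu; case: eqP => [emu|_].
    by rewrite hP ?e// hs.
  by rewrite big1// => x _; rewrite mulr0.
by apply: has_zeta_sum => x; apply: has_zetaZ; exact: has_zeta_cell.
Qed.

(** Exponential growth of [f] gives absolute convergence far to the right, and there the sum equals
    the limit along [levels]. *)
Lemma FF_zeta f : FF g f -> exists2 Z : C -> C, mero q 4 Z & exists x0 : R,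
  forall z, x0 < complex.Re z -> csummable (fun mu => f mu * Ee z ^+ hgt mu) /\
    csum (fun mu => f mu * Ee z ^+ hgt mu) = Z z.
Proof.
move=> hf; have [Z mZ [x hx]] := FF_has_zeta hf; exists Z => //.
have [M [m [M0 hM]]] := FF_growth hf.
exists (Num.max x ((2 * (d * 2).+1 ^ 2)%:R + m%:R)) => z; rewrite gt_max => /andP[/hx h1 h2].
have cs := csummable_zeta M0 hM (ltW h2); split => //.
have h3 := hassum_exhaust (csummableP cs) (levels_uniq g) (levels_exhaust g).
exact: (@norm_cvg_unique _ _ _ _ _ _ h3 h1).
Qed.

End ZetaFunctions.

(** * The spectral triple of a fixed point *)

Section FixedPoint.
Variables (R : realType) (d : nat) (t : boundary d).
Hypothesis ht : shift_map t = t.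
Local Notation C := (R[i])^o.
Local Notation I := (fgroup d).
Local Notation H := (ell2 R I).
Local Notation w := (D_af R t).
Let g := linv (t 0%N).
Local Notation hgt := (height g).
Local Notation FF := (@FF R d g).
Local Notation sigma := (twist w 1).
Local Notation A0 := (@crossed_product R d t).
Local Notation A := (saturation w A0).
Local Notation Hoo := (H_infty w).
Local Notation B := (is_band (@bounded_fun R d) setT).
Implicit Types (f h : I -> C) (x y : H) (gam mu : I) (S T : H -> H).

Lemma fixed_const n : t n = t 0%N.
Proof. by elim: n => // n <-; rewrite -{2}ht. Qed.

Lemma ell_trail (mu : I) : ell mu t = Ll g mu.
Proof.
have key (f : nat -> letter d) r : (forall n, f n = t 0%N) ->
    cancellations r f = find (fun l => l != g) r.
  elim: r f => //= x r IH f hf; rewrite hf linv_eq -/g; case: eqVneq => //= _.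
  by rewrite IH.
rewrite /ell key; last exact: fixed_const.
rewrite {1}(core_cat g mu) rev_cat /Ll; have := core_coreless g mu.
move: (core g mu) (trail g mu) => v k cv.
have -> : rev (nseq k g) = nseq k g.
  by apply: (@eq_from_nth _ g); rewrite size_rev// size_nseq => i ik; rewrite nth_rev size_nseq// !nth_nseq; do 2 case: ifP.
elim: k => [|k IH] /=; last by rewrite eqxx /= IH.
case/lastP: v cv => [|v x] //; rewrite rev_rcons /coreless last_rcons /=.
by rewrite /nilp size_rcons /= => ->.
Qed.

Lemma foldr_bcons_fixed (v : seq (letter d)) i : reduced v -> coreless g v ->
  foldr (@bcons d) t v i = nth (t 0%N) v i.
Proof.
elim: v i => [|x v IH] i /=; first by rewrite nth_nil => _ _; exact: fixed_const.
move=> rv cv; rewrite /bcons_fun.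
have rv' : reduced v by exact: path_sorted rv.
have cv' : coreless g v by move: cv; rewrite /coreless /=; case: (v).
rewrite IH// ifF; first by case: i => //= i; rewrite IH.
case: v rv cv {IH rv' cv'} => [|y v] /=.
  by rewrite /coreless /= => _ /negPf xg; rewrite linv_eq -/g.
by rewrite /no_cancel => /andP[/negPf ->].
Qed.

(** The trail fixes [t], so the boundary point is the core followed by [t]; locally constant
    functions then see only the beginning of the core. *)
Lemma bact_fixed (mu : I) i : bact mu t i = nth (t 0%N) (core g mu) i.
Proof.
rewrite -foldr_bcons_fixed; [|exact: core_reduced|exact: core_coreless].
rewrite /bact {1}(core_cat g mu) foldr_cat.
have -> // : foldr (@bcons d) t (nseq (trail g mu) g) = t.
elim: (trail g mu) => //= k ->; apply: boundaryP => n.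
by rewrite bconsE /bcons_fun /g linvK eqxx !fixed_const.
Qed.

Definition sgn (mu : I) : R := if Ll g mu == 0%N then 1 else -1.

Lemma D_afE (mu : I) : D_af R t mu = sgn mu * expR (height g mu)%:R.
Proof.
rewrite /D_af ell_trail (size_dec g) /sgn; congr (_ * expR _).
  by case: eqP => _; rewrite ?mulr1 ?mulr0 /=; ring.
rewrite /height natrD; move: (Nn g mu) (Ll g mu) => N L.
case: (leqP L N) => h.
  have -> : maxn N (2 * L - N) = N by lia.
  rewrite ger0_norm; first by ring.
  have : (L%:R <= N%:R :> R) by rewrite ler_nat.
  by move: (L%:R : R) (N%:R : R) => l n nl; lra.
have -> : maxn N (2 * L - N) = (2 * L - N)%N by lia.
have NL2 : (N <= 2 * L)%N by lia.
rewrite (natrB _ NL2).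
have : (N%:R <= L%:R :> R) by rewrite ler_nat ltnW.
by rewrite natrM; move: (L%:R : R) (N%:R : R) => l n nl; rewrite ler0_norm; [ring|lra].
Qed.

Lemma abs_D_af (mu : I) : `|D_af R t mu| = expR (height g mu)%:R.
Proof.
rewrite D_afE normrM (ger0_norm (expR_ge0 _)) /sgn.
by case: ifP; rewrite ?normrN normr1 mul1r.
Qed.

Lemma FF_sgn : FF (fun mu : I => (sgn mu)%:C : C).
Proof.
apply: (@FF_cell _ _ _ _ 1) => mu nu [h1 h2 h3 h4]; rewrite /sgn; congr _%:C.
have -> // : (Ll g mu == 0%N) = (Ll g nu == 0%N).
by move: h2 h3 h4; rewrite -!/(Nn _ _) -!/(Ll _ _); lia.
Qed.

Lemma locally_constant_cell (a : boundary d -> C) : locally_constant a ->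
  exists n, forall mu nu : I, cell n (dec g mu) = cell n (dec g nu) ->
    a (bact mu t) = a (bact nu t).
Proof.
move=> /locally_constant_uniform[n hn]; exists n => mu nu [h1 h2 h3 h4].
apply: hn => i iN; rewrite !(bact_fixed) -/g.
have sE : minn (size (core g mu)) n = minn (size (core g nu)) n.
  by move/(congr1 size): h1; rewrite !size_take_min /=; lia.
case: (ltnP i (size (core g mu))) => hi.
  by rewrite -(nth_take _ iN) -[RHS](nth_take _ iN) h1.
rewrite nth_default// nth_default//; lia.
Qed.

Lemma FF_locally_constant (a : boundary d -> C) : locally_constant a ->
  FF (fun mu : I => a (bact mu t)).
Proof. by move=> /locally_constant_cell[n h]; apply: (@FF_cell _ _ _ _ n). Qed.

Lemma locally_constant_bounded (a : boundary d -> C) : locally_constant a ->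
  exists M : R, forall mu : I, modulus (a (bact mu t)) <= M.
Proof.
by move=> /locally_constant_cell[n h]; exact: (@cell_fun_bounded _ _ g (fun mu => a (bact mu t)) n).
Qed.

(** * Powers of |D| and the twist on bands *)

Definition wt (k : int) mu : R := expR (k%:~R * (hgt mu)%:R).

Lemma wt_gt0 k mu : 0 < wt k mu. Proof. exact: expR_gt0. Qed.

Lemma wtM k l mu : wt k mu * wt l mu = wt (k + l) mu.
Proof. by rewrite /wt -expRD -mulrDl rmorphD. Qed.

Lemma wt0 mu : wt 0 mu = 1. Proof. by rewrite /wt mul0r expR0. Qed.

Lemma wtMN k mu : wt k mu * wt (- k) mu = 1.
Proof. by rewrite wtM subrr wt0. Qed.

Lemma modulus_wt k mu : modulus (wt k mu)%:C = wt k mu.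
Proof. by rewrite modulus_real ger0_norm// ltW// wt_gt0. Qed.

Lemma wtE k mu : `|w mu| ^ k = wt k mu.
Proof.
rewrite abs_D_af// -/g /wt; case: k => n; first by rewrite -exprnP expRM_natl.
rewrite NegzE -exprnN rmorphN mulNr expRN; congr (_^-1).
by rewrite expRM_natl.
Qed.

Lemma w_wt mu : w mu = sgn mu * wt 1 mu.
Proof. by rewrite D_afE// /wt mul1r. Qed.

Lemma modulus_sgn mu : modulus (sgn mu)%:C = 1.
Proof. by rewrite modulus_real /sgn; case: ifP; rewrite ?normrN normr1. Qed.

Lemma dom_absDE k x :
  dom_absD w k x <-> (fun mu => (wt k mu)%:C * x mu) \in @square_summable R I.
Proof.
rewrite /dom_absD /fdom /diag_dom/= (_ : diag_fun _ x = (fun mu => (wt k mu)%:C * x mu))//.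
by apply/funext => mu; rewrite /diag_fun wtE.
Qed.

Lemma dom_absD_ss k x : dom_absD w k x ->
  (fun mu => (wt k mu)%:C * x mu) \in @square_summable R I.
Proof. by have [h _] := dom_absDE k x. Qed.

Lemma ss_dom_absD k x : (fun mu => (wt k mu)%:C * x mu) \in @square_summable R I ->
  dom_absD w k x.
Proof. by have [_ h] := dom_absDE k x. Qed.

Lemma absDE k x mu : dom_absD w k x -> absD w k x mu = (wt k mu)%:C * x mu.
Proof. by move=> h; rewrite /absD /fcalc diagE// wtE. Qed.

Lemma domDE x : domD w x <-> dom_absD w 1 x.
Proof.
rewrite dom_absDE; split=> h.
  apply: (@square_summable_dom _ _ _ (Ell2 h) 1) => mu.
  by rewrite mul1r /diag_fun/= !modulusM w_wt rmorphM modulusM modulus_sgn mul1r.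
apply: (@square_summable_dom _ _ _ (Ell2 h) 1) => mu.
by rewrite mul1r /diag_fun/= !modulusM w_wt rmorphM modulusM modulus_sgn mul1r.
Qed.

Lemma DopE x mu : domD w x -> Dop w x mu = (w mu)%:C * x mu.
Proof. exact: diagE. Qed.

(** The height is Lipschitz under translation. This is what makes the twist of a band bounded. *)
Lemma wt_translate k gam : exists M : R, forall mu,
  wt k mu <= M * wt k (gam * mu)%g.
Proof.
exists (expR (`|k|%:~R * (3 * size gam)%:R)) => mu; rewrite /wt -expRD ler_expR.
have [h1 h2] := height_lipschitz g gam mu.
have {}h1 : (hgt (gam * mu)%g)%:R <= (hgt mu)%:R + (3 * size gam)%:R :> R.
  by rewrite -natrD ler_nat.
have {}h2 : (hgt mu)%:R <= (hgt (gam * mu)%g)%:R + (3 * size gam)%:R :> R.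
  by rewrite -natrD ler_nat.
move: ((hgt mu)%:R : R) ((hgt (gam * mu)%g)%:R : R) ((3 * size gam)%:R : R) h1 h2 => a b c h1 h2.
have k0 : 0 <= `|k|%:~R :> R by rewrite intr_norm.
have k1 : - `|k|%:~R <= k%:~R :> R by rewrite intr_norm lerNl -normrN ler_norm.
have k2 : k%:~R <= `|k|%:~R :> R by rewrite intr_norm ler_norm.
by move: (k%:~R : R) (`|k|%:~R : R) k0 k1 k2 => r s ? ? ?; nra.
Qed.

Definition growth f := exists (M : R) (m : nat), forall mu, modulus (f mu) <= M * wt m mu.

Lemma bounded_growth f : bounded_fun f -> growth f.
Proof. by move=> [M hM]; exists M, 0%N => mu; rewrite wt0 mulr1. Qed.

Lemma H_infty_wt x k : H_infty w x -> (fun mu => (wt k mu)%:C * x mu) \in @square_summable R I.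
Proof. by move=> hx; exact: dom_absD_ss (hx k). Qed.

Lemma finsupp_dense_H_infty : finsupp_dense (H_infty w).
Proof.
have h k := diag_dom_finsupp (fun mu => (`|w mu| ^ k)%:C : C).
by split => [k|c x y hx hy k|i k]; have [h1 h2 h3] := h k; [exact: h1|exact: (h2 c x y (hx k) (hy k))|exact: h3].
Qed.

Lemma dense_sub (U V : set H) : U `<=` V -> dense_set U -> dense_set V.
Proof. by move=> UV dU x e e0; have [y /UV Vy hy] := dU x e e0; exists y. Qed.

Lemma dense_H_infty : dense_set (H_infty w).
Proof. exact: dense_finsupp finsupp_dense_H_infty. Qed.

Lemma band_dom_absD k l (J : finType) (f : J -> I -> C) (gam : J -> I) (y x : H) :
  (forall j, exists M : R, forall mu, modulus (f j mu) <= M * wt l mu) ->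
  (forall mu, y mu = \sum_j f j mu * x (gam j * mu)%g) ->
  dom_absD w (l + k) x -> dom_absD w k y.
Proof.
move=> hf yE /dom_absD_ss hx; apply: ss_dom_absD.
rewrite (_ : (fun=> _) = \sum_j (fun mu => (wt k mu)%:C * (f j mu * x (gam j * mu)%g))).
  rewrite rpred_sum// => j _; have [M hM] := hf j.
  have [N hN] := wt_translate (l + k) (gam j).
  have hxj := square_summable_reindex (Ell2 hx) (mulKg (gam j)).
  apply: (@square_summable_dom _ _ _ (Ell2 hxj) (`|M| * N)) => mu.
  rewrite !modulusM !modulus_wt mulrA -[X in _ <= X]mulrA [N * _]mulrA.
  rewrite [leRHS]mulrA ler_wpM2r ?modulus_ge0//.
  apply: (@le_trans _ _ (wt k mu * (`|M| * wt l mu))).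
    rewrite ler_wpM2l ?(ltW (wt_gt0 _ _))//; apply: le_trans (hM mu) _.
    by rewrite ler_wpM2r ?(ltW (wt_gt0 _ _))// ler_norm.
  by rewrite mulrCA wtM [k + l]addrC ler_wpM2l.
by apply/funext => mu; rewrite yE mulr_sumr fct_sumE.
Qed.

Lemma is_band_dom_absD K U k T x : K `<=` @bounded_fun R d -> is_band K U T -> U x ->
  dom_absD w k x -> dom_absD w k (T x).
Proof.
move=> Kb [J [f [gam [hf hT]]]] Ux hx.
apply: (@band_dom_absD k 0 J f gam _ x); last by rewrite add0r.
  by move=> j; have [M hM] := Kb _ (hf j); exists M => mu; rewrite wt0 mulr1.
by move=> mu; exact: hT.
Qed.

Lemma is_band_H_infty K T x : K `<=` growth -> is_band K (H_infty w) T ->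
  H_infty w x -> H_infty w (T x).
Proof.
move=> Kg [J [f [gam [hf hT]]]] hx k.
have [m hm] : exists m : nat, forall j, exists M : R, forall mu, modulus (f j mu) <= M * wt m mu.
  have /choice [m hm] j : exists m : nat, exists M : R, forall mu, modulus (f j mu) <= M * wt m mu.
    by have [M [m h]] := Kg _ (hf j); exists m, M.
  exists (\max_j m j) => j; have [M hM] := hm j; exists `|M| => mu.
  apply: le_trans (hM mu) _; apply: (@le_trans _ _ (`|M| * wt (m j) mu)).
    by rewrite ler_wpM2r ?(ltW (wt_gt0 _ _))// ler_norm.
  by rewrite ler_wpM2l// ler_expR ler_wpM2r// ler_int lez_nat leq_bigmax.
by apply: (@band_dom_absD k m J f gam _ x) => // mu; exact: hT.
Qed.

Lemma H_infty_absD k x : H_infty w x -> H_infty w (absD w k x).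
Proof.
move=> hx l; apply: ss_dom_absD; have := H_infty_wt (l + k) hx.
rewrite (_ : (fun=> _) = (fun mu => (wt l mu)%:C * absD w k x mu))//.
by apply/funext => mu; rewrite absDE// mulrA -rmorphM wtM.
Qed.

(* The coefficients of |D|^k (f λ) |D|^-k. *)
Definition twist_coef k gam f : I -> C := fun mu => (wt k mu * wt (- k) (gam * mu)%g)%:C * f mu.

Lemma bounded_twist_coef k gam f : bounded_fun f -> bounded_fun (twist_coef k gam f).
Proof.
move=> [M hM]; have [N hN] := wt_translate k gam.
exists (`|N| * M) => mu; rewrite modulusM ler_pM ?modulus_ge0//.
rewrite modulus_real ger0_norm ?mulr_ge0 ?(ltW (wt_gt0 _ _))//.
apply: (@le_trans _ _ (N * wt k (gam * mu)%g * wt (- k) (gam * mu)%g)).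
  by rewrite ler_wpM2r ?(ltW (wt_gt0 _ _)).
by rewrite -mulrA wtMN mulr1 ler_norm.
Qed.

(** The dense subspace [H_infty] lies in the domain of the conjugation, which multiplies each
    coefficient by a ratio of weights, bounded by [wt_translate]. *)
Lemma twist_bandop k (J : finType) (f : J -> I -> C) (gam : J -> I) :
  (forall j, bounded_fun (f j)) ->
  twist w k (bandop f gam) = bandop (fun j => twist_coef k (gam j) (f j)) gam.
Proof.
move=> bf; apply: bounded_extension_eq.
- apply: dense_sub dense_H_infty => x hx; split; first exact: hx.
  have : H_infty w (bandop f gam (absD w (- k) x)); last exact.
  apply: (@is_band_H_infty (@bounded_fun R d)); last exact: H_infty_absD.
    exact: bounded_growth.
  by apply: is_band_dom (bandop_is_band _ _ _) => //.
- by apply: bandop_bounded => j; exact: bounded_twist_coef.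
- move=> x [h1 h2]; apply: ell2P => mu.
  rewrite bandopE; last by move=> j; exact: bounded_twist_coef.
  rewrite [RHS]/= absDE//= bandopE// mulr_sumr; apply: eq_bigr => j _.
  by rewrite absDE// /twist_coef rmorphM/=; ring.
Qed.

Lemma twist_is_band K k T : K `<=` @bounded_fun R d ->
  (forall f gam, K f -> K (twist_coef k gam f)) ->
  is_band K setT T -> is_band K setT (twist w k T).
Proof.
move=> Kb Ktw /(is_band_bandop Kb)[J [f [gam [hf ->]]]].
by rewrite twist_bandop => [|j]; [apply: bandop_is_band => // j; exact: Ktw|exact: Kb].
Qed.

Lemma bandop_eq (J : finType) (f f' : J -> I -> C) (gam : J -> I) :
  (forall j mu, f j mu = f' j mu) -> bandop f gam = bandop f' gam.
Proof.
move=> ff'; have -> // : f = f'.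
by apply/funext => j; apply/funext => mu; exact: ff'.
Qed.


Lemma twist0 T : B T -> twist w 0 T = T.
Proof.
move=> /(is_band_bandop (fun=> id))[J [f [gam [hf ->]]]]; rewrite twist_bandop//.
by apply: bandop_eq => j mu; rewrite /twist_coef oppr0 !wt0 mulr1 mul1r.
Qed.

Lemma twist_twist k l T : B T -> twist w k (twist w l T) = twist w (k + l) T.
Proof.
move=> /(is_band_bandop (fun=> id))[J [f [gam [hf ->]]]]; rewrite !twist_bandop//.
  apply: bandop_eq => j mu; rewrite /twist_coef mulrA -rmorphM/= opprD -!wtM; congr (_%:C * _).
  by ring.
by move=> j; exact: bounded_twist_coef.
Qed.

Lemma twist_bounded k T : B T -> B (twist w k T).
Proof. by apply: twist_is_band => // f gam; exact: bounded_twist_coef. Qed.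

Lemma twistE k T x mu : B T -> H_infty w x ->
  twist w k T x mu = (wt k mu)%:C * T (absD w (- k) x) mu.
Proof.
move=> /(is_band_bandop (fun=> id))[J [f [gam [hf ->]]]] hx.
rewrite twist_bandop// !bandopE//; last by move=> j; exact: bounded_twist_coef.
rewrite mulr_sumr; apply: eq_bigr => j _.
by rewrite absDE// /twist_coef rmorphM/=; ring.
Qed.

Lemma B_bounded T : B T -> bounded_op T.
Proof. exact: is_band_bounded. Qed.

Lemma eq_on_H_infty (S T : H -> H) : bounded_op S -> bounded_op T ->
  (forall x, H_infty w x -> S x = T x) -> S = T.
Proof. by move=> bS bT; exact: bounded_op_eq_dense dense_H_infty bS bT. Qed.

Lemma B_star_algebra : star_algebra B.
Proof.
apply: star_algebra_band => //.
- by move=> c f [M hM]; exists (modulus c * M) => mu; rewrite modulusM ler_wpM2l ?modulus_ge0.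
- by move=> f h gam; exact: bounded_funM.
- by move=> f gam hf; apply: bounded_translate; exact: bounded_conjf.
Qed.

Lemma twist_lin k (c : C) S T : B S -> B T ->
  twist w k (c *: S + T) = c *: twist w k S + twist w k T.
Proof.
move=> BS BT; have [_ [_ AD AZ _] _] := B_star_algebra.
have BST : B (c *: S + T) by apply: AD => //; exact: AZ.
apply: eq_on_H_infty.
- by apply: B_bounded; exact: twist_bounded.
- by apply: B_bounded; apply: AD; [apply: AZ|]; exact: twist_bounded.
move=> x hx; apply: ell2P => mu; rewrite twistE//.
rewrite -[RHS]/(c * twist w k S x mu + twist w k T x mu) !twistE//.
by rewrite -[X in _ * X = _]/(c * S (absD w (- k) x) mu + T (absD w (- k) x) mu) mulrDr mulrCA.
Qed.

Lemma B_H_infty T x : B T -> H_infty w x -> H_infty w (T x).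
Proof.
move=> BT hx; apply: (@is_band_H_infty (@bounded_fun R d)) => //; first exact: bounded_growth.
exact: is_band_dom BT.
Qed.

Lemma absDK k x : H_infty w x -> absD w (- k) (absD w k x) = x.
Proof.
move=> hx; apply: ell2P => mu; rewrite absDE; last exact: H_infty_absD.
by rewrite absDE// mulrA -rmorphM/= [wt (- k) mu * _]mulrC wtMN mul1r.
Qed.

Lemma twist_absD k T x : B T -> H_infty w x ->
  twist w k T x = absD w k (T (absD w (- k) x)).
Proof.
move=> BT hx; apply: ell2P => mu; rewrite twistE// absDE//.
by apply: B_H_infty => //; exact: H_infty_absD.
Qed.

Lemma twist_comp k S T : B S -> B T -> twist w k (S \o T) = twist w k S \o twist w k T.
Proof.
move=> BS BT; have [_ [_ _ _ AM] _] := B_star_algebra.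
apply: eq_on_H_infty.
- by apply: B_bounded; apply: twist_bounded; exact: AM.
- by apply: B_bounded; apply: AM; exact: twist_bounded.
move=> x hx; have hx' := H_infty_absD (- k) hx.
rewrite twist_absD//; last exact: AM.
rewrite /= (twist_absD k BT)// twist_absD//; last by apply: H_infty_absD; exact: B_H_infty.
by rewrite absDK//; exact: B_H_infty.
Qed.

Lemma twist_adj k T : B T -> adj (twist w k T) = twist w (- k) (adj T).
Proof.
move=> /(is_band_bandop (fun=> id))[J [f [gam [hf ->]]]].
rewrite twist_bandop// !adj_bandop//; last by move=> j; exact: bounded_twist_coef.
rewrite twist_bandop; last by move=> j; apply: bounded_translate; exact: bounded_conjf.
apply: bandop_eq => j mu; rewrite /translate /conjf /twist_coef rmorphM/= conj_realC opprK mulVKg.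
by rewrite [wt k _ * _]mulrC.
Qed.

(** * Twisted commutators and the axioms of the triple *)

Definition finsupp f := exists X : seq I, forall mu, mu \notin X -> f mu = 0.

Lemma finsupp_bounded f : finsupp f -> bounded_fun f.
Proof.
move=> [X hX]; exists (\sum_(mu <- X) modulus (f mu)) => mu.
case: (boolP (mu \in X)) => [muX|/hX ->].
  rewrite (big_rem mu)//= lerDl sumr_ge0// => nu _; exact: modulus_ge0.
by rewrite modulus0 sumr_ge0// => nu _; exact: modulus_ge0.
Qed.

(** The twist cancels the modulus of D on the right of the coefficient, so a difference of two signs
    is all that remains beside the weight at [mu]. *)
Definition tcomm_coef gam f : I -> C := fun mu =>
  (wt 1 mu * (sgn mu - sgn (gam * mu)%g))%:C * f mu.

(* The sign of D is almost invariant under translations. *)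
Lemma finsupp_tcomm_coef gam f : finsupp (tcomm_coef gam f).
Proof.
exists (words_le d (2 * size gam)) => mu hmu; rewrite /tcomm_coef.
have h : (sgn mu = sgn (gam * mu)%g).
  rewrite /sgn -/g; case: (boolP ((Ll g (gam * mu)%g == 0%N) != (Ll g mu == 0%N))).
    by move=> /sign_change /mem_words_le; rewrite (negPf hmu).
  by rewrite negbK => /eqP ->.
by rewrite h subrr mulr0 mul0r.
Qed.

Lemma bandop_domD (J : finType) (f : J -> I -> C) (gam : J -> I) x :
  (forall j, bounded_fun (f j)) -> domD w x -> domD w (bandop f gam x).
Proof.
move=> bf /(domDE) hx; apply/(domDE).
apply: (is_band_dom_absD (K := @bounded_fun R d) (U := setT)) => //.
exact: bandop_is_band.
Qed.

Lemma tcomm_fun_bandop (J : finType) (f : J -> I -> C) (gam : J -> I) x :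
  (forall j, bounded_fun (f j)) -> domD w x ->
  tcomm_fun w (twist w 1) (bandop f gam) x = bandop (fun j => tcomm_coef (gam j) (f j)) gam x.
Proof.
move=> bf hx; apply: ell2P => mu.
have bt j : bounded_fun (tcomm_coef (gam j) (f j)) by apply: finsupp_bounded; exact: finsupp_tcomm_coef.
rewrite (bandopE _ _ _ bt) /tcomm_fun -[LHS]/(Dop w (bandop f gam x) mu
  - twist w 1 (bandop f gam) (Dop w x) mu).
rewrite (DopE _ (bandop_domD gam bf hx)) (twist_bandop 1 gam bf) (bandopE _ _ _ bf).
rewrite bandopE; last by move=> j; exact: bounded_twist_coef.
rewrite mulr_sumr -sumrB; apply: eq_bigr => j _.
rewrite (DopE _ hx) /twist_coef /tcomm_coef !(w_wt).
have := wtMN 1 (gam j * mu)%g.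
set a := wt 1 mu; set b := wt 1 (gam j * mu)%g; set b' := wt (-1) _.
set s := sgn mu; set s' := sgn _ => bb'.
transitivity ((a * s)%:C * (f j mu * x (gam j * mu)%g)
    - (a * s' * (b * b'))%:C * (f j mu * x (gam j * mu)%g)).
  by rewrite !rmorphM/=; ring.
by rewrite bb' mulr1 !rmorphM rmorphB/=; ring.
Qed.

Lemma tcomm_bandop (J : finType) (f : J -> I -> C) (gam : J -> I) :
  (forall j, bounded_fun (f j)) ->
  tcomm w (twist w 1) (bandop f gam) = bandop (fun j => tcomm_coef (gam j) (f j)) gam.
Proof.
move=> bf; apply: bounded_extension_eq.
- by apply: dense_finsupp; exact: diag_dom_finsupp.
- by apply: bandop_bounded => j; apply: finsupp_bounded; exact: finsupp_tcomm_coef.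
- by move=> x hx; rewrite tcomm_fun_bandop.
Qed.

Lemma tcomm_finsupp T : B T -> is_band finsupp setT (tcomm w (twist w 1) T).
Proof.
move=> /(is_band_bandop (fun=> id))[J [f [gam [hf ->]]]]; rewrite tcomm_bandop//.
by apply: bandop_is_band => [|j]; [exact: finsupp_bounded|exact: finsupp_tcomm_coef].
Qed.

Lemma partial_twist_sub (A : set (H -> H)) : A `<=` B -> partial_twist (twist w 1) A.
Proof.
move=> AB; exists B; split => //.
- exact: B_star_algebra.
- by move=> a Ba; apply: B_bounded; exact: twist_bounded.
- by move=> a b Ba Bb; exact: twist_comp.
- move=> a Ba; have [_ _ Badj] := B_star_algebra.
  have Bta := twist_bounded 1 Ba.
  split; first exact: Badj.
  rewrite -(twist_adj (-1)%R Bta).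
  by rewrite (twist_twist _ _ Ba) addNr (twist0 Ba).
Qed.

Lemma modulus_resolvent mu : modulus ((Num.sqrt (1 + w mu ^+ 2))^-1)%:C <= wt (-1) mu.
Proof.
rewrite modulus_real ger0_norm ?invr_ge0 ?sqrtr_ge0//.
rewrite /wt mulN1r expRN lef_pV2 ?posrE ?expR_gt0//; last first.
  by rewrite sqrtr_gt0 ltr_wpDr ?sqr_ge0.
rewrite -(abs_D_af) -sqrtr_sqr ler_sqrt ?lerDr//.
by rewrite addr_ge0 ?sqr_ge0.
Qed.

Lemma wtN1_small (e : R) : 0 < e ->
  exists X : seq I, forall mu, mu \notin X -> wt (-1) mu <= e.
Proof.
move=> e0; pose n := (Num.truncn e^-1).+1.
have [X [_ _ hX]] := height_growth_fgroup g n; exists X => mu muX.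
have hn : (n < hgt mu)%N by rewrite ltnNge; apply: contra muX => /hX.
rewrite /wt -/g mulN1r expRN -[leRHS]invrK lef_pV2 ?posrE ?expR_gt0 ?invr_gt0//.
apply: (@le_trans _ _ (n%:R : R)); first by rewrite ltW// truncnS_gt.
apply: (@le_trans _ _ (1 + (hgt mu)%:R)); last exact: expR_ge1Dx.
by rewrite addrC natr1 ler_nat; lia.
Qed.

Lemma weakly_twisted_sub (A : set (H -> H)) : star_algebra A -> A `<=` B ->
  weakly_twisted_spectral_triple w (twist w 1) A.
Proof.
move=> sA AB; split => //; first exact: self_adjoint_diag.
  exact: partial_twist_sub.
move=> a /AB Ba; have [J [f [gam [hf aE]]]] := is_band_bandop (fun=> id) Ba.
split.
- by rewrite aE => x; exact: bandop_domD.
- have bT : bounded_op (bandop (fun j => tcomm_coef (gam j) (f j)) gam).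
    by apply: bandop_bounded => j; apply: finsupp_bounded; exact: finsupp_tcomm_coef.
  have [M _ hM] := bounded_op_bound bT.
  by exists M => x hx; rewrite aE tcomm_fun_bandop.
- apply: (@compact_comp_diag _ _ _ _ 1); first exact: B_bounded.
    move=> mu; apply: le_trans (modulus_resolvent mu) _.
    by rewrite /wt mulN1r -expR0 ler_expR oppr_le0.
  move=> e e0; have [X hX] := wtN1_small e0; exists X => mu muX.
  exact: le_trans (modulus_resolvent mu) (hX _ muX).
Qed.

Lemma modulus_shifted_resolvent mu : modulus ((w mu +i* 1)^-1 : C) <= wt (-1) mu.
Proof.
rewrite /wt mulN1r expRN modulusV /modulus /= expr1n lef_pV2 ?posrE ?expR_gt0//.
  rewrite -(abs_D_af) -sqrtr_sqr ler_sqrt ?lerDl//.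
  by rewrite addr_ge0 ?sqr_ge0.
by rewrite sqrtr_gt0 ltr_wpDl ?sqr_ge0.
Qed.

Lemma growth_rate_gt1 : (1 < d)%N -> (1 < (d * 2).+1 ^ 2)%N.
Proof. by move=> d1; rewrite -(exp1n 2) ltn_exp2r// ltnS muln_gt0 ltnW. Qed.

Lemma finitely_summable_D_af : (1 < d)%N -> finitely_summable w.
Proof.
move=> /growth_rate_gt1; set Q := ((d * 2).+1 ^ 2)%N => Q1.
have Q0 : 0 < Q%:R ^+ 2 :> R by rewrite exprn_gt0// ltr0n ltnW.
(* A generous exponent: the required [Q ^ 2 <= exp p] follows from [1 + p <= exp p]. *)
exists (Q%:R ^+ 2) => //.
have hS : bounded_op (idfun : H -> H).
  by split => //; exists 1 => x _; rewrite mul1r.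
apply: (@schatten_comp_diag _ _ hgt Q _ 1 1 idfun _ (height_growth_fgroup g)) => //.
  by move=> mu; rewrite mul1r -mulNr; exact: modulus_shifted_resolvent.
by rewrite mul1r; apply: le_trans (expR_ge1Dx _); rewrite lerDr.
Qed.

(** All bounded bands form the algebra, with the twist itself as [theta]. As the twist is
    conjugation by |D|, the twisted commutator with |D| is zero. *)
Lemma regular_sub (A : set (H -> H)) : A `<=` B -> regular_triple w (twist w 1) A.
Proof.
move=> AB; exists B, (twist w 1); split => //.
- exact: B_star_algebra.
- move=> _ [a Aa <-]; apply: is_band_sub (tcomm_finsupp (AB _ Aa)).
  exact: finsupp_bounded.
split.
- split.
  + by move=> T BT; exact: twist_bounded.
  + move=> S T; rewrite !inE => BS BT e.
    have := congr1 (twist w (-1)) e.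
    by rewrite (twist_twist _ _ BS) (twist_twist _ _ BT) addNr (twist0 BS) (twist0 BT).
  + move=> T BT; exists (twist w (-1) T); first exact: twist_bounded.
    by rewrite (twist_twist _ _ BT) subrr (twist0 BT).
- by move=> c a b Ba Bb; exact: twist_lin.
- move=> b Bb; exists 0; first exact: is_band0.
  have [J [f [gam [hf ->]]]] := is_band_bandop (fun=> id) Bb.
  move=> x hx; have hbx : dom_absD w 1 (bandop f gam x).
    by apply: (is_band_dom_absD (K := @bounded_fun R d) (U := setT)) => //; exact: bandop_is_band.
  split => //; apply: ell2P => mu.
  rewrite -[LHS]/(absD w 1 (bandop f gam x) mu - twist w 1 (bandop f gam) (absD w 1 x) mu).
  rewrite (absDE _ hbx) (twist_bandop 1 gam hf) (bandopE _ _ _ hf).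
  rewrite bandopE; last by move=> j; exact: bounded_twist_coef.
  rewrite mulr_sumr -sumrB big1// => j _.
  rewrite (absDE _ hx) /twist_coef; have := wtMN 1 (gam j * mu)%g.
  set a1 := wt 1 mu; set b1 := wt 1 (gam j * mu)%g; set b2 := wt (-1) _ => bb.
  transitivity (a1%:C * (f j mu * x (gam j * mu)%g)
    - (a1 * (b1 * b2))%:C * (f j mu * x (gam j * mu)%g)); last by rewrite bb mulr1 subrr.
  by rewrite !rmorphM/=; ring.
Qed.

(** * The crossed product and its saturation *)

Definition bdry_fun : set (I -> C) :=
  [set f | exists2 a : boundary d -> C, locally_constant a & f = fun mu => a (bact mu t)].

Lemma bdry_fun_bounded : bdry_fun `<=` @bounded_fun R d.
Proof. by move=> f [a ha ->]; exact: locally_constant_bounded. Qed.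

Lemma bdry_fun_FF : bdry_fun `<=` FF.
Proof. by move=> f [a ha ->]; exact: FF_locally_constant. Qed.

Lemma star_algebra_bdry : star_algebra (is_band bdry_fun setT).
Proof.
apply: star_algebra_band.
- exact: bdry_fun_bounded.
- move=> c f [a ha ->]; exists (fun s => c * a s) => //.
  by apply: (locally_constant_op (fun _ z => c * z) ha ha).
- move=> f h gam [a ha ->] [b hb ->]; exists (fun s => a s * b (bact gam s)).
    by apply: (locally_constant_op *%R ha); exact: locally_constant_bact.
  by apply/funext => mu; rewrite bactM.
- move=> f gam [a ha ->]; exists (fun s => (a (bact gam s) : R[i])^*).
    have hag := locally_constant_bact gam ha.
    by apply: (locally_constant_op (fun _ z => (z : R[i])^*) hag hag).
  by apply/funext => mu; rewrite /translate /conjf bactM.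
Qed.

(** In coordinates, [a lambda_gamma] takes [x] to [a (nu t) x (gamma^-1 nu)]: the coefficient no
    longer involves gamma, and the translation is by the inverse. *)
Lemma crossed_product_band : A0 = is_band bdry_fun setT.
Proof.
apply/seteqP; split => T.
  move=> [bT [n [a [gam [ha hT]]]]].
  pose f (j : 'I_n) mu := a j (bact mu t).
  have hf j : bdry_fun (f j) by exists (a j).
  have bf j : bounded_fun (f j) by apply: bdry_fun_bounded.
  suff -> : T = bandop f (fun j => (gam j)^-1%g).
    by apply: bandop_is_band => //; exact: bdry_fun_bounded.
  apply: bounded_op_eq_delta => //; first exact: bandop_bounded.
  move=> mu; apply: ell2P => nu; rewrite hT bandopE// ell2_sum; apply: eq_bigr => j _.
  rewrite -[LHS]/(a j (bact (gam j * mu)%g t) * delta R (gam j * mu)%g nu) !delta_val.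
  have -> : (nu == gam j * mu)%g = ((gam j)^-1 * nu == mu)%g.
    by apply/eqP/eqP => [->|<-]; rewrite ?mulKg ?mulVKg.
  by case: eqP => [<-|_]; rewrite ?mulr0// mulVKg.
move=> hT; split; first exact: is_band_bounded bdry_fun_bounded hT.
have [J [f [gam [hf TE]]]] := is_band_bandop bdry_fun_bounded hT.
have bf j : bounded_fun (f j) by apply: bdry_fun_bounded.
have /choice [a ha] j : exists a : boundary d -> C,
    locally_constant a /\ f j = fun mu => a (bact mu t).
  by have [a h1 h2] := hf j; exists a.
exists #|J|, (fun i => a (enum_val i)), (fun i => (gam (enum_val i))^-1%g); split.
  by move=> i; have [] := ha (enum_val i).
move=> mu; apply: ell2P => nu; rewrite TE bandopE// ell2_sum.
rewrite (reindex (@enum_val J predT)) /=; last first.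
  by exists enum_rank => j _; rewrite ?enum_valK ?enum_rankK.
apply: eq_bigr => i _; set j := enum_val i; have [_ ->] := ha j.
rewrite -[RHS]/(a j (bact ((gam j)^-1 * mu)%g t) * delta R ((gam j)^-1 * mu)%g nu) !delta_val.
have -> : (nu == (gam j)^-1 * mu)%g = (gam j * nu == mu)%g.
  by apply/eqP/eqP => [->|<-]; rewrite ?mulKg ?mulVKg.
by case: eqP => [<-|_]; rewrite ?mulr0// mulKg.
Qed.

Definition FFb : set (I -> C) := [set f | FF f /\ bounded_fun f].

Lemma FF_wt (k : int) : FF (fun mu => (wt k mu)%:C : C).
Proof. exact: FF_expheight. Qed.

Lemma star_algebra_FFb : star_algebra (is_band FFb setT).
Proof.
apply: star_algebra_band.
- by move=> f [].
- move=> c f [hf [M hM]]; split; first exact: FFZ.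
  by exists (modulus c * M) => mu; rewrite modulusM ler_wpM2l ?modulus_ge0.
- move=> f h gam [hf bf] [hh bh]; split; last exact: bounded_funM.
  by apply: FFM => //; exact: FF_translate.
- move=> f gam [hf bf]; split; last by apply: bounded_translate; exact: bounded_conjf.
  by apply: FF_translate; exact: FF_conj.
Qed.

Lemma FFb_twist_coef k gam f : FFb f -> FFb (twist_coef k gam f).
Proof.
move=> [hf bf]; split; last exact: bounded_twist_coef.
apply: FFM => //.
rewrite (_ : (fun=> _) = (fun mu => (wt k mu)%:C * (wt (- k) (gam * mu)%g)%:C)).
  apply: FFM; first exact: FF_wt.
  exact: (FF_translate gam (FF_wt (- k))).
by apply/funext => mu; rewrite rmorphM.
Qed.


Lemma crossed_product_B : A0 `<=` B.
Proof. by rewrite crossed_product_band; move=> T; apply: is_band_sub; exact: bdry_fun_bounded. Qed.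

Lemma saturation_FFb : A `<=` is_band FFb setT.
Proof.
apply: smallest_sub; first exact: star_algebra_FFb.
move=> _ [k _ [T hT <-]]; apply: (twist_is_band); first by move=> f [].
  by move=> f gam; exact: FFb_twist_coef.
move: hT; rewrite crossed_product_band; apply: is_band_sub => f hf.
by split; [exact: bdry_fun_FF|exact: bdry_fun_bounded].
Qed.

Lemma saturation_B : A `<=` B.
Proof. by move=> T /saturation_FFb; apply: is_band_sub => f []. Qed.

Lemma star_algebra_saturation : star_algebra A.
Proof.
have AS : A `<=` @bounded_op R I by move=> T /saturation_B; exact: B_bounded.
split => //.
  split.
  - by move=> M [[_ [M0 _ _ _] _] _].
  - by move=> S T hS hT M hM; have [[_ [_ MD _ _] _] _] := hM; apply: MD; [exact: hS|exact: hT].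
  - by move=> c T hT M hM; have [[_ [_ _ MZ _] _] _] := hM; apply: MZ; exact: hT.
  - by move=> S T hS hT M hM; have [[_ [_ _ _ MM] _] _] := hM; apply: MM; [exact: hS|exact: hT].
by move=> T hT M hM; have [[_ _ Madj] _] := hM; apply: Madj; exact: hT.
Qed.

Lemma sub_saturation k : twist w k @` A0 `<=` A.
Proof. by move=> T hT; apply: sub_gen_smallest; exists k. Qed.

(** The elements all of whose twists stay in [A] form a *-algebra containing the generators;
    adjoints merely reverse the sign of the exponent. *)
Lemma saturation_twist k T : A T -> A (twist w k T).
Proof.
suff key : A `<=` [set T | A T /\ forall l, A (twist w l T)] by move=> /key[].
apply: smallest_sub; last first.
  move=> _ [l _ [S hS <-]]; split; first by apply: sub_saturation; exists S.
  move=> m; apply: (@sub_saturation (m + l)); exists S => //.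
  by rewrite (twist_twist)//; exact: crossed_product_B.
have [Ab [A00 AD AZ AM] Aadj] := star_algebra_saturation.
have tw l (c : C) S S' : A S -> A S' ->
    twist w l (c *: S + S') = c *: twist w l S + twist w l S'.
  by move=> hS hS'; apply: twist_lin => //; exact: saturation_B.
have tw0 l : twist w l 0 = 0.
  by have := tw l (-1) 0 0 A00 A00; rewrite scaler0 addr0 scaleN1r addNr.
split; first by move=> S [/Ab].
  split.
  - by split => // l; rewrite tw0.
  - move=> S S' [hS hS1] [hS' hS1']; split; first exact: AD.
    by move=> l; rewrite -[S]scale1r tw// scale1r; exact: AD.
  - move=> c S [hS hS1]; split; first exact: AZ.
    by move=> l; rewrite -[c *: S]addr0 tw// tw0 addr0; exact: AZ.
  - move=> S S' [hS hS1] [hS' hS1']; split; first exact: AM.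
    move=> l; rewrite (twist_comp _ (saturation_B hS) (saturation_B hS')).
    exact: AM.
move=> S [hS hS1]; split; first exact: Aadj.
move=> l; rewrite -[l]opprK -(twist_adj _ (saturation_B hS)); exact: Aadj.
Qed.

Lemma algebra_automorphism_saturation : algebra_automorphism (twist w 1) A.
Proof.
split.
- split.
  + by move=> T; exact: saturation_twist.
  + move=> S T; rewrite !inE => /saturation_B BS /saturation_B BT e.
    have := congr1 (twist w (-1)) e.
    by rewrite (twist_twist _ _ BS) (twist_twist _ _ BT) addNr (twist0 BS) (twist0 BT).
  + move=> T AT; exists (twist w (-1) T); first exact: saturation_twist.
    by rewrite (twist_twist _ _ (saturation_B AT)) subrr (twist0 (saturation_B AT)).
- by move=> c a b Aa Ab; apply: twist_lin => //; exact: saturation_B.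
- by move=> a b Aa Ab; apply: twist_comp => //; exact: saturation_B.
Qed.

Lemma crossed_product_saturation : A0 `<=` A.
Proof.
move=> T hT; apply: (@sub_saturation 0); exists T => //.
by rewrite (twist0 (crossed_product_B hT)).
Qed.

(** * The index of the compressed translation *)

Section IndexPairing.

Lemma dom_absDN1 x : dom_absD w (-1) x.
Proof.
apply: (ss_dom_absD); apply: (@square_summable_dom _ _ _ x 1) => mu.
rewrite modulusM modulus_wt ler_wpM2r ?modulus_ge0//.
by rewrite /wt mulN1r -expR0 ler_expR oppr_le0.
Qed.

Lemma FopE x mu : Fop w x mu = (sgn mu)%:C * x mu.
Proof.
have hx := dom_absDN1 x.
have e nu : (w nu)%:C * absD w (-1) x nu = (sgn nu)%:C * x nu.
  rewrite (absDE _ hx) (w_wt) mulrA -rmorphM -mulrA.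
  by rewrite [wt 1 nu * _](wtMN 1 nu) mulr1.
rewrite /Fop /= (DopE mu) ?e//.
apply: (@square_summable_dom _ _ _ x 1) => nu.
by rewrite /diag_fun e modulusM modulus_sgn.
Qed.

Lemma PopE x mu : Pop w x mu = if Ll g mu == 0%N then x mu else 0.
Proof.
rewrite -[LHS]/(2^-1 * (Fop w x mu + x mu)) FopE /sgn -/g.
case: eqP => _.
  have -> : 1%:C * x mu + x mu = 2 * x mu by rewrite rmorph1; ring.
  by rewrite mulKf// pnatr_eq0.
by rewrite rmorphN rmorph1 mulN1r addNr mulr0.
Qed.

Definition shift_gen : I := lgen (t 0%N).

Lemma shift_genV : shift_gen^-1%g = lgen g.
Proof. exact: val_inj. Qed.

Definition shift_op : H -> H := bandop (fun (_ : 'I_1) (_ : I) => 1 : C) (fun=> shift_gen^-1%g).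

Lemma bounded_fun1 : bounded_fun (fun _ : I => 1 : C).
Proof. by exists 1 => mu; rewrite modulus1. Qed.

Lemma shift_opE x mu : shift_op x mu = x (shift_gen^-1 * mu)%g.
Proof.
by rewrite bandopE => [|_]; [rewrite big_ord1 mul1r|exact: bounded_fun1].
Qed.

Lemma shift_op_crossed : A0 shift_op.
Proof.
rewrite (crossed_product_band); apply: bandop_is_band; first exact: bdry_fun_bounded.
by move=> _; exists (fun=> 1) => //; exact: locally_constant_cst.
Qed.

Lemma adj_shift_opE x mu : adj shift_op x mu = x (shift_gen * mu)%g.
Proof.
rewrite adj_bandop; last by move=> _; exact: bounded_fun1.
rewrite bandopE => [|_]; last by apply: bounded_translate; apply: bounded_conjf; exact: bounded_fun1.
by rewrite big_ord1 /translate /conjf conjC1 mul1r invgK.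
Qed.

Lemma shift_unitary : unitary_over (saturation w (A0))
  (fun _ _ : 'I_1 => shift_op).
Proof.
split.
- by move=> _ _; apply: (crossed_product_saturation); exact: shift_op_crossed.
- apply/funext => i; apply/funext => j; rewrite /matrix_mul big_ord1 /matrix_adj.
  rewrite /matrix_one (ord1 i) (ord1 j) eqxx; apply/funext => x; apply: ell2P => mu.
  by rewrite /= adj_shift_opE shift_opE mulKg.
- apply/funext => i; apply/funext => j; rewrite /matrix_mul big_ord1 /matrix_adj.
  rewrite /matrix_one (ord1 i) (ord1 j) eqxx; apply/funext => x; apply: ell2P => mu.
  by rewrite /= shift_opE adj_shift_opE mulVKg.
Qed.

Lemma Ll_lgen (l : letter d) mu : Ll g (lgen l * mu)%g = (lstep g l (dec g mu)).2.
Proof. by rewrite -dec_lgen. Qed.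

Lemma Ll_shift mu : Ll g mu = 0%N -> Ll g (shift_gen * mu)%g = 0%N.
Proof.
rewrite Ll_lgen -[Ll g mu]/(dec g mu).2.
case: (dec g mu) => [[|y v] k] /= ->; rewrite /lstep /=; last by case: ifP.
by rewrite ifF// /g; case: (t 0%N) => j b; rewrite /linv xpair_eqE eqxx /=; case: b.
Qed.

(** Multiplication by [g] lengthens the trail only when the core is empty, which with trail zero
    means at the identity; hence the cokernel is spanned by [delta R 1%g]. *)
Lemma Ll_unshift mu : mu != 1%g -> Ll g mu = 0%N -> Ll g (shift_gen^-1 * mu)%g = 0%N.
Proof.
rewrite shift_genV Ll_lgen -[Ll g mu]/(dec g mu).2 => mu1.
have : dec g mu != ([::], 0%N).
  apply: contra mu1 => /eqP e; apply/eqP; apply: (@core_trail_inj _ g); exact: e.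
by case: (dec g mu) => [[|y v] k] //= + k0; rewrite k0// /lstep /= => _; case: ifP.
Qed.

Lemma Ll_shift1 : Ll g (shift_gen^-1 * 1)%g = 1%N.
Proof. by rewrite shift_genV Ll_lgen /lstep /= eqxx. Qed.

Local Notation E := ('I_1 -> H).
Let V : set E := range (fun (x : E) i => Pop w (x i)).
Let T : E -> E := fun (x : E) i => Pop w (\sum_(j < 1) shift_op (Pop w (x j))).

Lemma toeplitzE (x : E) mu : T x ord0 mu =
  if (Ll g mu == 0%N) && (Ll g (shift_gen^-1 * mu)%g == 0%N)
  then x ord0 (shift_gen^-1 * mu)%g else 0.
Proof. by rewrite /T PopE big_ord1 shift_opE PopE; case: ifP. Qed.

Lemma range_PopP (x : E) : V x <-> forall mu, Ll g mu != 0%N -> x ord0 mu = 0.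
Proof.
split => [[y _ <-] mu /negPf h|h]; first by rewrite PopE h.
exists x => //; apply/funext => i; rewrite (ord1 i); apply: ell2P => mu.
by rewrite PopE; case: eqP => // /eqP /h.
Qed.

Lemma shift_index : index_pairing_is w (fun _ _ : 'I_1 => shift_op) (-1).
Proof.
rewrite /index_pairing_is -/T -/V; exists 0%N, 1%N; split => //.
- exists (fun=> 0); first by case.
  move=> x [/range_PopP Vx Tx]; exists (fun=> 0); split; last first.
    by move=> c _; apply/funext => -[].
  rewrite big_ord0 subr0; apply/funext => i; rewrite (ord1 i); apply: ell2P => mu.
  rewrite [RHS]/(0 : C); case: (eqVneq (Ll g mu) 0%N) => [h|]; last exact: Vx.
  have := congr1 (fun z : E => z ord0 (shift_gen * mu)%g) Tx.
  by rewrite toeplitzE Ll_shift// mulKg h.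
- exists (fun=> fun=> delta R 1%g).
    by move=> _; apply/range_PopP => mu /negPf h; rewrite delta_val; case: eqP => // e; rewrite e in h.
  move=> x /range_PopP Vx.
  have eqx (c : 'I_1 -> C) mu : (x - \sum_(i < 1) c i *: (fun=> delta R 1%g : H)) ord0 mu
      = x ord0 mu - c ord0 * (mu == 1%g)%:R.
    by rewrite big_ord1.
  exists (fun=> x ord0 1%g); split; last first.
    move=> c [y Vy e]; apply/funext => i; rewrite (ord1 i).
    have : (x - \sum_(i < 1) c i *: (fun=> delta R 1%g : H)) ord0 1%g = T y ord0 1%g by rewrite e.
    rewrite eqx toeplitzE eqxx mulr1 Ll_shift1 andbF => /eqP.
    by rewrite subr_eq0 => /eqP.
  (* Translating back and projecting gives a preimage, once the component at the identity has been
     removed. *)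
  exists (fun=> Pop w (adj shift_op (x ord0))).
    by apply/range_PopP => mu /negPf h; rewrite PopE h.
  apply/funext => i; rewrite (ord1 i); apply: ell2P => mu; rewrite eqx toeplitzE.
  case: (eqVneq (Ll g mu) 0%N) => h /=; last first.
    rewrite Vx//; case: eqVneq => [e|_]; last by rewrite mulr0 subr0.
    by rewrite e in h.
  case: (eqVneq mu 1%g) => [->|mu1]; first by rewrite Ll_shift1 /= mulr1 subrr.
  rewrite (Ll_unshift mu1 h) eqxx mulr0 subr0.
  by have := PopE (adj shift_op (x ord0)) (shift_gen^-1 * mu)%g;
    rewrite (Ll_unshift mu1 h) eqxx adj_shift_opE mulVKg.
Qed.

End IndexPairing.

(** * Dimension spectrum and residues of the ansatz *)

Hypothesis d1 : (1 < d)%N.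
Let q := (d * 2).-1.

Lemma FF_is_growth : FF `<=` growth.
Proof. by move=> f /FF_growth[M [m [M0 h]]]; exists M, m. Qed.

Lemma finsupp_FF : finsupp `<=` FF.
Proof. by move=> f [X hX]; exact: FF_finsupp hX. Qed.

Lemma FF_H_infty T x : is_band FF Hoo T -> Hoo x -> Hoo (T x).
Proof. exact: (is_band_H_infty FF_is_growth). Qed.

Lemma band_FF_comp S T : is_band FF Hoo S -> is_band FF Hoo T -> is_band FF Hoo (S \o T).
Proof.
move=> hS hT; apply: (is_band_comp _ _ hS hT) => [f h gam hf hh|x hx]; last exact: FF_H_infty hx.
by apply: FFM => //; exact: FF_translate.
Qed.

Lemma op_algebra_FF : op_algebra (is_band FF Hoo).
Proof.
split; [exact: is_band0|exact: is_bandD| |exact: band_FF_comp].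
by move=> c T; apply: is_bandZ => f; exact: FFZ.
Qed.

Lemma diagonal_band T f : FF f -> (forall x, Hoo x -> forall mu, T x mu = f mu * x mu) ->
  is_band FF Hoo T.
Proof.
move=> hf hT; exists 'I_1, (fun=> f), (fun=> 1%g); split => // x hx mu.
by rewrite big_ord1 mul1g; exact: hT.
Qed.

Lemma absD_band k : is_band FF Hoo (absD w k).
Proof.
apply: (diagonal_band (FF_wt k)) => x hx mu; exact: (absDE).
Qed.

Lemma Fop_band : is_band FF Hoo (Fop w).
Proof. by apply: (diagonal_band (FF_sgn)) => x hx mu; exact: FopE. Qed.

Lemma sq_band : is_band FF Hoo (fcalc w (fun r : R => (r ^+ 2)%:C)).
Proof.
apply: (diagonal_band (FF_wt 2)) => x hx mu.
have e nu : ((w nu) ^+ 2)%:C = (wt 2 nu)%:C :> C.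
  rewrite -(real_normK (num_real (w nu))) expr2.
  by rewrite -[`|w nu|]expr1 [_ ^+ 1](wtE 1 nu) wtM.
rewrite /fcalc diagE ?e//; rewrite /diag_dom/= (_ : diag_fun _ x = (fun mu => (wt 2 mu)%:C * x mu)).
  exact: (dom_absD_ss (hx 2)).
by apply/funext => nu; rewrite /diag_fun e.
Qed.

Lemma id_band : is_band FF Hoo idfun.
Proof. by apply: (diagonal_band (FF_cst g 1)) => x hx mu; rewrite mul1r. Qed.

Lemma A_band T : A T -> is_band FF Hoo T.
Proof.
move=> /(saturation_FFb) h; apply: is_band_dom (is_band_sub _ h) => // f [].
by [].
Qed.

Lemma tcomm_band T : A T -> is_band finsupp Hoo (tcomm w sigma T).
Proof.
by move=> /(saturation_B) BT; apply: is_band_dom (tcomm_finsupp BT).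
Qed.

Lemma Psi_band T : Psi w sigma A T -> is_band FF Hoo T.
Proof.
apply: smallest_sub; first exact: op_algebra_FF.
move=> S [[[->|AS]|[a Aa <-]]|[k _ <-]].
- exact: Fop_band.
- exact: A_band.
- by apply: is_band_sub (tcomm_band Aa); exact: finsupp_FF.
- exact: absD_band.
Qed.

Lemma cpow_Ee (n : nat) (z : C) : cpow (expR n%:R) (- (2 * z)) = Ee z ^+ n.
Proof.
rewrite /cpow expRK /Ee cexpX /cexp.
have -> : n%:R * - (2 * z) = (n%:R : R)%:C * - (2 * z) by rewrite rmorph_nat.
by case: (- (2 * z)) => a b /=; rewrite !mul0r subr0 addr0 ![n%:R * _]mulrC.
Qed.

Lemma modulus_EeX n (z : C) : modulus (Ee z ^+ n) = expR (- (2 * complex.Re z) * n%:R).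
Proof. by rewrite modulusX modulus_Ee -expRM_natl mulrC. Qed.

Lemma absD_cpowE (z : C) x mu : 0 <= complex.Re z ->
  absD_cpow w (- (2 * z)) x mu = Ee z ^+ hgt mu * x mu.
Proof.
move=> z0; have e nu : cpow `|w nu| (- (2 * z)) = Ee z ^+ hgt nu.
  by rewrite (abs_D_af) cpow_Ee.
rewrite /absD_cpow /fcalc (_ : (fun=> _) = fun nu => Ee z ^+ hgt nu); last exact/funext.
rewrite (@diagE _ _ _ x)//; apply: (@diag_dom_bounded _ _ _ 1 x) => nu.
by rewrite modulus_EeX -expR0 ler_expR mulNr oppr_le0 mulr_ge0// mulr_ge0.
Qed.

Lemma absD_cpow_H_infty (z : C) x : 0 <= complex.Re z -> Hoo x ->
  Hoo (absD_cpow w (- (2 * z)) x).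
Proof.
move=> z0 hx k; apply: (ss_dom_absD).
apply: (@square_summable_dom _ _ _ (Ell2 (dom_absD_ss (hx k))) 1) => nu /=.
rewrite absD_cpowE// mulrCA mul1r modulusM ler_piMl ?modulus_ge0//.
by rewrite modulus_EeX -expR0 ler_expR mulNr oppr_le0 mulr_ge0// mulr_ge0.
Qed.

(** Left translation by a non-trivial element has no fixed point, so only these terms reach the
    diagonal. *)
Definition diag_part (J : finType) (f : J -> I -> C) (gam : J -> I) : I -> C :=
  fun mu => \sum_(j | gam j == 1%g) f j mu.

(** For large real part of [z], a fixed share of the decay of |D|^(-2z) is trace class, and the rest
    outweighs the growth of the coefficients. *)
Lemma has_trace_band (J : finType) (f : J -> I -> C) (gam : J -> I) T :
  (forall j, FF (f j)) ->
  (forall x, Hoo x -> forall mu, T x mu = \sum_j f j mu * x (gam j * mu)%g) ->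
  exists x0 : R, forall z, x0 < complex.Re z ->
    has_trace w (T \o absD_cpow w (- (2 * z)))
      (csum (fun mu => diag_part f gam mu * Ee z ^+ hgt mu)).
Proof.
move=> hf hT.
have /choice [m hm] j : exists m : nat, exists M : R, forall mu, modulus (f j mu) <= M * wt m mu.
  by have [M [m [_ h]]] := FF_growth (hf j); exists m, M.
have Q1 := growth_rate_gt1 d1; set Q := ((d * 2).+1 ^ 2)%N in Q1.
pose s : R := Q%:R ^+ 2; have s0 : 0 <= s by exact: sqr_ge0.
have sQ : Q%:R ^+ 2 <= expR (s * 1).
  by rewrite mulr1; apply: le_trans (expR_ge1Dx _); rewrite lerDr.
move: s s0 sQ => s s0 sQ.
exists (s + (\sum_j m j)%:R) => z hz.
have z0 : 0 <= complex.Re z by apply: ltW; apply: le_lt_trans hz; rewrite addr_ge0.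
(* [diag k] is the trace class share. The sum of the [m j] in the abscissa bounds every growth
   exponent, which keeps the coefficients [F] bounded. *)
pose k mu : C := (expR (- (s * (hgt mu)%:R)))%:C.
pose F j mu : C := f j mu * (Ee z ^+ hgt (gam j * mu)%g * (expR (s * (hgt (gam j * mu)%g)%:R))%:C).
have kF mu : (expR (s * (hgt mu)%:R))%:C * k mu = 1 :> C.
  by rewrite -rmorphM -expRD subrr expR0.
have k1 mu : modulus (k mu) <= 1 * expR (- (s * (hgt mu)%:R)).
  by rewrite mul1r modulus_real ger0_norm// expR_ge0.
have k1' mu : modulus (k mu) <= 1.
  by apply: le_trans (k1 mu) _; rewrite mul1r -expR0 ler_expR oppr_le0 mulr_ge0.
have bF j : bounded_fun (F j).
  have [M hM] := hm j; have [N hN] := wt_translate (m j) (gam j).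
  exists (`|M| * `|N|) => mu; rewrite !modulusM modulus_EeX modulus_real (ger0_norm (expR_ge0 _)).
  rewrite -expRD; set h := hgt _.
  apply: (@le_trans _ _ ((`|M| * (`|N| * wt (m j) (gam j * mu)%g)) * wt (- (m j)%:Z) (gam j * mu)%g)).
    apply: ler_pM; rewrite ?modulus_ge0 ?expR_ge0//.
      apply: le_trans (hM mu) _; apply: (@le_trans _ _ (`|M| * wt (m j) mu)).
        by rewrite ler_wpM2r ?(ltW (wt_gt0 _ _))// ler_norm.
      rewrite ler_wpM2l//; apply: le_trans (hN mu) _.
      by rewrite ler_wpM2r ?(ltW (wt_gt0 _ _))// ler_norm.
    rewrite ler_expR -/h -mulrDl ler_wpM2r// rmorphN/=.
    have : (m j)%:R <= (\sum_j m j)%:R :> R by rewrite ler_nat (bigD1 j)//= leq_addr.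
    by move: hz z0; rewrite -[(m j)%:~R]/((m j)%:R); lra.
  by rewrite mulrA -mulrA (wtMN) mulr1.
have SE x mu : (bandop F gam \o diag k) x mu =
    \sum_j f j mu * (Ee z ^+ hgt (gam j * mu)%g * x (gam j * mu)%g).
  rewrite /= (bandopE _ _ _ bF); apply: eq_bigr => j _.
  rewrite (diagE _ (diag_dom_bounded x k1')) /F -!mulrA; congr (_ * (_ * _)).
  by rewrite mulrA kF mul1r.
exists (bandop F gam \o diag k); split.
- apply: (@schatten_comp_diag _ _ hgt Q 1 s 1 _ k (height_growth_fgroup g)) => //.
  exact: bandop_bounded.
- move=> x hx; apply: ell2P => mu; rewrite SE [RHS]hT; last exact: absD_cpow_H_infty.
  by apply: eq_bigr => j _; rewrite absD_cpowE.
- rewrite /trace; congr csum; apply/funext => mu; rewrite inner_deltal SE.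
  rewrite /diag_part mulr_suml [RHS]big_mkcond; apply: eq_bigr => j _; rewrite delta_val.
  case: (eqVneq (gam j) 1%g) => [->|gj]; first by rewrite mul1g eqxx mulr1.
  case: eqP => [e|_]; last by rewrite !mulr0.
  by move: gj; rewrite -(mulgK mu (gam j)) e mulgV eqxx.
Qed.

Lemma diag_part_FF (J : finType) (f : J -> I -> C) (gam : J -> I) :
  (forall j, FF (f j)) -> FF (diag_part f gam).
Proof.
move=> hf; rewrite (_ : diag_part f gam = \sum_(j | gam j == 1%g) f j).
  by elim/big_ind: _ => [||j _ //]; [exact: FF_cst|exact: FFD].
by apply/funext => mu; rewrite fct_sumE.
Qed.

Lemma dimension_spectrum : finite_discrete_dimension_spectrum w sigma A.
Proof.
have q0 : (0 < q)%N by rewrite /q; move: d1; lia.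
exists (@Sd R q), 4; split; first exact: discrete_Sd.
move=> T /Psi_band[J [f [gam [hf hT]]]].
have [x0 h0] := has_trace_band hf hT.
have [Z [Zh Zp] [x1 h1]] := FF_zeta d1 (diag_part_FF gam hf).
exists Z; last by move=> z; exact: pole_pole_order_le.
split.
- exists (Num.max x0 x1) => z; rewrite gt_max => /andP[/h0 ? /h1[_ <-]] //.
- by move=> z Sz; apply: holo_holomorphic_at; exact: Zh.
- by move=> z; exists 4; exact: pole_pole_order_le.
Qed.

Lemma finsupp_diag_part (J : finType) (f : J -> I -> C) (gam : J -> I) :
  (forall j, finsupp (f j)) -> finsupp (diag_part f gam).
Proof.
move=> /choice[X hX]; exists (flatten [seq X j | j <- enum J]) => mu hmu.
rewrite /diag_part big1// => j _; apply: hX; apply: contra hmu => muX.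
by apply/flatten_mapP; exists j; rewrite ?mem_enum.
Qed.

Lemma tau_finsupp j T : is_band finsupp Hoo T -> tau_is w j T 0.
Proof.
move=> [J [f [gam [hf hT]]]]; have hF i : FF (f i) by apply: finsupp_FF.
have [x0 h0] := has_trace_band hF hT.
(* Only absolute summability in a half-plane is taken from here; the continuation used is the finite
   sum [Z]. *)
have [Z0 _ [x1 h1]] := FF_zeta d1 (diag_part_FF gam hF).
have [Y hY] := finsupp_diag_part gam hf; pose X := undup Y.
have hX mu : mu \notin X -> diag_part f gam mu = 0 by rewrite mem_undup => /hY.
pose Z (z : C) := \sum_(mu <- X) diag_part f gam mu * Ee z ^+ hgt mu.
have eZ : entire Z.
  by apply: entire_sum => mu; apply: entireM; [exact: entire_cst|exact: entire_Ee].
have eid : entire (id : C -> C) by move=> s; exists 1; exact: qderiv_id.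
exists set0, Z; split; first by move=> z; apply: nearW => s [].
  split.
  - exists (Num.max x0 x1) => z; rewrite gt_max => /andP[/h0 hz /h1[cs _]].
    rewrite (_ : Z z = csum (fun mu => diag_part f gam mu * Ee z ^+ hgt mu))//.
    apply/esym/(csum_eq cs); apply: hassum_fin; first exact: undup_uniq.
    by move=> mu /hX ->; rewrite mul0r.
  - by move=> z _; apply: holo_holomorphic_at; exact: entire_holo.
  - by move=> z; exists 0%N; apply: pole_pole_order_le; exact: pole_entire.
exists 0%N, (fun=> 0), (fun z => z ^+ j * Z z); split => //.
  apply: holo_holomorphic_at; apply: entire_holo; apply: entireM => //.
  exact: (entireX j eid).
by apply: nearW => s; rewrite big1 ?addr0// => i _; rewrite mul0r.
Qed.

Lemma finsupp_compl S T : is_band FF Hoo S -> is_band finsupp Hoo T ->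
  is_band finsupp Hoo (S \o T).
Proof.
move=> hS hT; apply: (is_band_comp _ _ hS hT) => [f h gam _ [X hX]|x hx].
  exists [seq (gam^-1 * mu)%g | mu <- X] => mu hmu; rewrite hX ?mulr0//.
  apply: contra hmu => muX; rewrite -(mulKg gam mu); exact: map_f.
by apply: (FF_H_infty) hx; apply: is_band_sub hT; exact: finsupp_FF.
Qed.

Lemma finsupp_compr S T : is_band finsupp Hoo S -> is_band FF Hoo T ->
  is_band finsupp Hoo (S \o T).
Proof.
move=> hS hT; apply: (is_band_comp _ _ hS hT) => [f h gam [X hX] _|x hx].
  by exists X => mu /hX ->; rewrite mul0r.
exact: (FF_H_infty) hx.
Qed.

Lemma iter_tcomm2_finsupp k T : is_band finsupp Hoo T ->
  is_band finsupp Hoo (iter_tcomm2 w k T).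
Proof.
move=> hT; elim: k => //= k IH; apply: is_bandD.
  by apply: finsupp_compl => //; exact: (sq_band).
rewrite -scaleN1r; apply: is_bandZ.
  by move=> f [X hX]; exists X => mu /hX ->; rewrite mulr0.
apply: finsupp_compr _ (sq_band); apply: finsupp_compr _ (absD_band _).
by apply: finsupp_compl => //; exact: (absD_band).
Qed.

Lemma ansatz_op_finsupp m (k : {ffun 'I_m -> nat}) (a : 'I_m.+1 -> H -> H) :
  odd m -> (forall i, A (a i)) -> is_band finsupp Hoo (ansatz_op w k a).
Proof.
(* An odd [m] is positive, so that at least one twisted commutator occurs. *)
case: m k a => // m k a _ ha.
have hk (i : 'I_m.+1) : is_band finsupp Hoo (iter_tcomm2 w (k i)
    (tcomm w sigma (twist w (- (2 * mi_prefix k i)%:Z - 1) (a (lift ord0 i))))).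
  by apply: iter_tcomm2_finsupp; apply: (tcomm_band); exact: (saturation_twist).
apply: finsupp_compr; last exact: (absD_band).
apply: finsupp_compl.
  by apply: (band_FF_comp); [exact: (Fop_band)|exact: (A_band)].
(* The first commutator supplies the finite support; the remaining factors only have to preserve
   [H_infty] and the class of coefficients. *)
rewrite big_ord_recl; apply: finsupp_compr => //.
elim/big_ind: _ => [|S T hS hT|i _]; first exact: id_band.
  exact: band_FF_comp.
by apply: is_band_sub (hk _); exact: finsupp_FF.
Qed.

Lemma moscovici_cochain_zero : moscovici_cochain w A (fun _ _ => 0).
Proof.
move=> m a om ha; exists (fun _ _ => 0); split.
  by move=> j k _; apply: tau_finsupp; exact: ansatz_op_finsupp.
move=> /=; rewrite (_ : (fun k => _) = fun=> 0); last first.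
  by apply/funext => k; rewrite big1 ?mulr0// => j _; rewrite mulr0.
have cs : csummable (fun _ : {ffun 'I_m -> nat} => 0 : C).
  by apply: (@csummable_bound _ _ _ 0) => X _; rewrite big1// => k _; rewrite modulus0.
by split => //; apply/esym/(csum_eq cs); exact: hassum0.
Qed.

End FixedPoint.

Lemma chern_pairing_zero (R : realType) (J : choiceType) N
    (u : 'I_N -> 'I_N -> ell2 R J -> ell2 R J) :
  chern_pairing_is (fun _ _ => 0) u 0.
Proof.
rewrite /chern_pairing_is (_ : series _ = fun=> 0); first exact: cvg_cst.
by apply/funext => n; rewrite /series /= big1// => l _; rewrite /chern_term big1 ?mulr0.
Qed.

Local Close Scope classical_set_scope.
Local Close Scope complex_scope.

Theorem theorem3p10 (R : realType) (d : nat) (t : boundary d) :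
  (1 < d)%N -> shift_map t = t ->
  let D := D_af R t in
  let sigma := twist D 1 in
  let A0 := @crossed_product R d t in
  let A := saturation D A0 in
  [/\ weakly_twisted_spectral_triple D sigma A0,
      [/\ twisted_spectral_triple D sigma A,
          regular_triple D sigma A,
          finitely_summable D
        & finite_discrete_dimension_spectrum D sigma A],
      pairs_nontrivially_with_K1 D A
    & exists phi : cochain R (fgroup d),
        [/\ moscovici_cochain D A phi,
            forall m (a : 'I_m.+1 -> ell2 R (fgroup d) -> ell2 R (fgroup d)),
              odd m -> (forall i, A (a i)) -> phi m a = 0
          & forall kappa : R[i],
              ~ (forall N (u : 'I_N -> 'I_N ->
                               ell2 R (fgroup d) -> ell2 R (fgroup d)),
                   unitary_over A u ->
                   forall (c : R[i]) (n : int),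
                     chern_pairing_is phi u c -> index_pairing_is D u n ->
                     kappa * c = n%:~R)]].
Proof.
move=> d1 ht D sigma A0 A; split.
- apply: (weakly_twisted_sub ht); last exact: (crossed_product_B ht).
  by rewrite /A0 (crossed_product_band R ht); exact: (star_algebra_bdry R ht).
- split.
  + split; last exact: (algebra_automorphism_saturation R ht).
    apply: (weakly_twisted_sub ht); first exact: (star_algebra_saturation R ht).
    exact: (saturation_B ht).
  + by apply: (regular_sub ht); exact: (saturation_B ht).
  + exact: (finitely_summable_D_af R ht).
  + exact: (dimension_spectrum R ht).
- exists 1%N, (fun _ _ => @shift_op R d t); split; first exact: (shift_unitary R ht).
  by exists (-1); first exact: (shift_index R ht).
- exists (fun _ _ => 0); split => //; first exact: (moscovici_cochain_zero ht d1).
  move=> kappa h.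
  (* At the class of the translation the equality reads [kappa * 0 = -1], which no normalisation can
     repair. *)
  have /eqP := h _ _ (shift_unitary R ht) _ _ (chern_pairing_zero _) (shift_index R ht).
  by rewrite mulr0 rmorphN rmorph1 eq_sym oppr_eq0 oner_eq0.
Qed.
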